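(* Let $H(\mathcal U)$ be the space of holomorphic functions in $\mathcal U$. For any $r>0$, we have $$\mathcal B=H(\mathcal U)\cap BMO_r\qquad\text{and}\qquad \mathcal B_0=H(\mathcal U)\cap VMO_r .$$ Moreover, $\|f\|_{\mathcal B}$ and $\|f\|_{BMO_r}$ are equivalent quantities.
   Context: Write $z=(z',z_n)\in\mathbb C^{n-1}\times\mathbb C$, $z\cdot\overline w=\sum_j z_j\overline{w}_j$, and let $\mathcal U=\{z\in\mathbb C^n:\operatorname{Im} z_n>|z'|^2\}$ be the Siegel upper half-space with Lebesgue measure $V$; $L^2(\mathcal U)$ is taken with respect to $V$. Put $\rho(z,w)=\frac i2(\overline{w}_n-z_n)-z'\cdot\overline{w'}$ and $\rho(z)=\rho(z,z)=\operatorname{Im}z_n-|z'|^2$. Bergman metric: $\beta(z,w)=\tanh^{-1}\sqrt{1-\rho(z)\rho(w)/|\rho(z,w)|^2}$; $D(z,r)=\{w\in\mathcal U:\beta(z,w)<r\}$, $|D(z,r)|=V(D(z,r))$. $z\to\partial\widehat{\mathcal U}$ means $\rho(z)\to0$ or $|z|\to\infty$. $C_0(\mathcal U)$ is the space of complex-valued continuous functions $f$ on $\mathcal U$ with $f(z)\to0$ as $z\to\partial\widehat{\mathcal U}$. For $r>0$ and $f\in L^2(\mathcal U)$, $\widehat f_r(z)=\frac1{|D(z,r)|}\int_{D(z,r)}f\,dV$ and $MO_r(f)(z)=\Big(\frac1{|D(z,r)|}\int_{D(z,r)}|f(w)-\widehat f_r(z)|^2dV(w)\Big)^{1/2}$.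 The space $BMO_r$ consists of those $f\in L^2(\mathcal U)$ for which $\|f\|_{BMO_r}=\sup_{z\in\mathcal U}MO_r(f)(z)$ is finite; $VMO_r$ consists of those $f\in L^2(\mathcal U)$ for which $MO_r(f)\in C_0(\mathcal U)$. For $f\in H(\mathcal U)$ the invariant gradient is $$|\widetilde\nabla f(z)|=\Big(2\rho(z)\Big(4\rho(z)\Big|\frac{\partial f}{\partial z_n}(z)\Big|^2+\sum_{j=1}^{n-1}\Big|\frac{\partial f}{\partial z_j}(z)+2i\overline z_j\frac{\partial f}{\partial z_n}(z)\Big|^2\Big)\Big)^{1/2}.$$ The Bloch space $\mathcal B$ is the space of $f\in H(\mathcal U)$ with $\|f\|_{\mathcal B}=\sup_{z\in\mathcal U}|\widetilde\nabla f(z)|<\infty$; the little Bloch space $\mathcal B_0$ consists of the $f\in\mathcal B$ with $|\widetilde\nabla f|\in C_0(\mathcal U)$. Two quantities are equivalent if each is bounded by a positive constant, independent of $f$, times the other.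
   Formalization: BMO_r and VMO_r are taken with f locally square integrable on U instead of f in L^2(U); with L^2(U) the claim fails, since U has infinite volume and the constant 1 is in B and B_0 but not in L^2(U). *)

(* Defs.v *)
From HB Require Import structures.
From mathcomp Require Import all_boot all_order all_algebra.
From mathcomp Require Import complex.
From mathcomp Require Import all_classical all_reals all_analysis.

Set Implicit Arguments.
Unset Strict Implicit.
Unset Printing Implicit Defensive.

Import Order.TTheory GRing.Theory Num.Theory.
Import numFieldNormedType.Exports.
Import Normc.

Local Open Scope classical_set_scope.
Local Open Scope ring_scope.
Local Open Scope complex_scope.

(* The topology and norm of R[i] as a normed space over itself. *)
#[non_forgetful_inheritance]
HB.instance Definition _ (R : realType) := NormedModule.copy R[i] R[i]^o.

Section lebesgue_measure_tuple.
Context {R : realType}.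

Definition consT k (x : measurableTypeR R * k.-tuple R) : k.+1.-tuple R :=
  [tuple of x.1 :: x.2].

Lemma measurable_consT k : measurable_fun setT (@consT k).
Proof. exact: measurable_cons. Qed.

Definition unconsT k (t : k.+1.-tuple R) : measurableTypeR R * k.-tuple R :=
  (thead t, [tuple of behead t]).

Lemma consTK k : cancel (@consT k) (@unconsT k).
Proof.
by move=> [x t]; rewrite /unconsT /consT /= theadE; congr pair; exact/val_inj.
Qed.

Lemma measurable_unconsT k : measurable_fun setT (@unconsT k).
Proof.
apply: measurable_fun_pair; last exact: measurable_behead.
exact: measurable_tnth.
Qed.

Section step.
Variables (k : nat) (m : {sigma_finite_measure set (k.-tuple R) -> \bar R}).

Definition lebesgue_step : set (k.+1.-tuple R) -> \bar R :=
  pushforward (@lebesgue_measure R \x m)%E (@consT k).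

Let lebesgue_step0 : lebesgue_step set0 = 0%E.
Proof. by rewrite /lebesgue_step /pushforward preimage_set0 measure0. Qed.

Let mcons A : measurable A -> measurable (@consT k @^-1` A).
Proof.
by move=> mA; rewrite -[X in measurable X]setTI; exact: measurable_consT.
Qed.

Let lebesgue_step_ge0 A : (0 <= lebesgue_step A)%E.
Proof. by apply: integral_ge0 => x _; exact: measure_ge0. Qed.

Let lebesgue_step_sigma_additive : semi_sigma_additive lebesgue_step.
Proof.
move=> F mF tF mUF; rewrite /lebesgue_step /pushforward preimage_bigcup.
apply: measure_semi_sigma_additive => [n| |].
- exact: mcons.
- apply/trivIsetP => /= i j _ _ ij; rewrite -preimage_setI.
  by move/trivIsetP : tF => /(_ _ _ _ _ ij) ->//; rewrite preimage_set0.
- by rewrite -preimage_bigcup; exact: mcons.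
Qed.

HB.instance Definition _ := isMeasure.Build _ _ _ lebesgue_step
  lebesgue_step0 lebesgue_step_ge0 lebesgue_step_sigma_additive.

Let lebesgue_step_sigma_finite : sigma_finite setT lebesgue_step.
Proof.
have /sigma_finiteP[F [TF ndF Foo]] := sigma_finiteT (@lebesgue_measure R).
have /sigma_finiteP[G [TG ndG Goo]] := sigma_finiteT m.
exists (fun i => @unconsT k @^-1` (F i `*` G i)).
  apply/esym; rewrite -subTset => t _.
  have [i _ Fi] : (\bigcup_i F i) (unconsT t).1 by rewrite -TF.
  have [j _ Gj] : (\bigcup_j G j) (unconsT t).2 by rewrite -TG.
  exists (maxn i j) => //; split.
  - by move: Fi; exact/subsetPset/ndF/leq_maxl.
  - by move: Gj; exact/subsetPset/ndG/leq_maxr.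
move=> i; have [mF Fi] := Foo i; have [mG Gi] := Goo i; split.
  rewrite -[X in measurable X]setTI; apply: measurable_unconsT => //.
  exact: measurableX.
rewrite /lebesgue_step /pushforward -comp_preimage.
rewrite (_ : _ @^-1` _ = F i `*` G i); last first.
  by apply/funext => x; rewrite /preimage /mkset /comp consTK.
by rewrite product_measure1E// lte_mul_pinfty// ge0_fin_numE.
Qed.

HB.instance Definition _ :=
  Measure_isSigmaFinite.Build _ _ _ lebesgue_step lebesgue_step_sigma_finite.

End step.

Fixpoint lebesgue_tuple k : {sigma_finite_measure set (k.-tuple R) -> \bar R} :=
  if k is k'.+1 then lebesgue_step (lebesgue_tuple k') else \d_[tuple].

End lebesgue_measure_tuple.

Section complex_space.
Context {R : realType} {n : nat}.

Definition realify (z : 'rV[R[i]]_n) : (n + n).-tuple R :=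
  [tuple match fintype.split i with
         | inl j => complex.Re (z 0 j)
         | inr j => complex.Im (z 0 j)
         end | i < n + n].

Definition complexify (t : (n + n).-tuple R) : 'rV[R[i]]_n :=
  \row_j (tnth t (lshift n j) +i* tnth t (rshift n j)).

Lemma complexifyK : cancel complexify realify.
Proof.
move=> t; apply: eq_from_tnth => i; rewrite tnth_mktuple.
by case: split_ordP => j ->; rewrite mxE.
Qed.

Lemma realifyK : cancel realify complexify.
Proof.
move=> z; apply/rowP => j; rewrite !mxE !tnth_mktuple.
rewrite (unsplitK (inl j)) (unsplitK (inr j)).
by case: (z 0 j).
Qed.

(* As [realify] is a homeomorphism onto R^(2n), this is the Borel
   sigma-algebra of C^n. *)
Let measurable_rV : set (set 'rV[R[i]]_n) :=
  preimage_set_system setT realify measurable.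

Let sigma_algebra_rV : sigma_algebra setT measurable_rV.
Proof. exact/sigma_algebra_preimage/sigma_algebra_measurable. Qed.

Let measurable_rV0 : measurable_rV set0.
Proof. by case: sigma_algebra_rV. Qed.

Let measurable_rVC A : measurable_rV A -> measurable_rV (~` A).
Proof. by case: sigma_algebra_rV => _ + _ => /[apply]; rewrite setTD. Qed.

Let measurable_rV_bigcup (F : (set 'rV[R[i]]_n)^nat) :
  (forall i, measurable_rV (F i)) -> measurable_rV (\bigcup_i F i).
Proof. by case: sigma_algebra_rV => _ _; exact. Qed.

HB.instance Definition _ := @isMeasurable.Build
  (measure_tuple_display default_measure_display) 'rV[R[i]]_n
  measurable_rV measurable_rV0 measurable_rVC measurable_rV_bigcup.

Lemma measurable_complexify : measurable_fun setT complexify.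
Proof.
move=> _ _ [B mB <-]; rewrite !setTI -comp_preimage.
by rewrite (_ : _ @^-1` B = B)//; apply/funext => t /=; rewrite complexifyK.
Qed.

Definition volume : set 'rV[R[i]]_n -> \bar R :=
  pushforward (lebesgue_tuple (n + n)) complexify.

Let volume0 : volume set0 = 0%E.
Proof. by rewrite /volume /pushforward preimage_set0 measure0. Qed.

Let volume_ge0 A : (0 <= volume A)%E.
Proof. exact: (measure_ge0 (lebesgue_tuple (n + n))). Qed.

Let volume_sigma_additive : semi_sigma_additive volume.
Proof.
have mc A : measurable A -> measurable (complexify @^-1` A).
  by move=> mA; rewrite -[X in measurable X]setTI; exact: measurable_complexify.
move=> F mF tF mUF; rewrite /volume /pushforward preimage_bigcup.
apply: measure_semi_sigma_additive => [k| |].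
- exact: mc.
- apply/trivIsetP => /= i j _ _ ij; rewrite -preimage_setI.
  by move/trivIsetP : tF => /(_ _ _ _ _ ij) ->//; rewrite preimage_set0.
- by rewrite -preimage_bigcup; exact: mc.
Qed.

HB.instance Definition _ := isMeasure.Build _ _ _ volume
  volume0 volume_ge0 volume_sigma_additive.

Definition enorm (z : 'rV[R[i]]_n) : R :=
  Num.sqrt (\sum_(j < n) normc (z 0 j) ^+ 2).

Definition cintegral (D : set 'rV[R[i]]_n) (f : 'rV[R[i]]_n -> R[i]) : R[i] :=
  (\int[volume]_(w in D) complex.Re (f w)) +i*
  (\int[volume]_(w in D) complex.Im (f w)).

End complex_space.

Definition atanh {R : realType} (x : R) : R := ln ((1 + x) / (1 - x)) / 2.

(* The ambient space is C^(m+1) = C^m x C; the last coordinate of z is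
   [z 0 ord_max] and z' has coordinates [hd z j], j < m. *)
Section siegel_half_space.
Context {R : realType} {m : nat}.
Local Notation Cn := 'rV[R[i]]_m.+1.
Implicit Types (z w : Cn) (f : Cn -> R[i]).

Definition hd z (j : 'I_m) : R[i] := z 0 (widen_ord (leqnSn m) j).
Definition lst z : R[i] := z 0 ord_max.

Definition siegel : set Cn :=
  [set z | \sum_(j < m) normc (hd z j) ^+ 2 < complex.Im (lst z)].

Definition rho2 z w : R[i] :=
  'i / 2 * ((lst w)^*%C - lst z) - \sum_(j < m) hd z j * (hd w j)^*%C.

Definition rho z : R :=
  complex.Im (lst z) - \sum_(j < m) normc (hd z j) ^+ 2.

Lemma rho2_diag z : rho2 z z = (rho z)%:C.
Proof.
have conjE (x : R[i]) : x * x^*%C = (normc x ^+ 2)%:C.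
  case: x => a b; rewrite /normc sqr_sqrtr ?addr_ge0 ?sqr_ge0//.
  by simpc; rewrite !expr2 [b * a]mulrC addNr.
rewrite /rho2 /rho rmorphB rmorph_sum/=; congr (_ - _).
  have -> : (lst z)^*%C - lst z = - (2 * ('i * (complex.Im (lst z))%:C)).
    by case: (lst z) => a b; simpc; rewrite mulrDl mul1r opprD.
  by rewrite mulrN (mulrA _ 2) divfK ?pnatr_eq0// mulrA -expr2 sqr_i mulN1r opprK.
by apply: eq_bigr => j _; exact: conjE.
Qed.

Definition bergman z w : R :=
  atanh (Num.sqrt (1 - rho z * rho w / normc (rho2 z w) ^+ 2)).

Definition bergman_ball z (r : R) : set Cn :=
  [set w | siegel w /\ bergman z w < r].

Definition vol_ball z (r : R) : R := fine (volume (bergman_ball z r)).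

Definition mean r f z : R[i] :=
  cintegral (bergman_ball z r) f / (vol_ball z r)%:C.

(* Bergman balls are relatively compact in the half-space, so the integral
   is finite for f locally square integrable there. *)
Definition MO r f z : R :=
  Num.sqrt ((vol_ball z r)^-1 *
    \int[volume]_(w in bergman_ball z r) normc (f w - mean r f z) ^+ 2).

(* Local square integrability is required instead of f in L^2(siegel): the
   half-space has infinite volume, so with the global condition the nonzero
   constants would be Bloch functions (even little Bloch ones) not in BMO. *)
Definition L2loc : set (Cn -> R[i]) :=
  [set f : Cn -> R[i] | [/\ measurable_fun siegel (fun z => complex.Re (f z)),
               measurable_fun siegel (fun z => complex.Im (f z)) &
               forall K : set Cn, compact K -> K `<=` siegel ->
                 (\int[volume]_(w in K) (normc (f w) ^+ 2)%:E < +oo)%E]].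

Definition C0 : set (Cn -> R[i]) :=
  [set g : Cn -> R[i] | [/\ {within siegel, continuous g},
               forall e : R, 0 < e -> exists2 d : R, 0 < d &
                 forall z, siegel z -> rho z < d -> normc (g z) < e &
               forall e : R, 0 < e -> exists M : R,
                 forall z, siegel z -> M < enorm z -> normc (g z) < e]].

Definition normBMO r f : \bar R := ereal_sup [set (MO r f z)%:E | z in siegel].

Definition BMO r : set (Cn -> R[i]) :=
  [set f : Cn -> R[i] | L2loc f /\ (normBMO r f < +oo)%E].

Definition VMO r : set (Cn -> R[i]) :=
  [set f : Cn -> R[i] | L2loc f /\ C0 (fun z => (MO r f z)%:C)].

(* [differentiable] is Frechet differentiability over the scalar field R[i],
   and ['D_('e_j) f z] is the complex partial derivative. *)
Definition holomorphic : set (Cn -> R[i]) :=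
  [set f : Cn -> R[i] | forall z, siegel z -> differentiable f z].

Definition dz (j : 'I_m.+1) f z : R[i] := 'D_(delta_mx 0 j) f z.

Definition invgrad f z : R :=
  let dn := dz ord_max f z in
  Num.sqrt (2 * rho z * (4 * rho z * normc dn ^+ 2 +
    \sum_(j < m) normc (dz (widen_ord (leqnSn m) j) f z
                        + 2 * 'i * (hd z j)^*%C * dn) ^+ 2)).

Definition normBloch f : \bar R :=
  ereal_sup [set (invgrad f z)%:E | z in siegel].

Definition Bloch : set (Cn -> R[i]) :=
  [set f : Cn -> R[i] | holomorphic f /\ (normBloch f < +oo)%E].

Definition Bloch0 : set (Cn -> R[i]) :=
  [set f : Cn -> R[i] | Bloch f /\ C0 (fun z => (invgrad f z)%:C)].

End siegel_half_space.

(* Main.v *)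
(* The automorphism sg z of the half-space maps the base point (0', i) to z,
   multiplies Lebesgue measure by a constant and carries D(base, r) onto D(z, r).
   Hence MO_r(f)(z) is the mean oscillation of f o sg z over D(base, r), and the
   invariant gradient of f at sg z w is that of f o sg z at w.

   With kap = 1 - tanh(r)^2, D(base, r) = {kap |w_n + i|^2 < 4 rho w}. It lies in a
   compact convex part K of the half-space, on which invariant and Euclidean
   gradients are comparable, so the mean value theorem gives
   MO_r(f)(z) <= C sup_(w in K) |grad f|(sg z w). It also contains a polysquare
   about the base point: if a is the mean of h = f o sg z, the mean value inequality
   bounds |h - a| there by the average of |h - a| over D(base, r), hence by
   MO_r(f)(z), and Cauchy's estimate bounds the gradient of h at the base point.

   For the little spaces, sg z w tends to the boundary with z, uniformly for w in K;
   both MO_r(f) and the invariant gradient are continuous for holomorphic f, and a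
   continuous function that vanishes at the boundary is bounded. *)
Require Import Defs.
From mathcomp Require Import all_boot all_order all_algebra.
From mathcomp Require Import complex.
From mathcomp Require Import all_classical all_reals all_analysis.
From mathcomp Require Import measurable_realfun.
From mathcomp Require Import ring lra.

Set Implicit Arguments.
Unset Strict Implicit.
Unset Printing Implicit Defensive.

Import Order.TTheory GRing.Theory Num.Theory.
Import numFieldNormedType.Exports.
Import Normc.

Local Open Scope classical_set_scope.
Local Open Scope ring_scope.
Local Open Scope complex_scope.

(** * Complex norms and line integrals *)

(** Squares replace discs throughout. The boundary of a square consists of horizontal and vertical
    segments, so its line integral is made of one-dimensional Lebesgue integrals, and integrating
    over the boundaries of concentric squares gives an area integral by Tonelli alone, without polar
    coordinates. The value 2 pi i of the integral of 1/z is never computed: the lower bound 4 for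
    its modulus yields Cauchy's estimates and the mean value inequality up to constants, which is
    all that an equivalence of norms asks for.

    The second choice is to treat the coordinates one after another. Both the mean value inequality
    on polysquares and the change of variables under [sg z], a triangular affine map, reduce to
    single coordinates. The Jacobian enters only as a positive constant for each z, and it cancels
    in every average.

    Finally, uniformity in z comes for free once everything is pulled back to one fixed ball: the
    constants there do not see z, and the continuity of MO_r(f) becomes the continuity of z -> f o
    sg z in the uniform norm on that ball. *)

Section complex_norm.
Context {R : realType}.
Implicit Types x y z : R[i].

Lemma normc_ge0 x : 0 <= normc x.
Proof. by case: x => a b; exact: sqrtr_ge0. Qed.

Lemma normc_eq0 x : (normc x == 0) = (x == 0).
Proof.
by apply/eqP/eqP => [/eq0_normc //|->]; exact: normc0.
Qed.

Lemma normc_gt0 x : (0 < normc x) = (x != 0).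
Proof. by rewrite lt_def normc_ge0 andbT normc_eq0. Qed.

Lemma normc_distC x y : normc (x - y) = normc (y - x).
Proof. by rewrite -normcN opprB. Qed.

Lemma ler_normcB x y : normc (x - y) <= normc x + normc y.
Proof. by rewrite (le_trans (le_normcD _ _))// normcN. Qed.

Lemma ler_dist_normc x y : `|normc x - normc y| <= normc (x - y).
Proof.
have H (u v : R[i]) : normc u - normc v <= normc (u - v).
  by rewrite lerBlDr -{1}(subrK v u) le_normcD.
by rewrite ler_norml H andbT lerNl opprB normc_distC H.
Qed.

Lemma normcR (a : R) : normc a%:C = `|a|.
Proof. by rewrite /= expr0n/= addr0 sqrtr_sqr. Qed.

Lemma normci : normc 'i = 1 :> R.
Proof. by rewrite /= expr0n/= add0r expr1n sqrtr1. Qed.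

Lemma normc_sqr x : normc x ^+ 2 = complex.Re x ^+ 2 + complex.Im x ^+ 2.
Proof. by case: x => a b /=; rewrite sqr_sqrtr// addr_ge0 ?sqr_ge0. Qed.

Lemma normcX x n : normc (x ^+ n) = normc x ^+ n.
Proof.
elim: n => [|n IH]; first by rewrite !expr0 normc1.
by rewrite !exprS normcM IH.
Qed.

Lemma ler_Re_normc x : `|complex.Re x| <= normc x.
Proof.
rewrite -(ler_pXn2r (n := 2)) ?nnegrE ?normc_ge0// normc_sqr real_normK ?num_real//.
by rewrite lerDl sqr_ge0.
Qed.

Lemma ler_Im_normc x : `|complex.Im x| <= normc x.
Proof.
rewrite -(ler_pXn2r (n := 2)) ?nnegrE ?normc_ge0// normc_sqr real_normK ?num_real//.
by rewrite lerDr sqr_ge0.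
Qed.

Lemma ler_normc_ReIm x : normc x <= `|complex.Re x| + `|complex.Im x|.
Proof.
rewrite -(ler_pXn2r (n := 2)) ?nnegrE ?normc_ge0 ?addr_ge0// normc_sqr.
rewrite sqrrD !real_normK ?num_real// lerD2r lerDl mulrn_wge0//.
Qed.

Lemma normc_conj x : normc x^*%C = normc x.
Proof. by case: x => a b /=; rewrite sqrrN. Qed.

End complex_norm.

Section complex_line_integral.
Context {R : realType}.
Local Notation mu := (@lebesgue_measure R).
Implicit Types (a b c d e M : R) (g h : R -> R[i]).

(** The modulus is the real number [normc], not the norm of [R[i]], whose values are complex; every
    estimate below then takes place in [R]. *)
Definition ccontinuous_on (D : set R) g := forall x, D x -> forall e, 0 < e ->
  exists2 d, 0 < d & forall y, D y -> `|y - x| < d -> normc (g y - g x) < e.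

Definition Cint a b g : R[i] :=
  (\int[mu]_(x in `[a, b]) complex.Re (g x)) +i*
  (\int[mu]_(x in `[a, b]) complex.Im (g x)).

Lemma within_continuous_dist (D : set R) (h : R -> R) :
  (forall x, D x -> forall e, 0 < e ->
  exists2 d, 0 < d & forall y, D y -> `|y - x| < d -> `|h y - h x| < e) ->
  {within D, continuous h}.
Proof.
move=> H; apply/subspace_continuousP => x Dx.
apply/cvgrPdist_lt => e e0; have [d d0 Hd] := H _ Dx _ e0.
rewrite near_withinE; apply: filterS (nbhsx_ballx x d d0) => y xy Dy.
by rewrite distrC; apply: Hd => //; rewrite distrC.
Qed.

Lemma integrable_dist a b (h : R -> R) :
  (forall x, `[a, b]%classic x -> forall e, 0 < e ->
  exists2 d, 0 < d & forall y, `[a, b]%classic y -> `|y - x| < d ->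
    `|h y - h x| < e) ->
  mu.-integrable `[a, b] (EFin \o h).
Proof.
move=> H; apply: (@continuous_compact_integrable R h).
  exact: segment_compact.
exact: within_continuous_dist.
Qed.

Lemma integrable_scale a b k (h : R -> R) :
  mu.-integrable `[a, b] (EFin \o h) ->
  mu.-integrable `[a, b] (EFin \o (fun x => k * h x)).
Proof.
move=> ih; have mI : measurable (`[a, b]%classic : set (measurableTypeR R)).
  exact: measurable_itv.
by have := integrableZl mI k ih; apply: eq_integrable => // x _.
Qed.

Lemma integrable_Re a b g : ccontinuous_on `[a, b] g ->
  mu.-integrable `[a, b] (EFin \o (fun x => complex.Re (g x))).
Proof.
move=> H; apply: integrable_dist => x Dx e e0; have [d d0 Hd] := H _ Dx _ e0.
exists d => // y Dy yx; rewrite -raddfB.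
exact: le_lt_trans (ler_Re_normc _) (Hd _ Dy yx).
Qed.

Lemma integrable_Im a b g : ccontinuous_on `[a, b] g ->
  mu.-integrable `[a, b] (EFin \o (fun x => complex.Im (g x))).
Proof.
move=> H; apply: integrable_dist => x Dx e e0; have [d d0 Hd] := H _ Dx _ e0.
exists d => // y Dy yx; rewrite -raddfB.
exact: le_lt_trans (ler_Im_normc _) (Hd _ Dy yx).
Qed.

Lemma integrable_normc a b g : ccontinuous_on `[a, b] g ->
  mu.-integrable `[a, b] (EFin \o (fun x => normc (g x))).
Proof.
move=> H; apply: integrable_dist => x Dx e e0; have [d d0 Hd] := H _ Dx _ e0.
exists d => // y Dy yx.
exact: le_lt_trans (ler_dist_normc _ _) (Hd _ Dy yx).
Qed.

Lemma ccontinuous_onB (D : set R) g h : ccontinuous_on D g ->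
  ccontinuous_on D h -> ccontinuous_on D (fun x => g x - h x).
Proof.
move=> cg ch x Dx e e0; have e20 : 0 < e / 2 by rewrite divr_gt0.
have [d d0 Hd] := cg _ Dx _ e20; have [d' d'0 Hd'] := ch _ Dx _ e20.
exists (Num.min d d'); first by rewrite lt_min d0.
move=> y Dy; rewrite lt_min => /andP[yd yd'].
have -> : g y - h y - (g x - h x) = (g y - g x) - (h y - h x) by ring.
rewrite (le_lt_trans (ler_normcB _ _))// [ltRHS]splitr ltrD//.
  exact: Hd.
exact: Hd'.
Qed.

Lemma ccontinuous_on_cst (D : set R) (k : R[i]) :
  ccontinuous_on D (fun=> k).
Proof. by move=> x Dx e e0; exists 1 => // y _ _; rewrite subrr normc0. Qed.

Lemma ccontinuous_onZ (D : set R) g (k : R[i]) : ccontinuous_on D g ->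
  ccontinuous_on D (fun x => k * g x).
Proof.
move=> cg x Dx e e0.
have k0 : 0 < normc k + 1 by rewrite ltr_wpDl// normc_ge0.
have [d d0 Hd] := cg _ Dx _ (divr_gt0 e0 k0).
exists d => // y Dy yx; rewrite -mulrBr normcM.
apply: (@le_lt_trans _ _ ((normc k + 1) * normc (g y - g x))).
  by rewrite ler_wpM2r ?normc_ge0// lerDl.
by rewrite mulrC -ltr_pdivlMr// Hd.
Qed.

Lemma ccontinuous_onS (D E : set R) g : D `<=` E -> ccontinuous_on E g ->
  ccontinuous_on D g.
Proof.
move=> DE cg x /DE Ex e /(cg _ Ex)[d d0 H]; exists d => // y /DE; exact: H.
Qed.

Lemma CintB a b g h : ccontinuous_on `[a, b] g -> ccontinuous_on `[a, b] h ->
  Cint a b (fun x => g x - h x) = Cint a b g - Cint a b h.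
Proof.
move=> cg ch; rewrite /Cint; apply/eqP; rewrite eq_complex/=.
under eq_Rintegral do rewrite raddfB.
rewrite (RintegralB _ (integrable_Re cg) (integrable_Re ch))//= eqxx/=.
under eq_Rintegral do rewrite raddfB.
by rewrite (RintegralB _ (integrable_Im cg) (integrable_Im ch)).
Qed.

Lemma CintZ a b g (k : R[i]) : ccontinuous_on `[a, b] g ->
  Cint a b (fun x => k * g x) = k * Cint a b g.
Proof.
move=> cg; rewrite /Cint; case: k => k1 k2; apply/eqP; rewrite eq_complex/=.
have E1 x : complex.Re ((k1 +i* k2) * g x) =
    k1 * complex.Re (g x) - k2 * complex.Im (g x) by case: (g x).
have E2 x : complex.Im ((k1 +i* k2) * g x) =
    k1 * complex.Im (g x) + k2 * complex.Re (g x) by case: (g x).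
have iR := integrable_Re cg; have iI := integrable_Im cg.
have iRZ k := integrable_scale k iR; have iIZ k := integrable_scale k iI.
under eq_Rintegral do rewrite E1.
rewrite RintegralB//= !RintegralZl//= eqxx/=.
under eq_Rintegral do rewrite E2.
by rewrite RintegralD//= !RintegralZl.
Qed.

Lemma Rintegral_itv_cst a b M : a <= b ->
  \int[mu]_(x in `[a, b]) M = M * (b - a).
Proof.
move=> ab; rewrite Rintegral_cst//=.
have -> // : fine (mu `[a, b]) = b - a.
rewrite lebesgue_measure_itv/= lte_fin; case: ltP => //= ba.
by apply/esym/eqP; rewrite subr_eq0 eq_le ba ab.
Qed.

Lemma Cint_cst a b (k : R[i]) : a <= b -> Cint a b (fun=> k) = k * (b - a)%:C.
Proof.
move=> ab; rewrite /Cint !Rintegral_itv_cst//.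
by case: k => k1 k2; simpc.
Qed.

(** Rotation: if I is the integral, |I|^2 is the integral of Re (conj I * g), which is at most |I|
    times the integral of |g|. *)
Lemma normc_Cint a b g : ccontinuous_on `[a, b] g ->
  normc (Cint a b g) <= \int[mu]_(x in `[a, b]) normc (g x).
Proof.
move=> cg; set I := Cint a b g.
have [->|I0] := eqVneq I 0.
  by rewrite normc0; apply: Rintegral_ge0 => x _; exact: normc_ge0.
have H : (normc I) ^+ 2 <= normc I * \int[mu]_(x in `[a, b]) normc (g x).
  have -> : normc I ^+ 2 = complex.Re (I^*%C * I).
    by case: (I) => p q; rewrite normc_sqr/=; ring.
  have cZ := ccontinuous_onZ I^*%C cg.
  rewrite -(CintZ _ cg) /= -RintegralZl//; last exact: integrable_normc.
  apply: le_Rintegral => //.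
  - exact: (integrable_Re cZ).
  - exact: integrable_scale (integrable_normc cg).
  - move=> x _; rewrite (le_trans (ler_norm _))// (le_trans (ler_Re_normc _))//.
    by rewrite normcM (normc_conj I).
by rewrite expr2 ler_pM2l ?normc_gt0 in H.
Qed.

Lemma Cint_dist a b g (k : R[i]) M : a <= b -> ccontinuous_on `[a, b] g ->
  (forall x, a <= x <= b -> normc (g x - k) <= M) ->
  normc (Cint a b g - k * (b - a)%:C) <= M * (b - a).
Proof.
move=> ab cg H.
have ck := @ccontinuous_on_cst `[a, b]%classic k.
have cB := ccontinuous_onB cg ck.
rewrite -Cint_cst// -CintB// (le_trans (normc_Cint cB))//.
rewrite -Rintegral_itv_cst//.
apply: le_Rintegral => //.
- exact: integrable_normc cB.
- by apply: integrable_dist => x _ e e0; exists 1 => // y _ _; rewrite subrr normr0.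
Qed.

Lemma Cint_split a b c g : a <= b <= c -> ccontinuous_on `[a, c] g ->
  Cint a c g = Cint a b g + Cint b c g.
Proof.
move=> /andP[ab bc] cg; rewrite /Cint.
have H (h : R -> R) : mu.-integrable `[a, c] (EFin \o h) ->
  \int[mu]_(x in `[a, c]) h x =
  \int[mu]_(x in `[a, b]) h x + \int[mu]_(x in `[b, c]) h x.
  move=> ih; have := @Rintegral_itvB R h (BLeft a) (BRight c) b ih.
  rewrite !bnd_simp => /(_ ab bc).
  rewrite Rintegral_itv_obnd_cbnd => [<-|]; first by rewrite addrC subrK.
  apply: integrableS ih => //; apply: subset_itvr; by rewrite bnd_simp.
rewrite (H _ (integrable_Re cg)) (H _ (integrable_Im cg)).
by simpc.
Qed.

End complex_line_integral.

(** * Goursat's lemma *)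

Section goursat.
Context {R : realType}.
Implicit Types (a b c d e p q s x y : R) (f : R[i] -> R[i]) (z w : R[i]).

(** The remainder form has no quotient, so [w = z] needs no exclusion and the rules of calculus
    reduce to the triangle inequality. *)
Definition cderiv f z (l : R[i]) := forall e, 0 < e ->
  exists2 d, 0 < d & forall w, normc (w - z) < d ->
    normc (f w - f z - l * (w - z)) <= e * normc (w - z).

Definition crect a b c d : set R[i] :=
  [set z | a <= complex.Re z <= b /\ c <= complex.Im z <= d].

(* Integral along the boundary, counterclockwise. *)
Definition rect_int f a b c d : R[i] :=
  Cint a b (fun x => f (x +i* c) - f (x +i* d)) +
  'i * Cint c d (fun y => f (b +i* y) - f (a +i* y)).

Lemma cderiv_cts f z l : cderiv f z l -> forall e, 0 < e ->
  exists2 d, 0 < d & forall w, normc (w - z) < d -> normc (f w - f z) < e.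
Proof.
move=> /(_ 1 ltr01)[d d0 H] e e0.
have k0 : 0 < normc l + 1 by rewrite ltr_wpDl// normc_ge0.
exists (Num.min d (e / (normc l + 1))); first by rewrite lt_min d0 divr_gt0.
move=> w; rewrite lt_min => /andP[/H wd]; rewrite ltr_pdivlMr//; apply: le_lt_trans.
have -> : f w - f z = (f w - f z - l * (w - z)) + l * (w - z) by ring.
rewrite (le_trans (le_normcD _ _))// [normc (l * _)]normcM.
by move: wd; set A := normc (f w - _ - _); set N := normc (w - z); lra.
Qed.

Definition cdiff_on (D : set R[i]) f := forall z, D z -> exists l, cderiv f z l.

Lemma cdiff_on_subset (D E : set R[i]) f : D `<=` E -> cdiff_on E f -> cdiff_on D f.
Proof. by move=> DE cE z /DE /cE. Qed.

Lemma cdiff_on_hcts (D : set R[i]) f a b y : cdiff_on D f ->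
  (forall x, a <= x <= b -> D (x +i* y)) ->
  ccontinuous_on `[a, b] (fun x => f (x +i* y)).
Proof.
move=> cD H x; rewrite /= in_itv/= => /H /cD[l /cderiv_cts fl] e /fl[d d0 Hd].
exists d => // x' _ xd; apply: Hd.
have -> : (x' +i* y) - (x +i* y) = (x' - x)%:C.
  by apply/eqP; rewrite eq_complex/= subrr !eqxx.
by rewrite normcR.
Qed.

Lemma cdiff_on_vcts (D : set R[i]) f a b x : cdiff_on D f ->
  (forall y, a <= y <= b -> D (x +i* y)) ->
  ccontinuous_on `[a, b] (fun y => f (x +i* y)).
Proof.
move=> cD H y; rewrite /= in_itv/= => /H /cD[l /cderiv_cts fl] e /fl[d d0 Hd].
exists d => // y' _ yd; apply: Hd.
have -> : (x +i* y') - (x +i* y) = 'i * (y' - y)%:C.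
  by apply/eqP; rewrite eq_complex/= !mul0r !mul1r !subrr add0r !eqxx.
by rewrite normcM normci mul1r normcR.
Qed.

(** The two integrals along the cut cancel. Only the outer edges and the cut have to lie in [D]; the
    rectangle itself may contain a singularity, as it does when a square annulus is cut. *)
Lemma rect_int_splitx (D : set R[i]) f a e b c d : cdiff_on D f ->
  a <= e <= b -> c <= d ->
  (forall x, a <= x <= b -> D (x +i* c) /\ D (x +i* d)) ->
  (forall y, c <= y <= d -> [/\ D (a +i* y), D (e +i* y) & D (b +i* y)]) ->
  rect_int f a b c d = rect_int f a e c d + rect_int f e b c d.
Proof.
move=> fD aeb cd h1 h2; rewrite /rect_int.
have ha : ccontinuous_on `[c, d] (fun y => f (a +i* y)).
  by apply: (cdiff_on_vcts fD) => y /h2[].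
have hb : ccontinuous_on `[c, d] (fun y => f (b +i* y)).
  by apply: (cdiff_on_vcts fD) => y /h2[].
have he : ccontinuous_on `[c, d] (fun y => f (e +i* y)).
  by apply: (cdiff_on_vcts fD) => y /h2[].
have hc : ccontinuous_on `[a, b] (fun x => f (x +i* c)).
  by apply: (cdiff_on_hcts fD) => x /h1[].
have hd : ccontinuous_on `[a, b] (fun x => f (x +i* d)).
  by apply: (cdiff_on_hcts fD) => x /h1[].
have sl : `[a, e]%classic `<=` `[a, b]%classic.
  by apply: subset_itvl; rewrite bnd_simp; case/andP: aeb.
have sr : `[e, b]%classic `<=` `[a, b]%classic.
  by apply: subset_itvr; rewrite bnd_simp; case/andP: aeb.
rewrite (Cint_split aeb); last exact: ccontinuous_onB.
rewrite (CintB hb ha) (CintB he ha) (CintB hb he).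
rewrite (CintB (ccontinuous_onS sl hc) (ccontinuous_onS sl hd)).
by rewrite (CintB (ccontinuous_onS sr hc) (ccontinuous_onS sr hd)); ring.
Qed.

Lemma rect_int_splity (D : set R[i]) f a b c e d : cdiff_on D f ->
  a <= b -> c <= e <= d ->
  (forall y, c <= y <= d -> D (a +i* y) /\ D (b +i* y)) ->
  (forall x, a <= x <= b -> [/\ D (x +i* c), D (x +i* e) & D (x +i* d)]) ->
  rect_int f a b c d = rect_int f a b c e + rect_int f a b e d.
Proof.
move=> fD ab ced h1 h2; rewrite /rect_int.
have ha : ccontinuous_on `[a, b] (fun x => f (x +i* c)).
  by apply: (cdiff_on_hcts fD) => y /h2[].
have hb : ccontinuous_on `[a, b] (fun x => f (x +i* e)).
  by apply: (cdiff_on_hcts fD) => y /h2[].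
have he : ccontinuous_on `[a, b] (fun x => f (x +i* d)).
  by apply: (cdiff_on_hcts fD) => y /h2[].
have hc : ccontinuous_on `[c, d] (fun y => f (a +i* y)).
  by apply: (cdiff_on_vcts fD) => x /h1[].
have hd : ccontinuous_on `[c, d] (fun y => f (b +i* y)).
  by apply: (cdiff_on_vcts fD) => x /h1[].
have sl : `[c, e]%classic `<=` `[c, d]%classic.
  by apply: subset_itvl; rewrite bnd_simp; case/andP: ced.
have sr : `[e, d]%classic `<=` `[c, d]%classic.
  by apply: subset_itvr; rewrite bnd_simp; case/andP: ced.
rewrite (Cint_split ced); last exact: ccontinuous_onB.
rewrite (CintB ha he) (CintB ha hb) (CintB hb he).
rewrite (CintB (ccontinuous_onS sl hd) (ccontinuous_onS sl hc)).
by rewrite (CintB (ccontinuous_onS sr hd) (ccontinuous_onS sr hc)); ring.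
Qed.

Lemma crect_subset a b c d a' b' c' d' : a' <= a -> b <= b' -> c' <= c ->
  d <= d' -> crect a b c d `<=` crect a' b' c' d'.
Proof.
move=> aa bb cc dd z [/andP[z1 z2] /andP[z3 z4]].
by split; rewrite ?(le_trans aa z1) ?(le_trans cc z3)/= ?(le_trans z2 bb) ?(le_trans z4 dd).
Qed.

Lemma rect_int_quarter f a e b c g d : a <= e <= b -> c <= g <= d ->
  cdiff_on (crect a b c d) f ->
  rect_int f a b c d = (rect_int f a e c g + rect_int f a e g d) +
                       (rect_int f e b c g + rect_int f e b g d).
Proof.
move=> /andP[ae eb] /andP[cg gd] fD.
have ab := le_trans ae eb; have cd := le_trans cg gd.
have mem x y : a <= x -> x <= b -> c <= y -> y <= d -> crect a b c d (x +i* y).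
  by rewrite /crect/= => -> -> -> ->.
have laa := lexx a; have lbb := lexx b; have lcc := lexx c; have ldd := lexx d.
rewrite (@rect_int_splitx _ f a e b c d fD) ?ae//; last 2 first.
- by move=> x /andP[? ?]; split; apply: mem.
- by move=> y /andP[? ?]; split; apply: mem.
rewrite (@rect_int_splity _ f a e c g d fD) ?cg//; last 2 first.
- by move=> x /andP[? ?]; split; apply: mem.
- by move=> x /andP[? xe]; have ? := le_trans xe eb; split; apply: mem.
rewrite (@rect_int_splity _ f e b c g d fD) ?cg//; last 2 first.
- by move=> x /andP[? ?]; split; apply: mem.
- by move=> x /andP[ex ?]; have ? := le_trans ae ex; split; apply: mem.
Qed.

Definition edges a b c d : set R[i] :=
  [set z | crect a b c d z /\ (complex.Re z = a \/ complex.Re z = b \/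
                              complex.Im z = c \/ complex.Im z = d)].

Lemma edges_h a b c d x : c <= d -> a <= x <= b ->
  edges a b c d (x +i* c) /\ edges a b c d (x +i* d).
Proof.
move=> cd axb; split; (split; first by split=> //=; rewrite lexx cd).
  by right; right; left.
by right; right; right.
Qed.

Lemma edges_v a b c d y : a <= b -> c <= y <= d ->
  edges a b c d (a +i* y) /\ edges a b c d (b +i* y).
Proof.
move=> ab cyd; split; (split; first by split=> //=; rewrite lexx ab).
  by left.
by right; left.
Qed.

Lemma edges_cts f a b c d : a <= b -> c <= d -> cdiff_on (edges a b c d) f ->
  [/\ ccontinuous_on `[a, b] (fun x => f (x +i* c)),
      ccontinuous_on `[a, b] (fun x => f (x +i* d)),
      ccontinuous_on `[c, d] (fun y => f (a +i* y)) &
      ccontinuous_on `[c, d] (fun y => f (b +i* y))].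
Proof.
move=> ab cd fD; split.
- by apply: (cdiff_on_hcts fD) => x /(edges_h cd)[].
- by apply: (cdiff_on_hcts fD) => x /(edges_h cd)[].
- by apply: (cdiff_on_vcts fD) => y /(edges_v ab)[].
- by apply: (cdiff_on_vcts fD) => y /(edges_v ab)[].
Qed.

(** Constants [k1] and [k2] whose contributions cancel may be subtracted under the two integrals. In
    [goursat] they absorb the affine part of [f]; with both equal to 0 the lemma is the plain length
    estimate. *)
Lemma rect_int_le f a b c d M : a <= b -> c <= d ->
  cdiff_on (edges a b c d) f ->
  forall k1 k2 : R[i], k1 * (b - a)%:C + 'i * (k2 * (d - c)%:C) = 0 ->
  (forall x, a <= x <= b -> normc (f (x +i* c) - f (x +i* d) - k1) <= M) ->
  (forall y, c <= y <= d -> normc (f (b +i* y) - f (a +i* y) - k2) <= M) ->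
  normc (rect_int f a b c d) <= M * ((b - a) + (d - c)).
Proof.
move=> ab cd fD k1 k2 k0 H1 H2; rewrite /rect_int.
have [hc hd ha hb] := edges_cts ab cd fD.
set I1 := Cint a b _; set I2 := Cint c d _.
have -> : I1 + 'i * I2 = (I1 - k1 * (b - a)%:C) + 'i * (I2 - k2 * (d - c)%:C).
  by rewrite -[LHS]subr0 -k0; ring.
apply: le_trans (le_normcD _ _) _; rewrite [leRHS]mulrDr; apply: lerD.
  by apply: Cint_dist => //; exact: ccontinuous_onB.
rewrite normcM normci mul1r.
by apply: Cint_dist => //; exact: ccontinuous_onB.
Qed.

Lemma half_pow_lt s d : 0 < s -> 0 < d -> exists n, s / 2 ^+ n < d.
Proof.
move=> s0 d0; have [n Hn] : exists n, s / d < n%:R.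
  by exists (Num.truncn (s / d)).+1; rewrite truncnS_gt.
exists n; rewrite ltr_pdivrMr ?exprn_gt0// mulrC -ltr_pdivrMr//.
rewrite (lt_le_trans Hn)// -natrX ler_nat ltnW//; exact: ltn_expl.
Qed.

(* Cousin's lemma, by bisection; (x, y) is the lower left corner and the
   sides are s * p and s * q. *)
Lemma rect_cousin (P : R -> R -> R -> Prop) p q x0 y0 s0 :
  0 <= p -> 0 <= q -> 0 < s0 ->
  let sub x y s := [/\ x0 <= x, x + s * p <= x0 + s0 * p, y0 <= y &
                       y + s * q <= y0 + s0 * q] in
  (forall x y s, 0 < s -> sub x y s ->
     P x y (s / 2) -> P (x + s / 2 * p) y (s / 2) ->
     P x (y + s / 2 * q) (s / 2) -> P (x + s / 2 * p) (y + s / 2 * q) (s / 2) ->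
     P x y s) ->
  (forall u v, x0 <= u <= x0 + s0 * p -> y0 <= v <= y0 + s0 * q ->
     exists2 d, 0 < d & forall x y s, 0 < s < d -> sub x y s ->
       x <= u <= x + s * p -> y <= v <= y + s * q -> P x y s) ->
  P x0 y0 s0.
Proof.
move=> p0 q0 s00 sub Hadd Hloc; apply: contrapT => nP0.
pose s n := s0 / 2 ^+ n.
have sgt0 n : 0 < s n by rewrite divr_gt0// exprn_gt0.
have sS n : s n.+1 = s n / 2 by rewrite /s exprSr invfM mulrA.
have s2 n : s n = s n / 2 + s n / 2 by rewrite -splitr.
(* [B n t]: the rectangle of level n with corner [t] is bad. [N n t t']: the bad rectangle at [t'],
   of level n + 1, lies inside the one at [t]. *)
pose B n (t : R * R) := ~ P t.1 t.2 (s n) /\ sub t.1 t.2 (s n).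
pose N n (t t' : R * R) := [/\ B n.+1 t', t.1 <= t'.1,
  t'.1 + s n.+1 * p <= t.1 + s n * p, t.2 <= t'.2 &
  t'.2 + s n.+1 * q <= t.2 + s n * q].
have step n t : B n t -> exists t', N n t t'.
  move: t => [x y] [/= nP [sx1 sx2 sy1 sy2]].
  have hp : 0 <= s n / 2 * p by rewrite mulr_ge0// divr_ge0// ltW.
  have hq : 0 <= s n / 2 * q by rewrite mulr_ge0// divr_ge0// ltW.
  have hp2 : x + s n * p = x + s n / 2 * p + s n / 2 * p.
    by rewrite -addrA -mulrDl -splitr.
  have hq2 : y + s n * q = y + s n / 2 * q + s n / 2 * q.
    by rewrite -addrA -mulrDl -splitr.
  have xl : x + s n / 2 * p <= x + s n * p by rewrite hp2 lerDl.
  have yl : y + s n / 2 * q <= y + s n * q by rewrite hq2 lerDl.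
  apply: contrapT => /forallNP nt.
  apply/nP/Hadd => //; apply: contrapT => nP'.
  - apply: (nt (x, y)); rewrite /N /B /sub/= sS; split=> //; split=> //.
    by split; rewrite ?(le_trans xl) ?(le_trans yl).
  - apply: (nt (x + s n / 2 * p, y)).
    rewrite /N /B /sub/= sS -hp2 lerDl; split=> //; split=> //.
    by split; rewrite ?(le_trans sx1) ?lerDl ?(le_trans yl).
  - apply: (nt (x, y + s n / 2 * q)).
    rewrite /N /B /sub/= sS -hq2 lerDl; split=> //; split=> //.
    by split; rewrite ?(le_trans sy1) ?lerDl ?(le_trans xl).
  - apply: (nt (x + s n / 2 * p, y + s n / 2 * q)).
    rewrite /N /B /sub/= sS -hp2 -hq2 !lerDl; split=> //; split=> //.
    by split; rewrite ?(le_trans sx1) ?(le_trans sy1) ?lerDl.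
(* The successor function is total; its value at a rectangle that is not bad is arbitrary. *)
have /choice[nxt Hnxt] (nt : nat * (R * R)) :
    exists t', B nt.1 nt.2 -> N nt.1 nt.2 t'.
  case: nt => n t; have [/step[t' Ht']|nB] := pselect (B n t); first by exists t'.
  by exists t.
pose u := fix u n := if n is k.+1 then nxt (k, u k) else (x0, y0).
have Bu n : B n (u n).
  elim: n => [|n IH]; last by have [] := Hnxt (n, u n) IH.
  by rewrite /B /s expr0 divr1; split.
have Nu n : N n (u n) (u n.+1) by exact: (Hnxt (n, u n) (Bu n)).
have mono n k : [/\ (u n).1 <= (u (n + k)%N).1,
    (u (n + k)%N).1 + s (n + k)%N * p <= (u n).1 + s n * p,
    (u n).2 <= (u (n + k)%N).2 &
    (u (n + k)%N).2 + s (n + k)%N * q <= (u n).2 + s n * q].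
  elim: k => [|k [h1 h2 h3 h4]]; first by rewrite addn0.
  rewrite addnS; have [_ n1 n2 n3 n4] := Nu (n + k)%N.
  by split; [exact: le_trans n1|exact: le_trans h2|exact: le_trans n3|
             exact: le_trans h4].
(* Each lower left corner lies below each upper right corner, whichever of the two levels is deeper.
   Hence the suprema of the corners give a point common to all the rectangles. *)
have cross n m : (u n).1 <= (u m).1 + s m * p /\ (u n).2 <= (u m).2 + s m * q.
  have h k r : 0 <= r -> 0 <= s k * r by move=> ?; rewrite mulr_ge0// ltW.
  have [/subnKC <-|/ltnW/subnKC <-] := leqP n m.
    have [h1 _ h3 _] := mono n (m - n)%N.
    by split; rewrite ler_wpDr// h.
  have [_ h2 _ h4] := mono m (n - m)%N.
  by split; [apply: le_trans h2|apply: le_trans h4]; rewrite lerDl h.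
pose X := sup (range (fun n => (u n).1)).
pose Y := sup (range (fun n => (u n).2)).
have XP n : (u n).1 <= X <= (u n).1 + s n * p.
  apply/andP; split.
    apply: ub_le_sup; last by exists n.
    by exists ((u 0).1 + s 0 * p) => _ [m _ <-]; case: (cross m 0%N).
  apply: ge_sup; first by exists (u 0).1, 0%N.
  by move=> _ [m _ <-]; case: (cross m n).
have YP n : (u n).2 <= Y <= (u n).2 + s n * q.
  apply/andP; split.
    apply: ub_le_sup; last by exists n.
    by exists ((u 0).2 + s 0 * q) => _ [m _ <-]; case: (cross m 0%N).
  apply: ge_sup; first by exists (u 0).2, 0%N.
  by move=> _ [m _ <-]; case: (cross m n).
have [||d d0 Hd] := Hloc X Y.
- by have := XP 0%N; rewrite /s expr0 divr1.
- by have := YP 0%N; rewrite /s expr0 divr1.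
have [n sn] := half_pow_lt s00 d0.
have [nP sB] := Bu n; apply: nP; apply: Hd => //.
by rewrite sgt0.
Qed.

Lemma ler_normc_crect x y p q z w : crect x (x + p) y (y + q) z ->
  crect x (x + p) y (y + q) w -> normc (w - z) <= p + q.
Proof.
move=> [/andP[z1 z2] /andP[z3 z4]] [/andP[w1 w2] /andP[w3 w4]].
apply: (le_trans (ler_normc_ReIm _)); rewrite !raddfB lerD// ler_norml.
  by apply/andP; split; lra.
by apply/andP; split; lra.
Qed.

(** Cousin's lemma for the property that the boundary integral over a rectangle of scale s is at
    most [e * s ^+ 2]. The bound scales like an area, so four good quarters make a good rectangle.
    Near a point, [f] is affine up to a small multiple of the diameter and the perimeter is also of
    order s, so small rectangles are good. *)
Lemma goursat f a b c d : a < b -> c < d -> cdiff_on (crect a b c d) f ->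
  rect_int f a b c d = 0.
Proof.
move=> ab cd fD; apply/eqP; rewrite -normc_eq0 eq_le normc_ge0 andbT.
apply/ler_addgt0Pl => e e0; rewrite addr0.
pose p := b - a; pose q := d - c.
have p0 : 0 < p by rewrite subr_gt0.
have q0 : 0 < q by rewrite subr_gt0.
have pq0 : 0 < p + q by rewrite addr_gt0.
have bE : b = a + 1 * p by rewrite mul1r addrC subrK.
have dE : d = c + 1 * q by rewrite mul1r addrC subrK.
clearbody p q.
pose P x y s := normc (rect_int f x (x + s * p) y (y + s * q)) <= e * s ^+ 2.
suff : P a c 1 by rewrite /P -bE -dE expr1n mulr1.
apply: (@rect_cousin P p q); [exact: ltW|exact: ltW|by []| |].
- move=> x y s s0 [sx1 sx2 sy1 sy2].
  have hp : 0 <= s / 2 * p by rewrite mulr_ge0// ?divr_ge0// ltW.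
  have hq : 0 <= s / 2 * q by rewrite mulr_ge0// ?divr_ge0// ltW.
  have hp2 : s * p = s / 2 * p + s / 2 * p by rewrite -mulrDl -splitr.
  have hq2 : s * q = s / 2 * q + s / 2 * q by rewrite -mulrDl -splitr.
  rewrite /P.
  have -> : x + s / 2 * p + s / 2 * p = x + s * p by rewrite hp2 addrA.
  have -> : y + s / 2 * q + s / 2 * q = y + s * q by rewrite hq2 addrA.
  move=> P1 P2 P3 P4.
  rewrite (@rect_int_quarter f _ (x + s / 2 * p) _ _ (y + s / 2 * q)); last 3 first.
  - by rewrite hp2 addrA !lerDl hp.
  - by rewrite hq2 addrA !lerDl hq.
  - apply: cdiff_on_subset fD; apply: crect_subset => //.
      by rewrite bE.
    by rewrite dE.
  have -> : e * s ^+ 2 = (e * (s / 2) ^+ 2 + e * (s / 2) ^+ 2) +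
                         (e * (s / 2) ^+ 2 + e * (s / 2) ^+ 2) by field.
  by do 3! rewrite (le_trans (le_normcD _ _))// ?lerD//; rewrite (le_trans (le_normcD _ _))// ?lerD.
- move=> u v; rewrite -bE -dE => Hu Hv.
  have [l fl] : exists l, cderiv f (u +i* v) l by apply: fD.
  (* The remainder is at most this constant times [s * (p + q)]; the difference of two opposite
     edges doubles it, and the two side lengths give another [s * (p + q)]. The product is
     [e * s ^+ 2]. *)
  have e'0 : 0 < e / (2 * (p + q) ^+ 2).
    by rewrite divr_gt0// mulr_gt0// exprn_gt0.
  have [δ δ0 Hδ] := fl _ e'0.
  exists (δ / (p + q)); first by rewrite divr_gt0.
  move=> x y s /andP[s0]; rewrite ltr_pdivlMr// => sδ [sx1 sx2 sy1 sy2] xu yv.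
  rewrite /P.
  have sp : 0 < s * p by rewrite mulr_gt0.
  have sq : 0 < s * q by rewrite mulr_gt0.
  pose er w := f w - f (u +i* v) - l * (w - (u +i* v)).
  have er_le w : crect x (x + s * p) y (y + s * q) w ->
      normc (er w) <= e / (2 * (p + q) ^+ 2) * (s * (p + q)).
    move=> xyw; have wz : normc (w - (u +i* v)) <= s * (p + q).
      by rewrite mulrDr; apply: ler_normc_crect xyw; split.
    rewrite (le_trans (Hδ _ (le_lt_trans wz sδ)))// ler_wpM2l// ltW//.
  pose M := 2 * (e / (2 * (p + q) ^+ 2) * (s * (p + q))).
  have pq : p + q != 0 by rewrite gt_eqF.
  have xE : x + s * p - x = s * p by rewrite addrC addKr.
  have yE : y + s * q - y = s * q by rewrite addrC addKr.
  have xs : x <= x + s * p by rewrite lerDl ltW.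
  have ys : y <= y + s * q by rewrite lerDl ltW.
  have -> : e * s ^+ 2 = M * ((x + s * p - x) + (y + s * q - y)).
    by rewrite xE yE /M; field.
  have M2 w w' : crect x (x + s * p) y (y + s * q) w ->
      crect x (x + s * p) y (y + s * q) w' -> normc (er w - er w') <= M.
    move=> hw hw'; rewrite (le_trans (ler_normcB _ _))// /M mulrDl mul1r.
    by apply: lerD; exact: er_le.
  (* The two constants are the increments of the linear map w -> l w between opposite edges. *)
  apply: (@rect_int_le _ _ _ _ _ _ _ _ _ (l * (- ('i * (s * q)%:C))) (l * (s * p)%:C)) => //.
  - by apply: cdiff_on_subset fD => w [+ _]; exact: crect_subset.
  - by rewrite xE yE; ring.
  - move=> x' Hx'.
    have -> : f (x' +i* y) - f (x' +i* (y + s * q)) - l * - ('i * (s * q)%:C) =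
        er (x' +i* y) - er (x' +i* (y + s * q)).
      have -> : 'i * (s * q)%:C = (x' +i* (y + s * q)) - (x' +i* y).
        by apply/eqP; rewrite eq_complex/=; apply/andP; split; apply/eqP; ring.
      by rewrite /er; ring.
    by apply: M2; split=> //=; rewrite lexx ys.
  - move=> y' Hy'.
    have -> : f ((x + s * p) +i* y') - f (x +i* y') - l * (s * p)%:C =
        er ((x + s * p) +i* y') - er (x +i* y').
      have -> : (s * p)%:C = ((x + s * p) +i* y') - (x +i* y').
        by apply/eqP; rewrite eq_complex/=; apply/andP; split; apply/eqP; ring.
      by rewrite /er; ring.
    by apply: M2; split=> //=; rewrite lexx xs.
Qed.

End goursat.

(** * Cauchy's estimates on squares *)

Section cauchy.
Context {R : realType}.
Local Notation mu := (@lebesgue_measure R).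
Implicit Types (a b c d e s t : R) (f g : R[i] -> R[i]) (z w l : R[i]).

Lemma cderivD f g z l l' : cderiv f z l -> cderiv g z l' ->
  cderiv (fun w => f w + g w) z (l + l').
Proof.
move=> fl gl e e0; have e2 : 0 < e / 2 by rewrite divr_gt0.
have [d d0 Hd] := fl _ e2; have [d' d'0 Hd'] := gl _ e2.
exists (Num.min d d'); first by rewrite lt_min d0.
move=> w; rewrite lt_min => /andP[/Hd h /Hd' h'].
have -> : f w + g w - (f z + g z) - (l + l') * (w - z) =
  (f w - f z - l * (w - z)) + (g w - g z - l' * (w - z)) by ring.
by rewrite [e]splitr mulrDl; apply: le_trans (le_normcD _ _) _; exact: lerD.
Qed.

Lemma cderiv_cst (k : R[i]) z : cderiv (fun=> k) z 0.
Proof.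
move=> e e0; exists 1 => // w _; rewrite subrr mul0r subrr normc0.
by rewrite mulr_ge0 ?normc_ge0// ltW.
Qed.

Lemma cderivM f g z l l' : cderiv f z l -> cderiv g z l' ->
  cderiv (fun w => f w * g w) z (l * g z + f z * l').
Proof.
move=> fl gl e e0.
(* [K] adds up the factors that multiply [e / K] in the three error terms of the product; the 1
   comes from |g w| <= |g z| + 1 near z. *)
pose K := normc (g z) + 1 + normc l + normc (f z).
have K0 : 0 < K.
  rewrite /K; have := normc_ge0 (g z); have := normc_ge0 l; have := normc_ge0 (f z).
  lra.
have eK : 0 < e / K by rewrite divr_gt0.
have [d1 d10 H1] := fl _ eK; have [d2 d20 H2] := gl _ eK.
have [d3 d30 H3] := cderiv_cts gl eK; have [d4 d40 H4] := cderiv_cts gl ltr01.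
exists (Num.min (Num.min d1 d2) (Num.min d3 d4)).
  by rewrite !lt_min d10 d20 d30.
move=> w; rewrite !lt_min => /andP[/andP[/H1 h1 /H2 h2] /andP[/H3 h3 /H4 h4]].
have -> : f w * g w - f z * g z - (l * g z + f z * l') * (w - z) =
  (f w - f z - l * (w - z)) * g w + l * (w - z) * (g w - g z)
  + f z * (g w - g z - l' * (w - z)) by ring.
have gw : normc (g w) <= normc (g z) + 1.
  rewrite -(subrK (g z) (g w)) (le_trans (le_normcD _ _))// addrC lerD2l.
  exact: ltW.
set N := normc (w - z) in h1 h2 *.
apply: (@le_trans _ _ (e / K * N * (normc (g z) + 1) + normc l * N * (e / K)
    + normc (f z) * (e / K * N))).
  apply: le_trans (le_normcD _ _) _; apply: lerD.
    apply: le_trans (le_normcD _ _) _; apply: lerD; rewrite normcM.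
      by apply: ler_pM => //; exact: normc_ge0.
    rewrite normcM; apply: ler_pM; rewrite ?mulr_ge0 ?normc_ge0//.
    exact: ltW.
  by rewrite normcM ler_wpM2l ?normc_ge0.
rewrite -[leRHS](congr1 (fun k => k * N) (divfK (lt0r_neq0 K0) e)).
have KE : K = normc (g z) + 1 + normc l + normc (f z) by [].
by clearbody K N; rewrite {3}KE [leLHS](_ : _ = e / K * K * N) ?KE//; ring.
Qed.

Lemma cderivB f g z l l' : cderiv f z l -> cderiv g z l' ->
  cderiv (fun w => f w - g w) z (l - l').
Proof.
move=> fl gl.
have := cderivD fl (cderivM (cderiv_cst (-1) z) gl).
rewrite mul0r add0r mulN1r.
by under eq_fun do rewrite mulN1r.
Qed.

Lemma cderivV z : z != 0 -> cderiv (fun w => w^-1) z (- z^-1 ^+ 2).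
Proof.
rewrite -normc_gt0 => z0 e e0.
(* The first bound keeps |w| >= |z| / 2; with it the second one makes the remainder (w - z)^2 / (w
   z^2) at most e |w - z|. *)
pose D := Num.min (normc z / 2) (e * normc z ^+ 3 / 2).
have D0 : 0 < D by rewrite lt_min !divr_gt0// mulr_gt0// exprn_gt0.
exists D => // w; rewrite lt_min => /andP[wz we].
have zn0 : z != 0 by rewrite -normc_gt0.
have hw : normc z / 2 <= normc w.
  have := ler_normcB w (w - z); rewrite subKr.
  move: wz; set A := normc z; set B := normc w; set C := normc (w - z); lra.
have wn0 : w != 0 by rewrite -normc_gt0 (lt_le_trans _ hw)// divr_gt0.
have -> : w^-1 - z^-1 - - z^-1 ^+ 2 * (w - z) = (w - z) * ((w - z) * (w^-1 * z^-1 ^+ 2)).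
  by field; rewrite zn0 wn0.
rewrite normcM mulrC ler_wpM2r ?normc_ge0// normcM normcM normcX !normcV.
rewrite mulrA -ler_pdivlMr ?exprn_gt0 ?invr_gt0// ler_pdivrMr ?normc_gt0//.
rewrite (le_trans (ltW we))//.
have -> : e / (normc z)^-1 ^+ 2 = e * normc z ^+ 2 by rewrite exprVn invrK.
have -> : e * normc z ^+ 3 / 2 = e * normc z ^+ 2 * (normc z / 2) by ring.
by rewrite ler_wpM2l// mulr_ge0 ?exprn_ge0 ?normc_ge0// ltW.
Qed.

Definition csquare t := crect (- t) t (- t) t.
Definition square_int f t := rect_int f (- t) t (- t) t.

Lemma edge_normc t z : edges (- t) t (- t) t z -> t <= normc z <= 2 * t.
Proof.
move=> [[/andP[h1 h2] /andP[h3 h4]] h]; apply/andP; split; last first.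
  rewrite (le_trans (ler_normc_ReIm _))// mulrDl mul1r lerD// ler_norml ?h1//.
  by rewrite h3.
have hR := ler_Re_normc z; have hI := ler_Im_normc z.
have nt : `|t| <= normc z.
  by case: h => [|[|[|]]] h; [rewrite h normrN in hR|rewrite h in hR|
    rewrite h normrN in hI|rewrite h in hI].
exact: le_trans (ler_norm _) nt.
Qed.

(* The annulus is cut into four rectangles. *)
Lemma square_int_annulus g s t : 0 < s -> s < t ->
  cdiff_on (csquare t `\ 0) g -> square_int g t = square_int g s.
Proof.
move=> s0 st gD; have t0 := lt_trans s0 st.
have nt0 : - t < 0 by rewrite oppr_lt0.
have ns0 : - s < 0 by rewrite oppr_lt0.
have nst : - t < - s by rewrite ltrN2.
have [ts tt ss] : [/\ - t < s, - t < t & - s < s].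
  by split; [exact: lt_trans s0|exact: lt_trans t0|exact: lt_trans s0].
have nt := lt_trans ns0 t0.
have sub a b c d : - t <= a -> b <= t -> - t <= c -> d <= t ->
    (0 < a \/ b < 0 \/ 0 < c \/ d < 0) -> crect a b c d `<=` csquare t `\ 0.
  move=> h1 h2 h3 h4 h z [/andP[z1 z2] /andP[z3 z4]]; split.
    by apply: (crect_subset h1 h2 h3 h4); split; apply/andP.
  move=> z0; move: z1 z2 z3 z4; rewrite z0 /= => z1 z2 z3 z4.
  by case: h => [|[|[|]]]; rewrite ltNge ?z1 ?z2 ?z3 ?z4.
have mem x y : - t <= x -> x <= t -> - t <= y -> y <= t ->
    (x != 0 \/ y != 0) -> (csquare t `\ 0) (x +i* y).
  move=> h1 h2 h3 h4 h; split; first by rewrite /csquare/crect/= h1 h2 h3 h4.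
  by case=> x0 y0; case: h; rewrite ?x0 ?y0 eqxx.
have gz a b c d : a < b -> c < d -> - t <= a -> b <= t -> - t <= c -> d <= t ->
    (0 < a \/ b < 0 \/ 0 < c \/ d < 0) -> rect_int g a b c d = 0.
  by move=> ab cd h1 h2 h3 h4 h; apply: goursat => //; apply: cdiff_on_subset gD;
     apply: sub.
have ltt := lexx t; have lnn := lexx (- t).
have [? [? [? [? [? ?]]]]] : - t <= - s /\ - t <= s /\ - t <= t /\ - s <= s /\
    s <= t /\ - s <= t by rewrite !ltW.
have [? ? ? ?] : [/\ t != 0, - t != 0, s != 0 & - s != 0].
  by rewrite !oppr_eq0 !gt_eqF.
rewrite /square_int (@rect_int_splitx _ _ g (- t) (- s) t (- t) t gD); last 4 first.
- by apply/andP; split.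
- by [].
- by move=> x /andP[? ?]; split; apply: mem => //; right.
- by move=> y /andP[? ?]; split; apply: mem => //; left.
rewrite [X in X + _]gz ?add0r//; last by right; left.
rewrite (@rect_int_splitx _ _ g (- s) s t (- t) t gD); last 4 first.
- by apply/andP; split.
- by [].
- by move=> x /andP[sx ?]; split; apply: mem => //; (try by right);
    rewrite (le_trans _ sx).
- by move=> y /andP[? ?]; split; apply: mem => //; left.
rewrite [X in _ + X]gz ?addr0//; last by left.
rewrite (@rect_int_splity _ _ g (- s) s (- t) (- s) t gD); last 4 first.
- by [].
- by apply/andP; split.
- by move=> y /andP[? ?]; split; apply: mem => //; left.
- by move=> x /andP[sx xs]; split; apply: mem => //; (try by right);
    rewrite ?(le_trans _ sx) ?(le_trans xs).
rewrite [X in X + _]gz ?add0r//; last by right; right; right.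
rewrite (@rect_int_splity _ _ g (- s) s (- s) s t gD); last 4 first.
- by [].
- by apply/andP; split.
- move=> y /andP[sy yt]; have ? : - t <= y by rewrite (le_trans _ sy).
  by split; apply: mem => //; left.
- by move=> x /andP[sx xs]; split; apply: mem => //; (try by right);
    rewrite ?(le_trans _ sx) ?(le_trans xs).
by rewrite [X in _ + X]gz ?addr0//; right; right; left.
Qed.

Lemma edges_square t z : 0 < t -> edges (- t) t (- t) t z ->
  csquare t z /\ z != 0.
Proof.
move=> t0 h; split; first by case: h.
by rewrite -normc_gt0 (lt_le_trans t0)//; case/andP: (edge_normc h).
Qed.

Lemma edges_squareD t : 0 < t -> edges (- t) t (- t) t `<=` csquare t `\ 0.
Proof. by move=> t0 z /(edges_square t0)[? /eqP]; split. Qed.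

Lemma square_int_le g t M : 0 < t -> cdiff_on (csquare t `\ 0) g ->
  (forall z, edges (- t) t (- t) t z -> normc (g z) <= M) ->
  normc (square_int g t) <= 8 * t * M.
Proof.
move=> t0 gD H; have tt : - t <= t by rewrite ge0_cp ?ltW.
have -> : 8 * t * M = (M + M) * ((t - - t) + (t - - t)) by ring.
apply: (@rect_int_le _ _ _ _ _ _ _ tt tt _ 0 0).
- exact: cdiff_on_subset (edges_squareD t0) gD.
- by rewrite !mul0r mulr0 addr0.
- move=> x /(edges_h tt)[? ?].
  by rewrite subr0; apply: le_trans (ler_normcB _ _) _; apply: lerD; exact: H.
- move=> x /(edges_v tt)[? ?].
  by rewrite subr0; apply: le_trans (ler_normcB _ _) _; apply: lerD; exact: H.
Qed.

(** By [square_int_annulus] the square may be shrunk to half side s, where the integral is at most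
    the perimeter 8 s times a bound of order o(1/s). *)
Lemma square_int_small g t : 0 < t -> cdiff_on (csquare t `\ 0) g ->
  (forall e, 0 < e -> exists2 d, 0 < d &
    forall z, z != 0 -> normc z < d -> normc (z * g z) <= e) ->
  square_int g t = 0.
Proof.
move=> t0 gD H; apply/eqP; rewrite -normc_eq0 eq_le normc_ge0 andbT.
apply/ler_addgt0Pl => e e0; rewrite addr0.
have [|d d0 Hd] := H (e / 8); first by rewrite divr_gt0.
(* Points on the boundary of the square have modulus up to [2 * s], which stays below [d]. *)
pose s := Num.min (t / 2) (d / 4).
have s0 : 0 < s by rewrite lt_min !divr_gt0.
have st : s < t by rewrite /s gt_min; apply/orP; left; lra.
have sd4 : s <= d / 4 by rewrite ge_min lexx orbT.
have sd : 2 * s < d by lra.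
rewrite (square_int_annulus s0 st gD).
have -> : e = 8 * s * (e / 8 / s) by field; rewrite gt_eqF.
apply: square_int_le => // [|z ez].
  apply: cdiff_on_subset gD => z [sz z0]; split=> //.
  by apply: crect_subset sz; rewrite ?lerN2 ltW.
have [_ z0] := edges_square s0 ez.
have /andP[sz zs] := edge_normc ez.
have := Hd _ z0 (le_lt_trans zs sd); rewrite normcM => h.
rewrite ler_pdivlMr// (le_trans _ h)// mulrC ler_wpM2r ?normc_ge0//.
Qed.

Lemma square_intB g h t : 0 < t -> cdiff_on (csquare t `\ 0) g ->
  cdiff_on (csquare t `\ 0) h ->
  square_int (fun z => g z - h z) t = square_int g t - square_int h t.
Proof.
move=> t0 gD hD; have tt : - t <= t by rewrite ge0_cp ?ltW.
have [g1 g2 g3 g4] := edges_cts tt tt (cdiff_on_subset (edges_squareD t0) gD).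
have [h1 h2 h3 h4] := edges_cts tt tt (cdiff_on_subset (edges_squareD t0) hD).
have c (u v : R -> R[i]) : ccontinuous_on `[- t, t] u ->
    ccontinuous_on `[- t, t] v ->
    ccontinuous_on `[- t, t] (fun x => u x - v x) by exact: ccontinuous_onB.
rewrite /square_int /rect_int.
rewrite (CintB g1 g2) (CintB h1 h2) (CintB g4 g3) (CintB h4 h3).
rewrite (CintB (c _ _ g1 h1) (c _ _ g2 h2)) (CintB (c _ _ g4 h4) (c _ _ g3 h3)).
by rewrite (CintB g1 h1) (CintB g2 h2) (CintB g3 h3) (CintB g4 h4); ring.
Qed.

Lemma square_intZ g (k : R[i]) t : 0 < t -> cdiff_on (csquare t `\ 0) g ->
  square_int (fun z => k * g z) t = k * square_int g t.
Proof.
move=> t0 gD; have tt : - t <= t by rewrite ge0_cp ?ltW.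
have [g1 g2 g3 g4] := edges_cts tt tt (cdiff_on_subset (edges_squareD t0) gD).
rewrite /square_int /rect_int mulrDr [k * ('i * _)]mulrCA.
rewrite -(CintZ k (ccontinuous_onB g1 g2)) -(CintZ k (ccontinuous_onB g4 g3)).
by congr (Cint _ _ _ + 'i * Cint _ _ _); apply/funext => x; ring.
Qed.

Lemma cdiff_on_inv t : cdiff_on (csquare t `\ 0) (fun z => z^-1).
Proof. by move=> z [_ /eqP z0]; exists (- z^-1 ^+ 2); exact: cderivV. Qed.

(** In the imaginary part each pair of opposite edges contributes the integral of 2 t / (x^2 + t^2)
    over [-t, t]. The integrand is at least 1/t, so each pair gives at least 2. *)
Lemma normc_square_int_inv t : 0 < t -> 4 <= normc (square_int (fun z => z^-1) t).
Proof.
move=> t0; have tt : - t <= t by rewrite ge0_cp ?ltW.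
have [c1 c2 c3 c4] := edges_cts tt tt
  (cdiff_on_subset (edges_squareD t0) (@cdiff_on_inv t)).
have b1 := integrable_Im (ccontinuous_onB c1 c2).
have b2 := integrable_Re (ccontinuous_onB c4 c3).
rewrite (le_trans _ (le_trans (ler_norm _) (ler_Im_normc _)))//.
rewrite /square_int /rect_int /Cint raddfD/= mul0r mul1r add0r.
have H x : - t <= x <= t -> t^-1 <= 2 * t / (x ^+ 2 + t ^+ 2).
  move=> /andP[x1 x2].
  have xt : x ^+ 2 <= t ^+ 2.
    by rewrite -(real_normK (num_real x)) ler_pXn2r ?nnegrE ?normr_ge0 ?(ltW t0)// ler_norml x1.
  rewrite ler_pdivlMr; last by rewrite ltr_wpDl ?sqr_ge0 ?exprn_gt0.
  rewrite ler_pdivrMl//; move: xt; rewrite !expr2; lra.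
have -> : 4 = t^-1 * (t - - t) + t^-1 * (t - - t) :> R.
  by field; rewrite gt_eqF.
rewrite -Rintegral_itv_cst//.
have ic : mu.-integrable `[(- t), t] (EFin \o (fun=> t^-1)).
  by apply: integrable_dist => x _ e e0; exists 1 => // y _ _; rewrite subrr normr0.
rewrite lerD//; apply: le_Rintegral => // x; rewrite /= in_itv/= => /H h;
  apply: (le_trans h); rewrite sqrrN le_eqVlt; apply/orP; left; apply/eqP.
  by set D := x ^+ 2 + _; ring.
by rewrite [t ^+ 2 + _]addrC; set D := x ^+ 2 + _; ring.
Qed.

(** Subtracting l / z leaves a function to which [square_int_small] applies, so the integral of [g]
    is l times that of 1/z. This stands in for the residue theorem. *)
Lemma residue_le g l t : 0 < t -> cdiff_on (csquare t `\ 0) g ->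
  (forall e, 0 < e -> exists2 d, 0 < d &
    forall z, z != 0 -> normc z < d -> normc (z * g z - l) <= e) ->
  4 * normc l <= normc (square_int g t).
Proof.
move=> t0 gD H.
have iD := @cdiff_on_inv t.
have liD : cdiff_on (csquare t `\ 0) (fun z => l * z^-1).
  move=> z [_ /eqP z0]; eexists; apply: cderivM; first exact: cderiv_cst.
  exact: cderivV.
have : square_int (fun z => g z - l * z^-1) t = 0.
  apply: square_int_small => // [z Dz|e /H[d d0 Hd]].
    have [l1 h1] := gD _ Dz; have [l2 h2] := liD _ Dz.
    exists (l1 + (0 * (l * z^-1) + (-1) * l2)).
    have := cderivD h1 (cderivM (cderiv_cst (-1) z) h2).
    by under eq_fun do rewrite mulN1r.
  exists d => // z z0 zd; rewrite mulrBr mulrCA divff// mulr1; exact: Hd.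
rewrite square_intB// square_intZ// => /subr0_eq ->.
by rewrite normcM mulrC ler_wpM2l ?normc_ge0// normc_square_int_inv.
Qed.

Lemma normc_square_int g t : 0 < t -> cdiff_on (csquare t `\ 0) g ->
  normc (square_int g t) <=
    \int[mu]_(x in `[- t, t]) normc (g (x +i* - t)) +
    \int[mu]_(x in `[- t, t]) normc (g (x +i* t)) +
    \int[mu]_(y in `[- t, t]) normc (g (t +i* y)) +
    \int[mu]_(y in `[- t, t]) normc (g (- t +i* y)).
Proof.
move=> t0 gD; have tt : - t <= t by rewrite ge0_cp ?ltW.
have [c1 c2 c3 c4] := edges_cts tt tt (cdiff_on_subset (edges_squareD t0) gD).
rewrite /square_int /rect_int !CintB// (le_trans (le_normcD _ _))//.
rewrite -addrA lerD//; last rewrite normcM normci mul1r;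
  rewrite (le_trans (ler_normcB _ _))// lerD//; exact: normc_Cint.
Qed.

Lemma cdiff_onM (D : set R[i]) f g : cdiff_on D f -> cdiff_on D g ->
  cdiff_on D (fun z => f z * g z).
Proof.
move=> fD gD z Dz; have [l fl] := fD _ Dz; have [l' gl] := gD _ Dz.
by eexists; exact: cderivM fl gl.
Qed.

(** [residue_le] for f(z) / z, whose residue at 0 is f(0); on the boundary |1/z| <= 1/t. *)
Lemma cauchy_mean f t : 0 < t -> cdiff_on (csquare t) f ->
  4 * t * normc (f 0) <=
    \int[mu]_(x in `[- t, t]) normc (f (x +i* - t)) +
    \int[mu]_(x in `[- t, t]) normc (f (x +i* t)) +
    \int[mu]_(y in `[- t, t]) normc (f (t +i* y)) +
    \int[mu]_(y in `[- t, t]) normc (f (- t +i* y)).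
Proof.
move=> t0 fD; have tt : - t <= t by rewrite ge0_cp ?ltW.
have fD0 : cdiff_on (csquare t `\ 0) f by apply: cdiff_on_subset fD => z [].
have gD := cdiff_onM fD0 (@cdiff_on_inv t).
have f0 : csquare t 0 by split; rewrite /= oppr_le0 ltW.
have := residue_le t0 gD (l := f 0) => H.
have {H} : 4 * normc (f 0) <= normc (square_int (fun z => f z / z) t).
  apply: H => e e0; have [l fl] := fD _ f0; have [d d0 Hd] := cderiv_cts fl e0.
  by exists d => // z z0 zd; rewrite mulrC divfK// ltW// Hd// subr0.
move=> /le_trans/(_ (normc_square_int t0 gD)).
have [c1 c2 c3 c4] := edges_cts tt tt (cdiff_on_subset (edges_squareD t0) fD0).
have [d1 d2 d3 d4] := edges_cts tt tt (cdiff_on_subset (edges_squareD t0) gD).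
have E z : edges (- t) t (- t) t z -> normc (f z / z) <= t^-1 * normc (f z).
  move=> ez; rewrite normcM normcV mulrC ler_wpM2r ?normc_ge0//.
  have /andP[h _] := edge_normc ez.
  by rewrite lef_pV2 ?posrE// (lt_le_trans t0).
have K (p : R -> R[i]) : ccontinuous_on `[- t, t] (fun x => f (p x)) ->
    ccontinuous_on `[- t, t] (fun x => f (p x) / p x) ->
    (forall x, - t <= x <= t -> edges (- t) t (- t) t (p x)) ->
    \int[mu]_(x in `[- t, t]) normc (f (p x) / p x) <=
    t^-1 * \int[mu]_(x in `[- t, t]) normc (f (p x)).
  move=> cp cp' Hp; have ip := integrable_normc cp.
  rewrite -RintegralZl//; apply: le_Rintegral => //.
  - exact: integrable_normc.
  - exact: integrable_scale.
  - by move=> x; rewrite /= in_itv/= => /Hp; exact: E.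
move=> H; rewrite [4 * t]mulrC -mulrA -ler_pdivlMl//; apply: (le_trans H).
rewrite !mulrDr !lerD//.
- by apply: (K (fun x => x +i* - t)) => // x /(edges_h tt)[].
- by apply: (K (fun x => x +i* t)) => // x /(edges_h tt)[].
- by apply: (K (fun x => t +i* x)) => // x /(edges_v tt)[].
- by apply: (K (fun x => - t +i* x)) => // x /(edges_v tt)[].
Qed.

(** [residue_le] for (f(z) - f(0)) / z^2, whose residue is the derivative at 0. On the boundary this
    function is at most 2 M / t^2, and the perimeter is 8 t. *)
Lemma cauchy_deriv f l t M : 0 < t -> cdiff_on (csquare t) f -> cderiv f 0 l ->
  (forall z, csquare t z -> normc (f z) <= M) -> normc l <= 4 * M / t.
Proof.
move=> t0 fD fl fM.
have fD0 : cdiff_on (csquare t `\ 0) f by apply: cdiff_on_subset fD => z [].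
have f0 : csquare t 0 by split; rewrite /= oppr_le0 ltW.
have iD := @cdiff_on_inv t.
have gD : cdiff_on (csquare t `\ 0) (fun z => (f z - f 0) * (z^-1 * z^-1)).
  apply: cdiff_onM; last exact: cdiff_onM.
  move=> z Dz; have [m fm] := fD0 _ Dz; exists (m + 0).
  exact: cderivD fm (cderiv_cst (- f 0) z).
have H : 4 * normc l <= normc (square_int (fun z => (f z - f 0) * (z^-1 * z^-1)) t).
  apply: residue_le => // e /fl[d d0 Hd]; exists d => // z z0 zd.
  have -> : z * ((f z - f 0) * (z^-1 * z^-1)) - l = (f z - f 0 - l * (z - 0)) / z.
    by field.
  rewrite normcM normcV ler_pdivrMr ?normc_gt0//.
  by have := Hd z; rewrite !subr0; exact.
suff : 4 * normc l <= 8 * t * (2 * M / t ^+ 2).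
  have -> : 8 * t * (2 * M / t ^+ 2) = 4 * (4 * M / t) by field; rewrite gt_eqF.
  by rewrite ler_pM2l.
apply: (le_trans H); apply: square_int_le => // z ez.
have /andP[tz _] := edge_normc ez; have [sz z0] := edges_square t0 ez.
rewrite !normcM !normcV -invfM -expr2; apply: ler_pM; rewrite ?normc_ge0//.
- by rewrite invr_ge0 sqr_ge0.
- apply: (le_trans (ler_normcB _ _)); rewrite mulrDl mul1r.
  by apply: lerD; exact: fM.
- have nz0 : 0 < normc z by rewrite normc_gt0.
  rewrite lef_pV2 ?posrE ?exprn_gt0//.
  by rewrite ler_pXn2r ?nnegrE ?normc_ge0 ?(ltW t0).
Qed.

End cauchy.

(** * Gradients in several variables *)

Section complex_rV_topology.
Context {R : realType} {n : nat}.
Local Notation Cn := 'rV[R[i]]_n.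
Implicit Types (z w : Cn) (A : set Cn).

Definition polydisc z (e : R) : set Cn :=
  [set w | forall j, normc (w 0 j - z 0 j) < e].

Lemma normc_def2 (x : R[i]) : `|x| = (normc x)%:C.
Proof. by rewrite normc_def; case: x. Qed.

(** The balls of the topology have radii in [R[i]]. A positive element there is real, so
    neighbourhoods can be tested with real radii. *)
Lemma nbhs_polydiscP z A :
  nbhs z A <-> exists2 e : R, 0 < e & polydisc z e `<=` A.
Proof.
split=> [/nbhs_ballP[e /= e0 zA]|[e e0 zA]].
  exists (complex.Re e); first by move: e0; rewrite ltcE => /andP[].
  move=> w zw; apply: zA; split=> // i j; rewrite (ord1 i) /ball/= normc_def2.
  move: e0; rewrite !ltcE/= => /andP[-> _]/=.
  by rewrite normc_distC zw.
apply/nbhs_ballP; exists e%:C; first by rewrite /= ltcR.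
move=> w zw; apply: zA => j; have := zw.2 0 j.
by rewrite /ball/= normc_def2 ltcR normc_distC.
Qed.

Definition nrm1 (h : Cn) : R := \sum_j normc (h 0 j).

(* Only real quantities are compared here, which suits restrictions to
   coordinate lines and to real segments. *)
Definition cgrad (f : Cn -> R[i]) z (g : 'I_n -> R[i]) :=
  forall e, 0 < e -> exists2 d, 0 < d & forall w, polydisc z d w ->
    normc (f w - f z - \sum_j g j * (w 0 j - z 0 j)) <= e * nrm1 (w - z).

Lemma mx_norm_nrm1 (h : Cn) : `|h| <= (nrm1 h)%:C.
Proof.
have n0 : 0 <= (nrm1 h)%:C.
  by rewrite lecR sumr_ge0// => j _; exact: normc_ge0.
rewrite -[`|h|]/(mx_norm h); have [->//|/mx_norm_neq0[[i j] ->/=]] := eqVneq (mx_norm h) 0.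
rewrite (ord1 i) normc_def2 lecR /nrm1 (bigD1 j)//= lerDl sumr_ge0// => k _.
exact: normc_ge0.
Qed.

Lemma differentiable_cgrad (f : Cn -> R[i]) z : differentiable f z ->
  cgrad f z (fun j => 'D_(delta_mx 0 j) f z).
Proof.
move=> df e e0; move: (df) => /diff_locally; set k := 'o _ => fE.
have ec0 : 0 < e%:C by rewrite ltcR.
have /nbhs_polydiscP[d d0 Hd] : nbhs (0 : Cn) [set x : Cn | `|k x| <= e%:C * `|x| ].
  exact: (littleoP k ec0).
exists d => // w zw.
have kE : k (w - z) = f w - f z - \sum_j 'D_(delta_mx 0 j) f z * (w 0 j - z 0 j).
  have -> : f w = f z + 'd f z (w - z) + k (w - z).
    by have /(congr1 (fun F => F (w - z))) := fE; rewrite /= subrK.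
  have -> : 'd f z (w - z) = \sum_j 'D_(delta_mx 0 j) f z * (w 0 j - z 0 j).
    rewrite {1}[w - z]row_sum_delta linear_sum; apply: eq_bigr => j _.
    by rewrite linearZ deriveE// mulrC !mxE.
  by ring.
rewrite -kE -lecR -normc_def2 rmorphM.
rewrite (le_trans (Hd (w - z) _))//.
  by move=> j; have := zw j; rewrite !mxE subr0.
by apply: ler_wpM2l; [exact: ltW|exact: mx_norm_nrm1].
Qed.

Lemma rV_subE (a b : Cn) k : (a - b) 0 k = a 0 k - b 0 k.
Proof. by rewrite !mxE. Qed.

Lemma nrm1_ge0 (h : Cn) : 0 <= nrm1 h.
Proof. by rewrite sumr_ge0// => j _; exact: normc_ge0. Qed.

Lemma nrm1_polydisc z w (d : R) : nrm1 (w - z) < d -> polydisc z d w.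
Proof.
move=> h j; apply: le_lt_trans h; rewrite /nrm1 (bigD1 j)//= !mxE.
by rewrite lerDl sumr_ge0// => k _; exact: normc_ge0.
Qed.

Lemma polydisc_nrm1 z w (d : R) : polydisc z d w -> nrm1 (w - z) <= n%:R * d.
Proof.
move=> h; rewrite mulr_natl -[X in _ *+ X]card_ord -sumr_const.
by apply: ler_sum => j _; rewrite !mxE ltW.
Qed.

Lemma ler_normc_sum (I : Type) (s : seq I) (P : pred I) (F : I -> R[i]) :
  normc (\sum_(i <- s | P i) F i) <= \sum_(i <- s | P i) normc (F i).
Proof.
elim/big_rec2 : _ => [|i y x _ IH]; first by rewrite normc0.
by rewrite (le_trans (le_normcD _ _))// lerD2l.
Qed.

Lemma cgrad_le (f : Cn -> R[i]) z g : cgrad f z g -> forall e, 0 < e ->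
  exists2 d, 0 < d & forall w, polydisc z d w -> normc (f w - f z) < e.
Proof.
move=> /(_ 1 ltr01)[d d0 Hd] e e0.
pose G := \sum_j normc (g j).
have G0 : 0 <= G by rewrite sumr_ge0// => j _; exact: normc_ge0.
pose K := 1 + n%:R * (1 + G).
have K0 : 0 < K by rewrite ltr_wpDr// mulr_ge0// addr_ge0.
exists (Num.min d (e / K)); first by rewrite lt_min d0 divr_gt0.
move=> w zw.
have zwd : polydisc z d w by move=> j; have := zw j; rewrite lt_min => /andP[].
have zwe : polydisc z (e / K) w by move=> j; have := zw j; rewrite lt_min => /andP[].
have -> : f w - f z = (f w - f z - \sum_j g j * (w 0 j - z 0 j))
    + \sum_j g j * (w 0 j - z 0 j) by ring.
have N1 := polydisc_nrm1 zwe.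
rewrite (le_lt_trans (le_normcD _ _))//.
apply: (@le_lt_trans _ _ ((1 + G) * nrm1 (w - z))).
  rewrite mulrDl lerD//; first exact: Hd.
  rewrite (le_trans (ler_normc_sum _ _ _))// /G mulr_suml; apply: ler_sum => j _.
  rewrite normcM ler_wpM2l ?normc_ge0// /nrm1 (bigD1 j)//= !mxE.
  by rewrite lerDl sumr_ge0// => k _; exact: normc_ge0.
rewrite (@le_lt_trans _ _ ((1 + G) * (n%:R * (e / K))))//.
  by rewrite ler_wpM2l// addr_ge0.
have -> : (1 + G) * (n%:R * (e / K)) = (K - 1) * e / K by rewrite /K; ring.
by rewrite ltr_pdivrMr// mulrC ltr_pM2l// ltrBlDr ltrDl.
Qed.

Definition cline z (j : 'I_n) (x : R[i]) : Cn := z + x *: delta_mx 0 j.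

Lemma clineE z j x k : cline z j x 0 k = z 0 k + x *+ (k == j).
Proof. by rewrite !mxE eqxx/=; case: eqP; rewrite ?mulr1 ?mulr0. Qed.

Lemma cgrad_cline (f : Cn -> R[i]) z j x g : cgrad f (cline z j x) g ->
  cderiv (fun y => f (cline z j y)) x (g j).
Proof.
move=> fg e /fg[d d0 Hd]; exists d => // y xy.
have E k : cline z j y 0 k - cline z j x 0 k = (y - x) *+ (k == j).
  by rewrite !clineE opprD addrACA subrr add0r mulrnBl.
have := Hd (cline z j y); rewrite (_ : \sum_k _ = g j * (y - x)); last first.
  rewrite (bigD1 j)//= E eqxx mulr1n big1 ?addr0// => k /negPf kj.
  by rewrite E kj mulr0n mulr0.
rewrite (_ : nrm1 _ = normc (y - x)); last first.
  have E' k : (cline z j y - cline z j x) 0 k = (y - x) *+ (k == j).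
    by rewrite rV_subE E.
  rewrite /nrm1 (bigD1 j)//=.
  rewrite E' eqxx mulr1n big1 ?addr0// => k /negPf kj.
  by rewrite E' kj mulr0n normc0.
apply => k; rewrite E; case: eqP => _; rewrite ?mulr1n// mulr0n normc0//.
Qed.

Lemma is_derive_dist (h : R -> R) x l : (forall e, 0 < e ->
    exists2 d, 0 < d & forall y, `|y - x| < d ->
      `|h y - h x - l * (y - x)| <= e * `|y - x|) ->
  is_derive x 1 h l.
Proof.
move=> H.
suff C : (fun t : R => t^-1 *: (h (t *: 1 + x) - h x)) @ 0^' --> l.
  by apply: DeriveDef; [apply/cvg_ex; exists l|exact/cvg_lim].
apply/cvgrPdist_le => e e0; have [d d0 Hd] := H _ e0.
apply/nbhs_ballP; exists d => //= t; rewrite /ball/= sub0r normrN => td t0.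
have -> : l - t^-1 *: (h (t *: 1 + x) - h x) =
    - (t^-1 * (h (t + x) - h x - l * (t + x - x))).
  rewrite addrK /GRing.scale/= mulr1; field; exact: t0.
rewrite normrN normrM normfV ler_pdivrMl ?normr_gt0//.
by rewrite [leRHS]mulrC; have := Hd (t + x); rewrite addrK; exact.
Qed.

(** The mean value theorem fails for complex values, so it is applied to the real function Re (conj
    D * f) along the segment, with D = f(b) - f(a). Its increment is |D|^2 and its derivative is at
    most |D| M. *)
Lemma cgrad_mean_value (f : Cn -> R[i]) (a b : Cn) (g : R -> 'I_n -> R[i]) M :
  (forall t, 0 <= t <= 1 -> cgrad f (a + t%:C *: (b - a)) (g t)) ->
  (forall t, 0 <= t <= 1 -> normc (\sum_j g t j * (b 0 j - a 0 j)) <= M) ->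
  normc (f b - f a) <= M.
Proof.
move=> fg gM.
have [->|D0] := eqVneq (f b - f a) 0.
  by rewrite normc0 (le_trans (normc_ge0 _) (gM 0 _)) ?lexx ?ler01.
set D := f b - f a in D0 *; pose p t := a + t%:C *: (b - a).
pose h t := complex.Re (D^*%C * f (p t)).
pose dh t := complex.Re (D^*%C * \sum_j g t j * (b 0 j - a 0 j)).
pose N := nrm1 (b - a) + 1.
have N0 : 0 < N by rewrite ltr_wpDl// nrm1_ge0.
have DN : 0 < normc D by rewrite normc_gt0.
have der t : 0 <= t <= 1 -> forall e, 0 < e ->
    exists2 d, 0 < d & forall y, `|y - t| < d ->
      `|h y - h t - dh t * (y - t)| <= e * `|y - t|.
  move=> t01 e e0; have eN : 0 < e / (normc D * N) by rewrite divr_gt0// mulr_gt0.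
  have [d d0 Hd] := fg t t01 _ eN; exists (d / N); first by rewrite divr_gt0.
  move=> y; rewrite ltr_pdivlMr// => yt.
  have E j : p y 0 j - p t 0 j = (y - t)%:C * (b 0 j - a 0 j).
    by rewrite !mxE rmorphB; ring.
  have n1 : nrm1 (p y - p t) <= `|y - t| * N.
    rewrite /N mulrDr mulr1 ler_wpDr// /nrm1 mulr_sumr; apply: ler_sum => j _.
    by rewrite !rV_subE E normcM normcR.
  have -> : h y - h t - dh t * (y - t) =
    complex.Re (D^*%C * (f (p y) - f (p t) - \sum_j g t j * (p y 0 j - p t 0 j))).
    rewrite (_ : \sum_j _ = (y - t)%:C * \sum_j g t j * (b 0 j - a 0 j)); last first.
      by rewrite mulr_sumr; apply: eq_bigr => j _; rewrite E; ring.
    rewrite /h /dh; set S := \sum_j _.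
    have ReB (u v : R[i]) : complex.Re (u - v) = complex.Re u - complex.Re v.
      by case: u; case: v.
    rewrite [in RHS]mulrBr [in RHS]mulrBr !ReB; congr (_ - _).
    rewrite [in RHS]mulrCA.
    by case: (D^*%C * S) => u v /=; ring.
  apply: (le_trans (ler_Re_normc _)); rewrite normcM normc_conj.
  rewrite -ler_pdivlMl//; apply: (le_trans (Hd _ _)).
    exact/nrm1_polydisc/(le_lt_trans n1).
  apply: (@le_trans _ _ (e / (normc D * N) * (`|y - t| * N))).
    by rewrite ler_wpM2l// ltW.
  rewrite le_eqVlt; apply/orP; left; apply/eqP; field.
  by rewrite !gt_eqF.
have [||c c01 hc] := @MVT R h dh 0 1 ltr01.
- move=> t; rewrite in_itv/= => /andP[t0 t1].
  by apply: is_derive_dist; apply: der; rewrite !ltW.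
- apply: within_continuous_dist => t; rewrite /= in_itv/= => t01 e e0.
  have [d d0 Hd] := der t t01 _ ltr01.
  pose K := 1 + `|dh t|; have K0 : 0 < K by rewrite ltr_wpDr.
  exists (Num.min d (e / K)); first by rewrite lt_min d0 divr_gt0.
  move=> y _; rewrite lt_min => /andP[/Hd yd]; rewrite ltr_pdivlMr// => yK.
  rewrite -(subrK (dh t * (y - t)) (h y - h t)).
  rewrite (le_lt_trans (ler_normD _ _))// (le_lt_trans _ yK)//.
  rewrite normrM [leRHS]mulrC /K [leRHS]mulrDl lerD2r//.
have hb : h 1 - h 0 = normc D ^+ 2.
  rewrite /h; have -> : p 1 = b by rewrite /p scale1r [a + _]addrC subrK.
  have -> : p 0 = a by rewrite /p scale0r addr0.
  rewrite -raddfB -mulrBr -/D normc_sqr.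
  by case: (D) => u v /=; ring.
move: hc; rewrite hb subr0 mulr1 => hc.
have : normc D ^+ 2 <= normc D * M.
  rewrite hc (le_trans (ler_norm _))// (le_trans (ler_Re_normc _))// normcM normc_conj.
  by rewrite ler_wpM2l ?normc_ge0// gM//; move: c01; rewrite in_itv/= => /andP[c0 c1]; rewrite !ltW.
by rewrite expr2 ler_pM2l.
Qed.

End complex_rV_topology.

(** * Cauchy estimates and their consequences on polysquares *)

Section several_variables.
Context {R : realType} {n : nat}.
Local Notation Cn := 'rV[R[i]]_n.
Implicit Types (z w a b c : Cn) (f : Cn -> R[i]) (g : 'I_n -> R[i]) (D : set Cn).

Definition cgrad_on D f := forall z, D z -> exists g, cgrad f z g.

Definition cbox c (s : R) : set Cn := [set w | forall j, csquare s (w 0 j - c 0 j)].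

Lemma csquareP (s : R) (x : R[i]) :
  csquare s x <-> `|complex.Re x| <= s /\ `|complex.Im x| <= s.
Proof. by rewrite !ler_norml. Qed.

Lemma csquareS (s t : R) : s <= t -> csquare s `<=` csquare t.
Proof. by move=> st; apply: crect_subset; rewrite ?lerN2. Qed.

Lemma csquareD (s t : R) x y : csquare s x -> csquare t y -> csquare (s + t) (x + y).
Proof.
move=> /csquareP[x1 x2] /csquareP[y1 y2]; apply/csquareP; rewrite !raddfD.
by split; apply: (le_trans (ler_normD _ _)); exact: lerD.
Qed.

Lemma csquare0 (s : R) : 0 <= s -> csquare s 0.
Proof. by move=> s0; apply/csquareP; rewrite !normr0. Qed.

Lemma cbox_center c (s : R) : 0 <= s -> cbox c s c.
Proof. by move=> s0 j; rewrite subrr; exact: csquare0. Qed.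

Lemma cboxS c (s t : R) : s <= t -> cbox c s `<=` cbox c t.
Proof. by move=> st w cw j; exact: csquareS (cw j). Qed.

Lemma cbox_trans c w a (s t : R) : cbox c s w -> cbox w t a -> cbox c (s + t) a.
Proof.
move=> cw wa j; rewrite (_ : a 0 j - c 0 j = (w 0 j - c 0 j) + (a 0 j - w 0 j)); last by ring.
exact: csquareD.
Qed.

Lemma normc_csquare (s : R) (x : R[i]) : normc x <= s -> csquare s x.
Proof.
by move=> xs; apply/csquareP; split; apply: le_trans xs;
  [exact: ler_Re_normc|exact: ler_Im_normc].
Qed.

Lemma csquare_normc (s : R) (x : R[i]) : csquare s x -> normc x <= s + s.
Proof.
by move=> /csquareP[h1 h2]; apply: (le_trans (ler_normc_ReIm _)); exact: lerD.
Qed.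

Lemma polydisc_cbox c (s : R) : polydisc c s `<=` cbox c s.
Proof. by move=> w cw j; apply: normc_csquare; exact: ltW. Qed.

Lemma cbox_polydisc c (s d : R) : s + s < d -> cbox c s `<=` polydisc c d.
Proof. by move=> sd w cw j; exact: le_lt_trans (csquare_normc (cw j)) sd. Qed.

Lemma cbox_cline c j (s : R) x : 0 <= s -> csquare s x -> cbox c s (cline c j x).
Proof.
move=> s0 sx k; rewrite clineE addrAC subrr add0r; case: eqP => _.
  by rewrite mulr1n.
by rewrite mulr0n; exact: csquare0.
Qed.

Lemma cline0 c j : cline c j 0 = c.
Proof. by rewrite /cline scale0r addr0. Qed.

Lemma cgrad_cline_on D f z j : cgrad_on D f ->
  cdiff_on [set x | D (cline z j x)] (fun x => f (cline z j x)).
Proof.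
by move=> fD x /fD[g fg]; exists (g j); exact: cgrad_cline.
Qed.

Lemma cauchy_grad f c (s M : R) g j : 0 < s -> cgrad_on (cbox c s) f ->
  (forall w, cbox c s w -> normc (f w) <= M) -> cgrad f c g ->
  normc (g j) <= 4 * M / s.
Proof.
move=> s0 fD fM fg; have s0' := ltW s0.
apply: (@cauchy_deriv _ (fun x => f (cline c j x)) (g j) s M s0).
- by apply: (cdiff_on_subset _ (@cgrad_cline_on _ f c j fD)) => x; exact: cbox_cline.
- by apply: cgrad_cline; rewrite cline0.
- by move=> x sx; apply: fM; exact: cbox_cline.
Qed.

Lemma cbox_convex c (s : R) a b t : 0 <= t <= 1 -> cbox c s a -> cbox c s b ->
  cbox c s (a + t%:C *: (b - a)).
Proof.
move=> /andP[t0 t1] ca cb j; have /csquareP[a1 a2] := ca j.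
have /csquareP[b1 b2] := cb j; apply/csquareP; rewrite !mxE.
move: a1 a2 b1 b2.
case: (a 0 j) (b 0 j) (c 0 j) => [x1 y1] [x2 y2] [x3 y3] /=.
rewrite !mul0r !subr0 addr0 !ler_norml.
move=> /andP[? ?] /andP[? ?] /andP[? ?] /andP[? ?].
have H (u v w : R) : - s <= u - w -> u - w <= s -> - s <= v - w -> v - w <= s ->
    - s <= u + t * (v - u) - w <= s.
  move=> h1 h2 h3 h4.
  have -> : u + t * (v - u) - w = (1 - t) * (u - w) + t * (v - w) by ring.
  have t1' : 0 <= 1 - t by rewrite subr_ge0.
  have sE : s = (1 - t) * s + t * s by ring.
  by rewrite {2}sE [X in - X <= _]sE opprD -!mulrN !lerD// ler_wpM2l.
by split; exact: H.
Qed.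

(** Each point of the smaller box is the centre of a box of half side s inside the larger one.
    Cauchy's estimate there bounds the gradient along the segment, which stays in the smaller box by
    convexity. *)
Lemma cgrad_lipschitz f c (s M : R) : 0 < s -> cgrad_on (cbox c (s + s)) f ->
  (forall w, cbox c (s + s) w -> normc (f w) <= M) ->
  forall a b, cbox c s a -> cbox c s b ->
  normc (f b - f a) <= 4 * M / s * nrm1 (b - a).
Proof.
move=> s0 fD fM a b ca cb.
have st : s <= s + s by rewrite lerDl ltW.
have Hs w : cbox c s w -> cbox w s `<=` cbox c (s + s).
  by move=> cw v; exact: cbox_trans.
have /choice[G HG] (t : R) : exists g, 0 <= t <= 1 -> cgrad f (a + t%:C *: (b - a)) g.
  have [t01|nt01] := boolP (0 <= t <= 1); last by exists (fun=> 0).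
  have [g fg] := fD _ (cboxS st (cbox_convex t01 ca cb)).
  by exists g.
apply: (cgrad_mean_value HG) => t t01.
rewrite (le_trans (ler_normc_sum _ _ _))// /nrm1 mulr_sumr; apply: ler_sum => j _.
rewrite normcM rV_subE ler_wpM2r ?normc_ge0//.
have ct := cbox_convex t01 ca cb.
apply: (@cauchy_grad f _ s M _ j s0 _ _ (HG t t01)).
  by move=> w /(Hs _ ct); exact: fD.
by move=> w /(Hs _ ct); exact: fM.
Qed.

(** No second derivatives are involved: [g' j - g j] is the derivative at 0 of x -> f(w + x e_j) -
    f(c + x e_j). The Lipschitz bound makes this function small, and Cauchy's estimate passes the
    smallness on to the derivative. *)
Lemma cgrad_continuous f c g : (exists2 d, 0 < d & cgrad_on (polydisc c d) f) ->
  cgrad f c g -> forall e, 0 < e -> exists2 d, 0 < d & forall w g',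
  polydisc c d w -> cgrad f w g' -> forall j, normc (g' j - g j) < e.
Proof.
move=> [d d0 fD] fg e e0; have [d' d'0 Hd'] := cgrad_le fg ltr01.
(* Boxes of half side 4 s are used. Their points are at distance at most 8 s from c in each
   coordinate, which is half of the available radius. *)
pose s := Num.min d d' / 16; pose M := normc (f c) + 1.
have m0 : 0 < Num.min d d' by rewrite lt_min d0.
have s0 : 0 < s by rewrite divr_gt0.
have M0 : 0 <= M by rewrite addr_ge0 ?normc_ge0.
have sub : cbox c (s + s + (s + s)) `<=` polydisc c (Num.min d d').
  by apply: cbox_polydisc; rewrite /s; lra.
have fD' : cgrad_on (cbox c (s + s + (s + s))) f.
  by move=> w /sub cw; apply: fD => j; have := cw j; rewrite lt_min => /andP[].
have fM w : cbox c (s + s + (s + s)) w -> normc (f w) <= M.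
  move=> /sub cw; rewrite -(subrK (f c) (f w)) (le_trans (le_normcD _ _))//.
  rewrite /M addrC lerD2l ltW// Hd'// => j.
  by have := cw j; rewrite lt_min => /andP[].
have ss0 : 0 < s + s by rewrite addr_gt0.
have lip := cgrad_lipschitz ss0 fD' fM.
pose L := 4 * M / (s + s).
have L0 : 0 <= L by apply: divr_ge0; [exact: mulr_ge0|exact: ltW].
pose K := 4 * (L * n%:R) / s + 1.
have K0 : 0 < K.
  apply: ltr_wpDl => //; apply: divr_ge0; last exact: ltW.
  by apply: mulr_ge0 => //; exact: mulr_ge0.
exists (Num.min s (e / K)); first by rewrite lt_min s0 divr_gt0.
move=> w g' cw fg' j.
have cws : cbox c s w.
  by apply: polydisc_cbox => k; have := cw k; rewrite lt_min => /andP[].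
have cwe : polydisc c (e / K) w by move=> k; have := cw k; rewrite lt_min => /andP[].
have s4 : s + s <= s + s + (s + s) by rewrite lerDl ltW.
have cbs : cbox c s `<=` cbox c (s + s) by apply: cboxS; rewrite lerDl ltW.
have wx x : csquare s x -> cbox c (s + s) (cline w j x).
  by move=> sx; apply: cbox_trans cws (cbox_cline _ _ (ltW s0) sx).
have cx x : csquare s x -> cbox c (s + s) (cline c j x).
  by move=> sx; apply: cbs; exact: cbox_cline (ltW s0) sx.
have : normc (g' j - g j) <= 4 * (L * nrm1 (w - c)) / s.
  apply: (@cauchy_deriv _ (fun x => f (cline w j x) - f (cline c j x)) _ _ _ s0).
  - move=> x sx.
    have [l1 h1] := fD' _ (cboxS s4 (wx _ sx)).
    have [l2 h2] := fD' _ (cboxS s4 (cx _ sx)).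
    exists (l1 j - l2 j); apply: cderivB; exact: cgrad_cline.
  - by apply: cderivB; apply: cgrad_cline; rewrite cline0.
  - move=> x sx; rewrite (le_trans (lip _ _ (cx _ sx) (wx _ sx)))//.
    by rewrite /cline opprD addrACA subrr addr0.
move=> /le_lt_trans; apply.
have H := polydisc_nrm1 cwe.
apply: (@le_lt_trans _ _ (4 * (L * (n%:R * (e / K))) / s)).
  by rewrite ler_wpM2r ?invr_ge0 ?(ltW s0)// ler_wpM2l// ler_wpM2l.
rewrite [ltLHS](_ : _ = (K - 1) * e / K); last by rewrite /K; ring.
by rewrite ltr_pdivrMr// mulrC ltr_pM2l// ltrBlDr ltrDl.
Qed.

End several_variables.

(** * Lebesgue measure on C^n *)

Section tuple_integral.
Context {R : realType}.
Local Notation mu := (@lebesgue_measure R).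
Local Open Scope ereal_scope.

Lemma tuple_tonelli n (F : n.+1.-tuple R -> \bar R) :
  measurable_fun setT F -> (forall t, 0 <= F t) ->
  \int[lebesgue_tuple n.+1]_t F t =
  \int[mu]_x \int[lebesgue_tuple n]_t F (consT (x, t)).
Proof.
move=> mF F0.
transitivity (\int[(mu \x lebesgue_tuple n)]_p F (consT p)).
  by rewrite (@ge0_integral_pushforward _ _ _ _ _ (@consT R n) (@measurable_consT R n) _ setT).
rewrite fubini_tonelli1//.
by apply: measurableT_comp => //; exact: measurable_consT.
Qed.

Definition upd n (t : n.-tuple R) (k : 'I_n) (x : R) : n.-tuple R :=
  [tuple if i == k then x else tnth t i | i < n].

Lemma tnth_upd n (t : n.-tuple R) k x i :
  tnth (upd t k x) i = if i == k then x else tnth t i.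
Proof. by rewrite tnth_mktuple. Qed.

Lemma upd_upd n (t : n.-tuple R) k x y : upd (upd t k x) k y = upd t k y.
Proof. by apply: eq_from_tnth => i; rewrite !tnth_upd; case: eqP. Qed.

Lemma measurable_upd n (k : 'I_n) :
  measurable_fun setT (fun p : n.-tuple R * measurableTypeR R => upd p.1 k p.2).
Proof.
apply/measurable_fun_tnthP => i.
rewrite [X in measurable_fun _ X](_ : _ = fun p : n.-tuple R * measurableTypeR R =>
   if i == k then p.2 else tnth p.1 i); last first.
  by apply/funext => p /=; rewrite tnth_upd.
case: eqP => _; first exact: measurable_snd.
exact: (measurableT_comp (measurable_tnth i) measurable_fst).
Qed.

Lemma upd_consT0 n (x0 x : R) (t : n.-tuple R) :
  upd (consT (x0, t)) ord0 x = consT (x, t).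
Proof.
apply: eq_from_tnth => i; rewrite tnth_upd; case: (unliftP ord0 i) => [j|] -> /=.
  by rewrite !tnthS.
by [].
Qed.

Lemma upd_consT_lift n (x0 x : R) (t : n.-tuple R) k :
  upd (consT (x0, t)) (lift ord0 k) x = consT (x0, upd t k x).
Proof.
apply: eq_from_tnth => i; rewrite tnth_upd; case: (unliftP ord0 i) => [j|] -> /=.
  by rewrite !tnthS tnth_upd (inj_eq lift_inj).
by [].
Qed.

Lemma measurable_upd1 n (t : n.-tuple R) k :
  measurable_fun setT (fun x : measurableTypeR R => upd t k x).
Proof.
exact: (measurableT_comp (measurable_upd k) (measurable_pair1 _)).
Qed.

(** Tonelli in an arbitrary coordinate k, without reordering the coordinates or introducing a
    measure on the remaining ones. The inner integral no longer depends on the k-th coordinate, and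
    the weight [p] keeps the outer integration over it from producing infinity. *)
Lemma integral_upd n (F : n.-tuple R -> \bar R) k (p : R -> \bar R) :
  measurable_fun setT F -> (forall t, 0 <= F t) ->
  measurable_fun setT p -> (forall x, 0 <= p x) ->
  \int[lebesgue_tuple n]_t (p (tnth t k) * \int[mu]_x F (upd t k x)) =
  (\int[mu]_x p x) * \int[lebesgue_tuple n]_t F t.
Proof.
elim: n F k => [F []//|n IH] F k mF F0 mp p0.
have mFu : measurable_fun setT (fun q : n.+1.-tuple R * measurableTypeR R =>
    F (upd q.1 k q.2)) by apply: measurableT_comp => //; exact: measurable_upd.
have mI : measurable_fun setT (fun t => \int[mu]_x F (upd t k x)).
  by apply: (measurable_fun_fubini_tonelli_F _ mFu).
have I0 t : 0 <= \int[mu]_x F (upd t k x) by exact: integral_ge0.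
have mFc : measurable_fun setT (fun q : measurableTypeR R * n.-tuple R => F (consT q)).
  by apply: measurableT_comp => //; exact: measurable_consT.
rewrite tuple_tonelli//; last 2 first.
  apply: emeasurable_funM => //; apply: measurableT_comp => //.
  exact: measurable_tnth.
  by move=> t; exact: mule_ge0.
rewrite [X in _ = _ * X]tuple_tonelli//.
have mFcx x : measurable_fun setT (fun t => F (consT (x, t))).
  exact: (measurableT_comp mFc (measurable_pair1 x)).
case: (unliftP ord0 k) mFu mI I0 => [j|] -> mFu mI I0.
  transitivity (\int[mu]_x ((\int[mu]_x p x) *
      \int[lebesgue_tuple n]_t F (consT (x, t)))).
    apply: eq_integral => x _.
    have <- := IH (fun t => F (consT (x, t))) j (mFcx x) (fun t => F0 _) mp p0.
    apply: eq_integral => t _; rewrite tnthS.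
    by under eq_integral do rewrite upd_consT_lift.
  rewrite ge0_integralZl//.
  - by apply: (measurable_fun_fubini_tonelli_F _ mFc) => ?; exact: F0.
  - by move=> x _; exact: integral_ge0.
  - exact: integral_ge0.
have mJ : measurable_fun setT (fun t => \int[mu]_x F (consT (x, t))).
  by apply: (measurable_fun_fubini_tonelli_G _ mFc) => ?; exact: F0.
have -> := @fubini_tonelli _ _ _ _ _ mu (lebesgue_tuple n)
  (fun q => F (consT q)) mFc (fun q => F0 _).
have J0 : 0 <= \int[lebesgue_tuple n]_t \int[mu]_x F (consT (x, t)).
  by apply: integral_ge0 => t _; exact: integral_ge0.
rewrite -ge0_integralZr//.
apply: eq_integral => x _.
have <- : \int[lebesgue_tuple n]_t (p x * \int[mu]_y F (consT (y, t))) =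
    p x * \int[lebesgue_tuple n]_t \int[mu]_y F (consT (y, t)).
  by apply: ge0_integralZl => // t _; exact: integral_ge0.
apply: eq_integral => t _; congr (_ * _).
by under eq_integral do rewrite upd_consT0.
Qed.

(** Uniqueness of Lebesgue measure: |a| times the push-forward of [mu] under x -> a x + b has the
    right value on half-open intervals. *)
Lemma integral_affine (G : R -> \bar R) (a b : R) : a != 0%R ->
  measurable_fun setT G -> (forall x, 0 <= G x) ->
  \int[mu]_x G x = `|a|%:E * \int[mu]_x G (a * x + b)%R.
Proof.
move=> a0 mG G0; pose h := (fun x : measurableTypeR R => a * x + b : measurableTypeR R)%R.
have mh : measurable_fun setT h.
  by apply: measurable_funD => //; exact: measurable_funM.
have aa : (0 <= `|a|)%R by [].
pose pf := (pushforward mu h : {measure set (measurableTypeR R) -> \bar R}).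
pose nu := mscale (NngNum aa) (pf mh).
have E : forall A, measurable A -> mu A = nu A.
  apply: lebesgue_measure_unique => X [[c d] _ <-]/=.
  rewrite /nu /mscale/= /pf /= /pushforward.
  pose u := ((c - b) / a)%R; pose v := ((d - b) / a)%R.
  (* A negative [a] reverses the interval and moves the closed end to the left. *)
  have pre : h @^-1` `]c, d]%classic =
      if (0 < a)%R then `]u, v]%classic else `[v, u[%classic.
    apply/seteqP; rewrite /u /v; case: ifPn => [apos|]; last rewrite -leNgt le_eqVlt (negPf a0) /= => aneg.
      split=> x; rewrite /= !in_itv/= ltr_pdivrMr// ler_pdivlMr// ltrBlDr lerBrDr [(x * a)%R]mulrC//.
    by split=> x; rewrite /= !in_itv/= ler_ndivrMr// ltr_ndivlMr// ltrBlDr lerBrDr [(x * a)%R]mulrC andbC.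
  rewrite lebesgue_measure_itv/= lte_fin pre.
  case: (ifPn (0 < a)%R) => [apos|]; last rewrite -leNgt le_eqVlt (negPf a0) /= => aneg.
    rewrite lebesgue_measure_itv/= !lte_fin /u /v ltr_pM2r ?invr_gt0// ltrD2r.
    case: ifPn => cd; last by rewrite mule0.
    by rewrite -EFinB -EFinM gtr0_norm//; congr (_%:E); field.
  rewrite lebesgue_measure_itv/= !lte_fin /u /v ltr_nM2r ?invr_lt0// ltrD2r.
  case: ifPn => cd; last by rewrite mule0.
  by rewrite -EFinB -EFinM ltr0_norm//; congr (_%:E); field.
transitivity (\int[nu]_x G x).
  by apply: eq_measure_integral => A mA _; exact: E.
rewrite ge0_integral_mscale//; congr (_ * _).
exact: (@ge0_integral_pushforward _ _ _ _ _ h mh mu setT G).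
Qed.

End tuple_integral.

Section elementary_maps.
Context {R : realType}.
Local Notation mu := (@lebesgue_measure R).
Local Open Scope ereal_scope.

(** With a weight of total mass 1, the indicator of [0, 1], [integral_upd] singles out coordinate k
    on both sides. What remains is [integral_affine], where [h t] is a constant because it does not
    depend on that coordinate. *)
Lemma integral_upd_affine n (F : n.-tuple R -> \bar R) k (a : R)
    (h : n.-tuple R -> R) : a != 0%R ->
  measurable_fun setT F -> (forall t, 0 <= F t) ->
  measurable_fun setT h -> (forall t x, h (upd t k x) = h t) ->
  \int[lebesgue_tuple n]_t F t =
  `|a|%:E * \int[lebesgue_tuple n]_t F (upd t k (a * tnth t k + h t)%R).
Proof.
move=> a0 mF F0 mh hk.
pose p (x : R) : \bar R := (\1_(`[0%R, 1%R]%classic : set R) x)%:E.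
have mp : measurable_fun setT p.
  by apply/measurable_EFinP; exact: measurable_indic.
have p0 x : 0 <= p x by rewrite lee_fin.
have ip : \int[mu]_x p x = 1.
  have E : mu `[0%R, 1%R]%classic = 1.
    by rewrite lebesgue_measure_itv/= lte_fin ltr01 oppr0 adde0.
  by rewrite integral_indic// setIT.
pose T t := upd t k (a * tnth t k + h t)%R.
have mT : measurable_fun setT T.
  have m2 : measurable_fun setT (fun t : n.-tuple R =>
      (t, (a * tnth t k + h t)%R : measurableTypeR R)).
    apply/measurable_fun_pairP; split; first exact: measurable_id.
    apply: measurable_funD => //; apply: measurable_funM => //.
    exact: measurable_tnth.
  exact: (measurableT_comp (measurable_upd k) m2).
have mFT : measurable_fun setT (F \o T) by exact: measurableT_comp.
rewrite -[LHS]mul1e -ip -(integral_upd k mF F0 mp p0).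
rewrite -[X in _ = _ * X]mul1e -ip.
rewrite -(integral_upd k mFT (fun t => F0 _) mp p0).
have mFu t : measurable_fun setT (fun x : R => F (upd t k x)).
  exact: (measurableT_comp mF (measurable_upd1 t k)).
rewrite -ge0_integralZl//.
- apply: eq_integral => t _; rewrite muleCA; congr (_ * _).
  rewrite (integral_affine (h t) a0 (mFu t) (fun x => F0 _)).
  congr (_ * _); apply: eq_integral => x _.
  by rewrite /= /T tnth_upd eqxx upd_upd hk.
- apply: emeasurable_funM.
    apply: measurableT_comp => //; exact: measurable_tnth.
  have mq : measurable_fun setT (fun q : n.-tuple R * measurableTypeR R =>
     (F \o T) (upd q.1 k q.2)).
    exact: (measurableT_comp mFT (measurable_upd k)).
  by apply: (measurable_fun_fubini_tonelli_F _ mq) => ?; exact: F0.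
- by move=> t _; apply: mule_ge0 => //; apply: integral_ge0 => x _; exact: F0.
Qed.

End elementary_maps.

Section complex_coordinates.
Context {R : realType} {n : nat}.
Local Notation mu := (@lebesgue_measure R).
Local Notation Cn := 'rV[R[i]]_n.
Local Open Scope ereal_scope.

Lemma tnth_realify (w : Cn) (j : 'I_n) :
  (tnth (realify w) (lshift n j) = complex.Re (w ord0 j)) *
  (tnth (realify w) (rshift n j) = complex.Im (w ord0 j)).
Proof.
by rewrite !tnth_mktuple (unsplitK (inl j)) (unsplitK (inr j)).
Qed.

Lemma measurable_realify : measurable_fun setT (@realify R n).
Proof. by move=> _ B mB; rewrite setTI; exists B => //; rewrite setTI. Qed.

Lemma measurable_Re_coord (j : 'I_n) :
  measurable_fun setT (fun w : Cn => complex.Re (w ord0 j)).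
Proof.
under eq_fun do rewrite -(tnth_realify _ j).1.
exact: (measurableT_comp (measurable_tnth _) measurable_realify).
Qed.

Lemma measurable_Im_coord (j : 'I_n) :
  measurable_fun setT (fun w : Cn => complex.Im (w ord0 j)).
Proof.
under eq_fun do rewrite -(tnth_realify _ j).2.
exact: (measurableT_comp (measurable_tnth _) measurable_realify).
Qed.

Lemma measurable_fun_Cn d (T : measurableType d) (G : T -> Cn) :
  (forall j, measurable_fun setT (fun x => complex.Re (G x ord0 j))) ->
  (forall j, measurable_fun setT (fun x => complex.Im (G x ord0 j))) ->
  measurable_fun setT G.
Proof.
move=> mR mI; have mrG : measurable_fun setT (@realify R n \o G).
  apply/measurable_fun_tnthP => i.
  case: (split_ordP i) => j ->.
    rewrite [X in measurable_fun _ X](_ : _ = fun x => complex.Re (G x ord0 j))//.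
    by apply/funext => x /=; rewrite (tnth_realify (G x) j).1.
  rewrite [X in measurable_fun _ X](_ : _ = fun x => complex.Im (G x ord0 j))//.
  by apply/funext => x /=; rewrite (tnth_realify (G x) j).2.
move=> _ _ [B mB <-]; rewrite setTI; have := mrG measurableT B mB.
by rewrite !setTI.
Qed.

Lemma integral_volume (F : Cn -> \bar R) :
  measurable_fun setT F -> (forall w, 0 <= F w) ->
  \int[volume]_w F w = \int[lebesgue_tuple (n + n)]_t F (complexify t).
Proof.
move=> mF F0.
exact: (@ge0_integral_pushforward _ _ _ _ _ (@complexify R n)
  measurable_complexify (lebesgue_tuple (n + n)) setT F).
Qed.

Definition cupd (w : Cn) (j : 'I_n) (x : R[i]) : Cn :=
  \row_k (if k == j then x else w ord0 k).

Lemma cupdE w j x k : cupd w j x ord0 k = if k == j then x else w ord0 k.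
Proof. by rewrite mxE. Qed.

Lemma complexifyE (t : (n + n).-tuple R) j :
  complexify t ord0 j = (tnth t (lshift n j) +i* tnth t (rshift n j)).
Proof. by rewrite mxE. Qed.

Lemma complexify_updl (t : (n + n).-tuple R) j x :
  complexify (upd t (lshift n j) x) = cupd (complexify t) j (x +i* tnth t (rshift n j)).
Proof.
apply/rowP => k; rewrite cupdE !complexifyE !tnth_upd eq_rlshift/=.
rewrite (inj_eq (@lshift_inj _ _)).
by case: eqP => [->|].
Qed.

Lemma complexify_updr (t : (n + n).-tuple R) j x :
  complexify (upd t (rshift n j) x) = cupd (complexify t) j (tnth t (lshift n j) +i* x).
Proof.
apply/rowP => k; rewrite cupdE !complexifyE !tnth_upd eq_lrshift/=.
rewrite (inj_eq (@rshift_inj _ _)).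
by case: eqP => [->|].
Qed.

Lemma cupd_cupd w j x y : cupd (cupd w j x) j y = cupd w j y.
Proof. by apply/rowP => k; rewrite !cupdE; case: eqP. Qed.

Lemma measurable_cupd d (T : measurableType d) (G : T -> Cn) (j : 'I_n)
    (g1 g2 : T -> R) : measurable_fun setT G ->
  measurable_fun setT g1 -> measurable_fun setT g2 ->
  measurable_fun setT (fun x => cupd (G x) j (g1 x +i* g2 x)).
Proof.
move=> mG m1 m2; apply: measurable_fun_Cn => k.
  under eq_fun do rewrite cupdE.
  case: eqP => _ //.
  exact: (measurableT_comp (measurable_Re_coord k) mG).
under eq_fun do rewrite cupdE.
case: eqP => _ //.
exact: (measurableT_comp (measurable_Im_coord k) mG).
Qed.

Section cupd_integral.
Variables (F : Cn -> \bar R) (mF : measurable_fun setT F) (F0 : forall w, 0 <= F w).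

Lemma measurable_cupd_pair w j : measurable_fun setT
  (fun q : measurableTypeR R * measurableTypeR R => F (cupd w j (q.1 +i* q.2))).
Proof.
apply: measurableT_comp => //; exact: measurable_cupd.
Qed.

Lemma measurable_cupd_integral j :
  measurable_fun setT (fun w => \int[mu]_x \int[mu]_y F (cupd w j (x +i* y))).
Proof.
have mG : measurable_fun setT
    (fun s : (Cn * measurableTypeR R) * measurableTypeR R => F (cupd s.1.1 j (s.1.2 +i* s.2))).
  apply: measurableT_comp => //; apply: measurable_cupd.
  - exact: (measurableT_comp measurable_fst measurable_fst).
  - exact: (measurableT_comp measurable_snd measurable_fst).
  - exact: measurable_snd.
have mG1 := measurable_fun_fubini_tonelli_F (m2 := mu) _ mG (fun q => F0 _).
have G10 (s : Cn * measurableTypeR R) : 0 <= \int[mu]_y F (cupd s.1 j (s.2 +i* y)).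
  by apply: integral_ge0.
exact: (measurable_fun_fubini_tonelli_F (m2 := mu) _ mG1 G10).
Qed.

(** [integral_upd] twice, for the imaginary and then for the real part of one complex coordinate.
    Separate weights suffice because they will be indicators of the two sides of a square. *)
Lemma integral_cupd j (p q : R -> \bar R) :
  measurable_fun setT p -> (forall x, 0 <= p x) ->
  measurable_fun setT q -> (forall x, 0 <= q x) ->
  \int[volume]_w (p (complex.Re (w ord0 j)) * (q (complex.Im (w ord0 j)) *
    \int[mu]_x \int[mu]_y F (cupd w j (x +i* y)))) =
  (\int[mu]_x p x) * ((\int[mu]_x q x) * \int[volume]_w F w).
Proof.
move=> mp p0 mq q0.
pose c := @complexify R n; pose l := lshift n j; pose r := rshift n j.
have mc : measurable_fun setT c := measurable_complexify.
have mFc : measurable_fun setT (F \o c) by exact: measurableT_comp.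
pose H t := q (tnth t r) * \int[mu]_y F (c (upd t r y)).
have mI : measurable_fun setT (fun t => \int[mu]_y F (c (upd t r y))).
  have mq2 : measurable_fun setT (fun s : (n + n).-tuple R * measurableTypeR R =>
     (F \o c) (upd s.1 r s.2)).
    exact: (measurableT_comp mFc (measurable_upd r)).
  by apply: (measurable_fun_fubini_tonelli_F _ mq2) => ?; exact: F0.
have I0 t : 0 <= \int[mu]_y F (c (upd t r y)).
  by apply: integral_ge0 => y _; exact: F0.
have H0 t : 0 <= H t by exact: mule_ge0.
have mH : measurable_fun setT H.
  exact: (emeasurable_funM (measurableT_comp mq (measurable_tnth r)) mI).
have E : \int[lebesgue_tuple (n + n)]_t H t =
    (\int[mu]_x q x) * \int[volume]_w F w.
  by rewrite integral_volume//; exact: (integral_upd r mFc (fun t => F0 _) mq q0).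
rewrite -E -(integral_upd l mH H0 mp p0) integral_volume.
- apply: eq_integral => t _.
  rewrite complexifyE/=; congr (_ * _).
  have HE x : H (upd t l x) = q (tnth t r) * \int[mu]_y F (cupd (c t) j (x +i* y)).
    rewrite /H tnth_upd eq_rlshift; congr (_ * _); apply: eq_integral => y _.
    by rewrite /c complexify_updr complexify_updl cupd_cupd tnth_upd eqxx.
  under [RHS]eq_integral do rewrite HE.
  rewrite ge0_integralZl//.
    exact: (measurable_fun_fubini_tonelli_F _ (measurable_cupd_pair (c t) j)
      (fun q => F0 _)).
  by move=> x _; apply: integral_ge0.
- apply: emeasurable_funM.
    exact: (measurableT_comp mp (measurable_Re_coord j)).
  apply: emeasurable_funM.
    exact: (measurableT_comp mq (measurable_Im_coord j)).
  exact: measurable_cupd_integral.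
- move=> w; apply: mule_ge0 => //; apply: mule_ge0 => //.
  by apply: integral_ge0 => x _; exact: integral_ge0.
Qed.

(** As [a] is real, the map acts on the real and imaginary parts separately, each contributing one
    factor [a]. *)
Lemma integral_cupd_affine j (a : R) (h : Cn -> R[i]) : (0 < a)%R ->
  measurable_fun setT (fun w => complex.Re (h w)) ->
  measurable_fun setT (fun w => complex.Im (h w)) ->
  (forall w x, h (cupd w j x) = h w) ->
  \int[volume]_w F w =
  (a ^+ 2)%:E * \int[volume]_w F (cupd w j (a%:C * w ord0 j + h w)%R).
Proof.
move=> a0 mh1 mh2 hj.
pose c := @complexify R n; pose l := lshift n j; pose r := rshift n j.
have mc : measurable_fun setT c := measurable_complexify.
have an0 : a != 0%R by rewrite gt_eqF.
pose h1 t := complex.Re (h (c t)); pose h2 t := complex.Im (h (c t)).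
have mh1c : measurable_fun setT h1 by exact: (measurableT_comp mh1 mc).
have mh2c : measurable_fun setT h2 by exact: (measurableT_comp mh2 mc).
have h1l t x : h1 (upd t l x) = h1 t by rewrite /h1 /c complexify_updl hj.
have h2l t x : h2 (upd t l x) = h2 t by rewrite /h2 /c complexify_updl hj.
have h2r t x : h2 (upd t r x) = h2 t by rewrite /h2 /c complexify_updr hj.
have mFc : measurable_fun setT (F \o c) by exact: measurableT_comp.
pose T2 t := upd t r (a * tnth t r + h2 t)%R.
have mT2 : measurable_fun setT T2.
  have m2 : measurable_fun setT (fun t : (n + n).-tuple R =>
      (t, (a * tnth t r + h2 t)%R : measurableTypeR R)).
    apply/measurable_fun_pairP; split; first exact: measurable_id.
    apply: measurable_funD => //; apply: measurable_funM => //.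
    exact: measurable_tnth.
  exact: (measurableT_comp (measurable_upd r) m2).
have mFT2 : measurable_fun setT ((F \o c) \o T2) by exact: measurableT_comp.
rewrite integral_volume//.
have -> := integral_upd_affine an0 mFc (fun t => F0 _) mh2c h2r.
have -> := integral_upd_affine an0 mFT2 (fun t => F0 _) mh1c h1l.
rewrite gtr0_norm// muleA -EFinM expr2; congr (_ * _).
rewrite integral_volume//; last first.
  apply: measurableT_comp => //.
  have -> : (fun w => cupd w j (a%:C * w ord0 j + h w)%R) = (fun w => cupd w j
     ((a * complex.Re (w ord0 j) + complex.Re (h w)) +i*
      (a * complex.Im (w ord0 j) + complex.Im (h w)))%R).
    apply/funext => w; congr cupd; case: (w ord0 j) (h w) => [x y] [u v].
    by apply/eqP; rewrite eq_complex/= !mul0r subr0 addr0 !eqxx.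
  apply: measurable_cupd => //; apply: measurable_funD => //;
    apply: measurable_funM => //.
    exact: measurable_Re_coord.
  exact: measurable_Im_coord.
apply: eq_integral => t _ /=; congr F.
rewrite /T2 /c complexify_updr complexify_updl cupd_cupd !tnth_upd eqxx eq_rlshift.
rewrite h2l complexifyE; congr cupd; rewrite /h1 /h2 /c.
by case: (h _) => u v; apply/eqP; rewrite eq_complex/= !mul0r subr0 addr0 !eqxx.
Qed.

End cupd_integral.

End complex_coordinates.

(** * Volumes of boxes *)

Section box_volume.
Context {R : realType}.
Local Notation mu := (@lebesgue_measure R).
Local Open Scope ereal_scope.

Definition tbox n (c : n.-tuple R) (s : R) : set (n.-tuple R) :=
  [set t | forall i, (`|tnth t i - tnth c i| <= s)%R].

Lemma measurable_tbox n (c : n.-tuple R) s : measurable (tbox c s).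
Proof.
have -> : tbox c s = \bigcap_(i in [set: 'I_n])
    ((fun t : n.-tuple R => tnth t i) @^-1` `[tnth c i - s, tnth c i + s]%classic)%R.
  apply/seteqP; split=> t /=.
    by move=> H i _ /=; rewrite in_itv/= -ler_distlC distrC.
  by move=> H i; have := H i I; rewrite /= in_itv/= -ler_distlC distrC.
apply: fin_bigcap_measurable => // i _.
rewrite -[X in measurable X]setTI.
by apply: (measurable_tnth i) => //; exact: measurable_itv.
Qed.

Lemma measurable_indicE d (T : measurableType d) (D : set T) :
  measurable D -> measurable_fun setT (fun x => (\1_D x : R)%:E).
Proof. by move=> mD; apply/measurable_EFinP; exact: measurable_indic. Qed.

Lemma lebesgue_itv_center (a s : R) : (0 <= s)%R ->
  mu `[(a - s)%R, (a + s)%R]%classic = (s + s)%:E.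
Proof.
move=> s0; rewrite lebesgue_measure_itv/= lte_fin; case: ifPn => h.
  by rewrite -EFinB; congr _%:E; ring.
have -> : s = 0%R; last by rewrite addr0.
by apply/eqP; move: h; rewrite -leNgt => h; lra.
Qed.

Lemma lebesgue_tbox n (c : n.-tuple R) s : (0 <= s)%R ->
  lebesgue_tuple n (tbox c s) = ((s + s) ^+ n)%:E.
Proof.
move=> s0; elim: n c => [|n IH] c.
  rewrite /= diracE mem_set//; by case.
rewrite /= /lebesgue_step /pushforward.
have -> : consT (k:=n) @^-1` tbox c s =
    `[(tnth c ord0 - s)%R, (tnth c ord0 + s)%R]%classic `*` tbox [tuple of behead c] s.
  have bE i : tnth [tuple of behead c] i = tnth c (lift ord0 i).
    by rewrite [in RHS](tuple_eta c) tnthS.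
  apply/seteqP; split=> -[x t] /=.
    move=> H; split; first by have := H ord0; rewrite /= in_itv/= -ler_distlC distrC.
    by move=> i; have := H (lift ord0 i); rewrite tnthS bE.
  move=> [x0 H] i; case: (unliftP ord0 i) => [j|] ->.
    by rewrite tnthS -bE; exact: H.
  by move: x0; rewrite /= in_itv/= -ler_distlC distrC.
rewrite product_measure1E//; last exact: measurable_tbox.
rewrite IH exprS EFinM; congr (_ * _).
exact: lebesgue_itv_center.
Qed.

End box_volume.

Section cbox_volume.
Context {R : realType} {n : nat}.
Local Notation mu := (@lebesgue_measure R).
Local Notation Cn := 'rV[R[i]]_n.
Local Open Scope ereal_scope.

Lemma cboxE (c : Cn) s : cbox c s = @realify R n @^-1` tbox (realify c) s.
Proof.
apply/seteqP; split=> w /=.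
  move=> cw i; case: (split_ordP i) => j ->.
    by rewrite !tnth_realify; have /csquareP[+ _] := cw j; rewrite raddfB.
  by rewrite !tnth_realify; have /csquareP[_ +] := cw j; rewrite raddfB.
move=> H j; apply/csquareP; rewrite !raddfB.
by split; [have := H (lshift n j)|have := H (rshift n j)]; rewrite !tnth_realify.
Qed.

Lemma measurable_cbox (c : Cn) s : measurable (cbox c s).
Proof.
rewrite cboxE -[X in measurable X]setTI.
by apply: measurable_realify => //; exact: measurable_tbox.
Qed.

Lemma volume_cbox (c : Cn) s : (0 <= s)%R ->
  volume (cbox c s) = ((s + s) ^+ (n + n))%:E.
Proof.
move=> s0; rewrite /volume /pushforward -(@lebesgue_tbox R (n + n) (realify c))//.
congr (_ _); rewrite cboxE -comp_preimage; apply/seteqP.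
by split=> t /=; rewrite complexifyK.
Qed.

End cbox_volume.

(** * The mean value inequality on a square in the plane *)

Section mean_value.
Context {R : realType}.
Local Notation mu := (@lebesgue_measure R).
Local Open Scope ereal_scope.

Lemma Rintegral_segment_le (h : R -> R) (G : R -> \bar R) t :
  mu.-integrable `[(- t)%R, t] (EFin \o h) -> measurable_fun setT G ->
  (forall x, 0 <= G x) -> (forall x, (- t <= x <= t)%R -> (h x)%:E <= G x) ->
  (forall x, (0 <= h x)%R) ->
  (\int[mu]_(x in `[(- t)%R, t]) h x)%:E <= \int[mu]_x G x.
Proof.
move=> ih mG G0 hG h0; rewrite fineK; last exact: integrable_fin_num.
apply: (@le_trans _ _ (\int[mu]_(x in `[(- t)%R, t]) G x)).
  apply: ge0_le_integral => //.
  - by move=> x _; rewrite lee_fin.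
  - by case/integrableP: ih.
  - exact: measurable_funTS.
have mI : measurable (`[(- t)%R, t]%classic : set (measurableTypeR R)).
  exact: measurable_itv.
exact: (@ge0_subset_integral _ _ _ mu _ _ mI measurableT G mG (fun x _ => G0 x)
  (fun _ _ => Logic.I)).
Qed.

(** [cauchy_mean] is integrated over the half sides t in [s/2, s]: by Tonelli each of the four edge
    terms is at most the area integral of [G]. A majorant on the whole plane is used, so that edges
    extend to full lines and no domains have to be tracked. *)
Lemma cauchy_mean_area (g : R[i] -> R[i]) s (G : R -> R -> \bar R) : (0 < s)%R ->
  cdiff_on (csquare s) g ->
  measurable_fun setT (fun q : measurableTypeR R * measurableTypeR R => G q.1 q.2) ->
  (forall x y, 0 <= G x y) ->
  (forall x y, csquare s (x +i* y) -> (normc (g (x +i* y)))%:E <= G x y) ->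
  (s ^+ 2 * normc (g 0%R))%:E <= 4%:E * \int[mu]_x \int[mu]_y G x y.
Proof.
move=> s0 gD mG G0 gG.
pose V x := \int[mu]_y G x y; pose H y := \int[mu]_x G x y.
have mV : measurable_fun setT V.
  exact: (measurable_fun_fubini_tonelli_F (m2 := mu) _ mG (fun q => G0 _ _)).
have mH : measurable_fun setT H.
  exact: (measurable_fun_fubini_tonelli_G (m1 := mu) _ mG (fun q => G0 _ _)).
have V0 x : 0 <= V x by apply: integral_ge0.
have H0 x : 0 <= H x by apply: integral_ge0.
have VH : \int[mu]_x V x = \int[mu]_y H y.
  exact: (@fubini_tonelli _ _ _ _ _ mu mu _ mG (fun q => G0 _ _)).
have VE x : V x = \int[mu]_y G x y by [].
have HE y : H y = \int[mu]_x G x y by [].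
clearbody V H.
have mopp : measurable_fun setT (fun x : R => - x)%R by exact: oppr_measurable.
(* [W t] is the integral of [G] over the four lines that carry the edges of the square of half side
   t; its integral over all t is four times the area integral. *)
pose W t := H (- t)%R + H t + V t + V (- t)%R.
have W0 t : 0 <= W t by do 3! (apply: adde_ge0 => //).
have mHo : measurable_fun setT (fun t : R => H (- t)%R) by exact: measurableT_comp.
have mVo : measurable_fun setT (fun t : R => V (- t)%R) by exact: measurableT_comp.
have mW : measurable_fun setT W by rewrite /W; do 3! apply: emeasurable_funD => //.
have iW : \int[mu]_t W t = 4%:E * \int[mu]_x V x.
  have refl (K : R -> \bar R) : measurable_fun setT K -> (forall x, 0 <= K x) ->
      \int[mu]_t K (- t)%R = \int[mu]_t K t.
    move=> mK K0; have n1 : (-1 : R)%R != 0%R by rewrite oppr_eq0 oner_eq0.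
    rewrite [RHS](integral_affine 0 n1 mK K0) normrN1 mul1e.
    by apply: eq_integral => x _; rewrite mulN1r addr0.
  rewrite /W ge0_integralD//; last 2 first.
  - by move=> x _; do ? (apply: adde_ge0 => //).
  - by do 2! apply: emeasurable_funD => //.
  rewrite ge0_integralD//; last 2 first.
  - by move=> x _; do ? (apply: adde_ge0 => //).
  - by apply: emeasurable_funD => //.
  rewrite ge0_integralD// !refl// -VH.
  have -> : (4 = 1 + 1 + 1 + 1 :> R)%R by ring.
  rewrite !EFinD !ge0_muleDl ?adde_ge0 ?lee_fin// !mul1e.
  by rewrite !addeA.
(* Here 4 t >= 2 s; the length s/2 of the interval then produces the factor [s ^+ 2]. *)
have pt t : (s / 2 <= t <= s)%R -> (2 * s * normc (g 0%R))%:E <= W t.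
  move=> /andP[t1 t2]; have t0 : (0 < t)%R by lra.
  have tt : (- t <= t)%R by lra.
  have gDt : cdiff_on (csquare t) g by apply: cdiff_on_subset gD; exact: csquareS.
  have gDe : cdiff_on (edges (- t) t (- t) t) g.
    by apply: cdiff_on_subset gDt => z [].
  have [c1 c2 c3 c4] := edges_cts tt tt gDe.
  apply: (@le_trans _ _ (4 * t * normc (g 0))%:E).
    by rewrite lee_fin ler_wpM2r ?normc_ge0//; lra.
  have memx x y : (- t <= x <= t)%R -> (- t <= y <= t)%R -> csquare s (x +i* y).
    by move=> hx hy; apply: (csquareS t2); split.
  have Gx y : measurable_fun setT (fun x => G x y).
    exact: (measurableT_comp mG (measurable_pair2 _)).
  have Gy x : measurable_fun setT (G x).
    exact: (measurableT_comp mG (measurable_pair1 _)).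
  apply: (@le_trans _ _ _%:E); first by rewrite lee_fin; exact: cauchy_mean t0 gDt.
  have nt : (- t <= - t <= t)%R by rewrite lexx tt.
  have tt' : (- t <= t <= t)%R by rewrite lexx tt.
  rewrite !EFinD /W !leeD//; rewrite ?VE ?HE.
  - apply: Rintegral_segment_le => //; first exact: integrable_normc.
    + by move=> x hx; apply/gG/memx.
    + by move=> x; exact: normc_ge0.
  - apply: Rintegral_segment_le => //; first exact: integrable_normc.
    + by move=> x hx; apply/gG/memx.
    + by move=> x; exact: normc_ge0.
  - apply: Rintegral_segment_le => //; first exact: integrable_normc.
    + by move=> x hx; apply/gG/memx.
    + by move=> x; exact: normc_ge0.
  - apply: Rintegral_segment_le => //; first exact: integrable_normc.
    + by move=> x hx; apply/gG/memx.
    + by move=> x; exact: normc_ge0.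
have -> : \int[mu]_x \int[mu]_y G x y = \int[mu]_x V x.
  by apply: eq_integral => x _; rewrite VE.
rewrite -iW.
apply: (@le_trans _ _ (\int[mu]_(t in `[(s / 2)%R, s]) W t)); last first.
  have mI : measurable (`[(s / 2)%R, s]%classic : set (measurableTypeR R)).
    exact: measurable_itv.
  exact: (@ge0_subset_integral _ _ _ mu _ _ mI measurableT W mW (fun x _ => W0 x)
    (fun _ _ => Logic.I)).
apply: (@le_trans _ _ (\int[mu]_(t in `[(s / 2)%R, s]) (2 * s * normc (g 0%R))%:E)).
  rewrite integral_cst//= lebesgue_measure_itv/= lte_fin ifT; last by lra.
  by rewrite -EFinB -EFinM lee_fin le_eqVlt; apply/orP; left; apply/eqP; field.
apply: ge0_le_integral => //.
- by move=> x _; rewrite lee_fin !mulr_ge0 ?normc_ge0// ltW.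
exact: measurable_funTS.
Qed.

End mean_value.

(** * The mean value inequality on boxes *)

Section mean_value_box.
Context {R : realType} {n : nat}.
Local Notation mu := (@lebesgue_measure R).
Local Notation Cn := 'rV[R[i]]_n.
Local Open Scope ereal_scope.
Variables (c : Cn) (s : R) (f : Cn -> R[i]).
Hypothesis s0 : (0 < s)%R.
Hypothesis fD : cgrad_on (cbox c s) f.

Let F : Cn -> \bar R := (fun w => (normc (f w))%:E) \_ (cbox c s).
Hypothesis mF : measurable_fun setT F.

Let F0 w : 0 <= F w.
Proof. by rewrite /F patchE; case: ifP => // _; rewrite lee_fin normc_ge0. Qed.

Let FE w : cbox c s w -> F w = (normc (f w))%:E.
Proof. by move=> cw; rewrite /F patchE mem_set. Qed.

(* c with the coordinates in P replaced by those of w: the one-variable estimate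
   is applied to one coordinate after another. *)
Let mix (P : pred 'I_n) (w : Cn) : Cn := \row_j (if P j then w ord0 j else c ord0 j).

Let mixE P w j : mix P w ord0 j = if P j then w ord0 j else c ord0 j.
Proof. by rewrite mxE. Qed.

Let cbox_mix P w : cbox c s w -> cbox c s (mix P w).
Proof.
move=> cw j; rewrite mixE; case: ifP => _; first exact: cw.
by rewrite subrr; apply: csquare0; exact: ltW.
Qed.

Let measurable_mix P : measurable_fun setT (mix P).
Proof.
apply: measurable_fun_Cn => j.
  under eq_fun do rewrite mixE.
  by case: (P j); [exact: measurable_Re_coord|exact: measurable_cst].
under eq_fun do rewrite mixE.
by case: (P j); [exact: measurable_Im_coord|exact: measurable_cst].
Qed.

(** Coordinates outside [P] do not enter the first factor; the indicator keeps them in the box, so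
    that integrating over them only costs the area of a square. *)
Let FP P (w : Cn) : \bar R := F (mix P w) * (\1_(cbox c s) w)%:E.

Let FP0 P w : 0 <= FP P w.
Proof. by rewrite mule_ge0// lee_fin. Qed.

Let mFP P : measurable_fun setT (FP P).
Proof.
apply: emeasurable_funM; first exact: measurableT_comp.
by apply: measurable_indicE; exact: measurable_cbox.
Qed.

(** Translation invariance carries the square of [cauchy_mean_area], centred at 0, to the coordinate
    of [c]. *)
Let shift (G : Cn -> \bar R) w K : measurable_fun setT G -> (forall w, 0 <= G w) ->
  \int[mu]_x \int[mu]_y G (cupd w K (c ord0 K + (x +i* y))%R) =
  \int[mu]_x \int[mu]_y G (cupd w K (x +i* y)).
Proof.
move=> mG G0; set a := complex.Re (c ord0 K); set b := complex.Im (c ord0 K).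
have mp := measurable_cupd_pair mG w K.
have mG1 : measurable_fun setT (fun x => \int[mu]_y G (cupd w K (x +i* y))).
  exact: (measurable_fun_fubini_tonelli_F (m2 := mu) _ mp (fun q => G0 _)).
rewrite [RHS](integral_affine a (oner_neq0 R) mG1); last first.
  by move=> x; apply: integral_ge0.
rewrite normr1 mul1e; apply: eq_integral => x _.
have mG2 : measurable_fun setT (fun y => G (cupd w K ((1 * x + a)%R +i* y))).
  exact: (measurableT_comp mp (measurable_pair1 _)).
rewrite [RHS](integral_affine b (oner_neq0 R) mG2)//.
rewrite normr1 mul1e; apply: eq_integral => y _; congr (G (cupd _ _ _)).
by apply/eqP; rewrite eq_complex/= !mul1r ![(_ + a)%R]addrC ![(_ + b)%R]addrC
  /a /b; case: (c ord0 K) => u v /=; rewrite !eqxx.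
Qed.

(** Coordinate k is released. [cauchy_mean_area] bounds s^2 times the value at c_k by 4 times the
    area integral, and the integration over the old k-th coordinate costs (2 s)^2; hence the factor
    16. *)
Let step (k : 'I_n) :
  \int[volume]_w FP (fun j => (j < k)%N) w <=
  16%:E * \int[volume]_w FP (fun j => (j < k.+1)%N) w.
Proof.
set P := (fun j : 'I_n => (j < k)%N); set P' := (fun j : 'I_n => (j < k.+1)%N).
have s0' := ltW s0.
pose J (w : Cn) := \int[mu]_x \int[mu]_y FP P' (cupd w k (x +i* y)).
have J0 w : 0 <= J w by apply: integral_ge0 => x _; exact: integral_ge0.
have pt w : cbox c s w -> (s ^+ 2)%:E * FP P w <= 4%:E * J w.
  move=> cw; rewrite /FP indicE mem_set// mule1 (FE (cbox_mix P cw)) -EFinM.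
  have mP0 : cline (mix P w) k 0%R = mix P w by rewrite cline0.
  rewrite -{1}mP0 /J -(shift w k (mFP P') (FP0 P')).
  (* Since [P] omits k and [P'] contains it, moving along the k-th line from the [P]-mixture amounts
     to varying w_k in the [P']-mixture. *)
  have E x : csquare s x -> cbox c s (cline (mix P w) k x) /\
      mix P' (cupd w k (c ord0 k + x)%R) = cline (mix P w) k x /\
      cbox c s (cupd w k (c ord0 k + x)%R).
    move=> sx; split; [|split].
    - move=> j; rewrite clineE mixE /P; have [->|jk] := eqVneq j k.
        by rewrite ltnn mulr1n addrAC subrr add0r.
      rewrite mulr0n addr0; case: ifP => _; first exact: cw.
      by rewrite subrr; exact: csquare0.
    - apply/rowP => j; rewrite clineE !mixE cupdE /P /P' ltnS leq_eqVlt.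
      have [->|jk] := eqVneq j k; first by rewrite eqxx/= ltnn mulr1n.
      by rewrite -[(j == k :> nat)]/(j == k) (negPf jk)/= mulr0n addr0.
    - move=> j; rewrite cupdE; case: eqP => [->|_]; last exact: cw.
      by rewrite addrAC subrr add0r.
  apply: (@cauchy_mean_area _ (fun x => f (cline (mix P w) k x)) s
    (fun x y => FP P' (cupd w k (c ord0 k + (x +i* y))%R)) s0).
  - apply: (cdiff_on_subset _ (@cgrad_cline_on _ _ _ f (mix P w) k fD)) => x sx.
    exact: (E x sx).1.
  - apply: measurableT_comp => //.
    have -> : (fun q : measurableTypeR R * measurableTypeR R =>
        cupd w k (c ord0 k + (q.1 +i* q.2))%R) = (fun q => cupd w k
        ((complex.Re (c ord0 k) + q.1)%R +i* (complex.Im (c ord0 k) + q.2)%R)).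
      by apply/funext => q; congr cupd; case: (c ord0 k).
    apply: measurable_cupd => //; apply: measurable_funD => //.
  - by move=> x y.
  - move=> x y sxy; have [e1 [e2 e3]] := E _ sxy.
    by rewrite /FP indicE mem_set// mule1 e2 FE.
pose I a (x : R) : \bar R := (\1_(`[(a - s)%R, (a + s)%R]%classic : set R) x)%:E.
have mI a : measurable_fun setT (I a) by exact: measurable_indicE.
have I0 a x : 0 <= I a x by rewrite lee_fin.
have iI a : \int[mu]_x I a x = (s + s)%:E.
  have L := @lebesgue_itv_center R a s s0'.
  by rewrite integral_indic// setIT.
(* [J] is independent of w_k, so its integral over all w_k would diverge in general. The indicators
   restrict w_k to the square, where the pointwise bound is needed, and give [J] the shape required
   by [integral_cupd]. *)
pose Q (w : Cn) := I (complex.Re (c ord0 k)) (complex.Re (w ord0 k)) *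
  (I (complex.Im (c ord0 k)) (complex.Im (w ord0 k)) * J w).
have Q0 w : 0 <= Q w by rewrite /Q !mule_ge0.
have ptQ w : (s ^+ 2)%:E * FP P w <= 4%:E * Q w.
  have [cw|ncw] := pselect (cbox c s w); last first.
    by rewrite /FP indicE memNset// !mule0 mule_ge0.
  apply: (le_trans (pt w cw)); rewrite /Q.
  have /csquareP[h1 h2] := cw k.
  rewrite /I !indicE !mem_set/= ?mul1e// in_itv/= -ler_distlC distrC.
    by move: h2; rewrite raddfB.
  by move: h1; rewrite raddfB.
have iQ : \int[volume]_w Q w = (s + s)%:E * ((s + s)%:E * \int[volume]_w FP P' w).
  rewrite /Q /J (integral_cupd (mFP P') (FP0 P') k (mI _) (I0 _) (mI _) (I0 _)).
  by rewrite !iI.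
have mQ : measurable_fun setT Q.
  apply: emeasurable_funM.
    exact: (measurableT_comp (mI _) (measurable_Re_coord k)).
  apply: emeasurable_funM.
    exact: (measurableT_comp (mI _) (measurable_Im_coord k)).
  exact: measurable_cupd_integral.
have s2 : (0 < s ^+ 2)%R by rewrite exprn_gt0.
rewrite -(@lee_pmul2l _ (s ^+ 2)%:E)//.
rewrite -ge0_integralZl//; last by rewrite lee_fin ltW.
apply: (@le_trans _ _ (\int[volume]_w (4%:E * Q w))).
  apply: ge0_le_integral => //.
  - by move=> w _; rewrite mule_ge0// lee_fin ltW.
  - exact: measurable_funeM.
  - exact: measurable_funeM.
rewrite ge0_integralZl// iQ !muleA -!EFinM le_eqVlt; apply/orP; left; apply/eqP.
by congr (_%:E * _); ring.
Qed.

(** The mixture with no released coordinate is [c], which gives the volume times |f(c)|. After n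
    steps the mixture is w itself. *)
Lemma mean_value_cbox : ((s + s) ^+ (n + n) * normc (f c))%:E <=
  (16 ^+ n)%:E * \int[volume]_(w in cbox c s) (normc (f w))%:E.
Proof.
have s0' := ltW s0; have cc := cbox_center c s0'.
have AE k : (k <= n)%N -> \int[volume]_w FP (fun j => (j < 0)%N) w <=
    (16 ^+ k)%:E * \int[volume]_w FP (fun j => (j < k)%N) w.
  elim: k => [_|k IH kn]; first by rewrite expr0 mul1e.
  apply: (le_trans (IH (ltnW kn))); rewrite exprSr EFinM -muleA.
  by apply: lee_wpmul2l; [rewrite lee_fin|exact: (step (Ordinal kn))].
have -> : ((s + s) ^+ (n + n) * normc (f c))%:E = \int[volume]_w FP (fun j => (j < 0)%N) w.
  rewrite mulrC EFinM -(volume_cbox c s0').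
  under eq_integral => w _.
    rewrite /FP (_ : mix _ w = c); last by apply/rowP => j; rewrite mixE.
    rewrite FE//; over.
  rewrite ge0_integralZl ?lee_fin ?normc_ge0//; last first.
    by apply: measurable_indicE; exact: measurable_cbox.
  by rewrite integral_indic ?setIT//; exact: measurable_cbox.
apply: (le_trans (AE n (leqnn n))); rewrite le_eqVlt; apply/orP; left; apply/eqP.
congr (_ * _); rewrite [RHS]integral_mkcond; apply: eq_integral => w _.
rewrite /FP (_ : mix _ w = w); last by apply/rowP => j; rewrite mixE ltn_ord.
rewrite /F !patchE indicE; case: (w \in cbox c s); first by rewrite mule1.
by rewrite mule0.
Qed.

End mean_value_box.

(** * Automorphisms of the Siegel half-space *)

Section siegel_automorphism.
Context {R : realType} {m : nat}.
Local Notation Cn := 'rV[R[i]]_m.+1.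
Implicit Types (z w v : Cn).

Definition mkC (h : 'I_m -> R[i]) (l : R[i]) : Cn :=
  \row_j (if unlift ord_max j is Some k then h k else l).

Lemma widen_lift (j : 'I_m) : widen_ord (leqnSn m) j = lift ord_max j.
Proof. by apply/val_inj; rewrite /= /bump leqNgt ltn_ord. Qed.

Lemma hd_mkC h l j : hd (mkC h l) j = h j.
Proof. by rewrite /hd mxE widen_lift liftK. Qed.

Lemma lst_mkC h l : lst (mkC h l) = l.
Proof. by rewrite /lst mxE unlift_none. Qed.

Lemma hd_lst_eq z w : (forall j, hd z j = hd w j) -> lst z = lst w -> z = w.
Proof.
move=> H L; apply/rowP => j; case: (unliftP ord_max j) => [k|] ->; last exact: L.
by rewrite -widen_lift; exact: H.
Qed.

Lemma conjcD (x y : R[i]) : (x + y)^*%C = x^*%C + y^*%C.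
Proof. exact: rmorphD. Qed.

Lemma conjcB (x y : R[i]) : (x - y)^*%C = x^*%C - y^*%C.
Proof. exact: rmorphB. Qed.

Lemma conjcM (x y : R[i]) : (x * y)^*%C = x^*%C * y^*%C.
Proof. exact: rmorphM. Qed.

Lemma siegel_rho z : siegel z <-> 0 < rho z.
Proof. by rewrite /siegel/= /rho subr_gt0. Qed.

Definition base : Cn := mkC (fun=> 0) 'i.

Definition scl z : R := Num.sqrt (rho z).

Lemma scl_sqr z : siegel z -> scl z ^+ 2 = rho z.
Proof. by move=> /siegel_rho/ltW z0; rewrite sqr_sqrtr. Qed.

Lemma scl_gt0 z : siegel z -> 0 < scl z.
Proof. by move=> /siegel_rho z0; rewrite sqrtr_gt0. Qed.

Lemma scl_sqrC z : siegel z -> (scl z)%:C * (scl z)%:C = (rho z)%:C.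
Proof. by move=> sz; rewrite -rmorphM -expr2 scl_sqr. Qed.

(* A dilation by (s, s^2), s^2 = rho z, followed by a Heisenberg translation;
   it sends [base] = (0', i) to z. *)
Definition sg z w : Cn :=
  mkC (fun j => hd z j + (scl z)%:C * hd w j)
      (lst z + (rho z)%:C * (lst w - 'i)
        + 2 * 'i * (scl z)%:C * \sum_(j < m) hd w j * (hd z j)^*%C).

Lemma sg_base z : sg z base = z.
Proof.
apply: hd_lst_eq => [j|]; first by rewrite hd_mkC hd_mkC mulr0 addr0.
rewrite !lst_mkC subrr mulr0 addr0 big1 ?mulr0 ?addr0// => j _.
by rewrite hd_mkC mul0r.
Qed.

Lemma rhoC z : (rho z)%:C =
  'i / 2 * ((lst z)^*%C - lst z) - \sum_(j < m) hd z j * (hd z j)^*%C.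
Proof. by rewrite -rho2_diag. Qed.

(** This homogeneity is the source of all invariance: that of [rho], of the Bergman metric and of
    its balls follows from it. *)
Lemma rho2_sg z w v : siegel z -> rho2 (sg z w) (sg z v) = (rho z)%:C * rho2 w v.
Proof.
move=> sz; have ss := scl_sqrC sz; have rE := rhoC z.
rewrite /rho2 !lst_mkC.
set s := (scl z)%:C in ss *; set r := (rho z)%:C in ss rE *.
set A := \sum_(j < m) hd w j * _; set B := \sum_(j < m) hd v j * (hd z j)^*%C.
have sC : s^*%C = s by rewrite conjc_real.
have rC : r^*%C = r by rewrite conjc_real.
have iC : 'i^*%C = - 'i :> R[i] by apply/eqP; rewrite eq_complex/= oppr0 !eqxx.
have tC : 2^*%C = 2 :> R[i] by exact: conjc_nat.
have i2 : 'i * 'i = -1 :> R[i] by rewrite -expr2 sqr_i.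
have -> : (lst z + r * (lst v - 'i) + 2 * 'i * s * B)^*%C =
  (lst z)^*%C + r * ((lst v)^*%C + 'i) - 2 * 'i * s * B^*%C.
  by rewrite !conjcD !conjcM conjcB sC rC iC tC; ring.
have -> : \sum_(j < m) hd (sg z w) j * (hd (sg z v) j)^*%C =
  (\sum_(j < m) hd z j * (hd z j)^*%C) + s * A + s * B^*%C
    + s * s * \sum_(j < m) hd w j * (hd v j)^*%C.
  rewrite /A /B rmorph_sum !mulr_sumr -!big_split/=; apply: eq_bigr => j _.
  by rewrite !hd_mkC conjcD !conjcM sC conjcK; ring.
rewrite ss.
have -> : \sum_(j < m) hd z j * (hd z j)^*%C = 'i / 2 * ((lst z)^*%C - lst z) - r.
  by rewrite rE; ring.
set W := \sum_(j < m) _.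
apply/eqP; rewrite -subr_eq0; apply/eqP.
(* For [field], ['i] is an atom; the difference of the two sides vanishes only modulo i^2 + 1, and
   this is the cofactor. *)
transitivity (('i * 'i + 1) * (r - s * (A + B^*%C))); first by field.
by rewrite i2 addNr mul0r.
Qed.

Lemma rho_sg z w : siegel z -> rho (sg z w) = rho z * rho w.
Proof.
move=> sz; have := rho2_sg w w sz; rewrite !rho2_diag -rmorphM.
by move=> /complexI.
Qed.

Lemma siegel_sg z w : siegel z -> siegel w -> siegel (sg z w).
Proof.
move=> sz /siegel_rho w0; apply/siegel_rho; rewrite rho_sg// mulr_gt0//.
exact/siegel_rho.
Qed.

Lemma siegel_sgE z w : siegel z -> siegel (sg z w) -> siegel w.
Proof.
move=> sz /siegel_rho; rewrite rho_sg// pmulr_rgt0; first by move/siegel_rho.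
exact/siegel_rho.
Qed.

Definition sgi z w : Cn :=
  let h j := (scl z)^-1%:C * (hd w j - hd z j) in
  mkC h ('i + (rho z)^-1%:C * (lst w - lst z
       - 2 * 'i * (scl z)%:C * \sum_(j < m) h j * (hd z j)^*%C)).

Lemma sgiK z : siegel z -> cancel (sgi z) (sg z).
Proof.
move=> sz w; have s0 := scl_gt0 sz; have /siegel_rho r0 := sz.
have sV : (scl z)%:C * (scl z)^-1%:C = 1 by rewrite -rmorphM mulfV// gt_eqF.
have rV : (rho z)%:C * (rho z)^-1%:C = 1 by rewrite -rmorphM mulfV// gt_eqF.
apply: hd_lst_eq => [j|].
  by rewrite !hd_mkC mulrA sV mul1r addrC subrK.
rewrite !lst_mkC.
have -> : \sum_(j < m) hd (sgi z w) j * (hd z j)^*%C =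
  \sum_(j < m) ((scl z)^-1)%:C * (hd w j - hd z j) * (hd z j)^*%C.
  by apply: eq_bigr => j _; rewrite hd_mkC.
set S := \sum_(j < m) _.
rewrite [_ + _ - 'i]addrAC subrr add0r mulrA rV mul1r.
by ring.
Qed.

Lemma sg_inj z : siegel z -> injective (sg z).
Proof.
move=> sz w v E; have s0 := scl_gt0 sz; have /siegel_rho r0 := sz.
have sn0 : (scl z)%:C != 0 by rewrite -normc_gt0 normcR normr_gt0 gt_eqF.
have rn0 : (rho z)%:C != 0 by rewrite -normc_gt0 normcR normr_gt0 gt_eqF.
have hE j : hd w j = hd v j.
  have := congr1 (fun x => hd x j) E; rewrite /= !hd_mkC => /addrI.
  exact: (mulfI sn0).
apply: hd_lst_eq => //.
have := congr1 lst E; rewrite !lst_mkC.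
under eq_bigr do rewrite hE.
move=> /addIr/addrI/(mulfI rn0); exact: addIr.
Qed.

Lemma sgK z : siegel z -> cancel (sg z) (sgi z).
Proof. by move=> sz w; apply: (sg_inj sz); rewrite sgiK. Qed.

(** In the quotient under the root both numerator and denominator gain the factor (rho z)^2. *)
Lemma bergman_sg z w : siegel z -> bergman z (sg z w) = bergman base w.
Proof.
move=> sz; have /siegel_rho r0 := sz.
have E : rho2 z (sg z w) = (rho z)%:C * rho2 base w.
  by rewrite -(rho2_sg base w sz) sg_base.
rewrite /bergman E rho_sg// normcM normcR gtr0_norm//.
have -> : rho base = 1.
  by rewrite /rho lst_mkC/= big1 ?subr0// => j _; rewrite hd_mkC normc0 expr0n.
congr (atanh (Num.sqrt (1 - _))).
(* As [w] is arbitrary, the denominator may vanish; both quotients are then 0 by the convention for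
   the inverse of 0. *)
have [->|n0] := eqVneq (normc (rho2 base w)) 0.
  by rewrite mulr0 expr0n/= !invr0 !mulr0.
by field; rewrite n0 gt_eqF.
Qed.

Lemma bergman_ball_sg z r : siegel z ->
  bergman_ball z r = sgi z @^-1` bergman_ball base r.
Proof.
move=> sz; apply/seteqP; split=> w; rewrite /bergman_ball/=.
  move=> [sw]; rewrite -{1}(sgiK sz w) bergman_sg// => h; split=> //.
  by apply: (siegel_sgE sz); rewrite sgiK.
move=> [sw h]; rewrite -(sgiK sz w) bergman_sg//; split=> //.
exact: siegel_sg.
Qed.

End siegel_automorphism.

(** * Bergman balls about the base point *)

Section base_ball.
Context {R : realType} {m : nat}.
Local Notation Cn := 'rV[R[i]]_m.+1.
Implicit Types (z w v a b : Cn).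

Lemma continuous_polydisc n (h : 'rV[R[i]]_n -> R) (w : 'rV[R[i]]_n) :
  (forall e : R, 0 < e -> exists2 d : R, 0 < d & forall v : 'rV[R[i]]_n, polydisc w d v ->
     `|h v - h w| < e) -> h x @[x --> w] --> h w.
Proof.
move=> H A /nbhs_ballP[e /= e0 eA]; have [d d0 Hd] := H e e0.
apply/nbhs_polydiscP; exists d => // v wv; apply: eA.
by rewrite /ball/= distrC; exact: Hd.
Qed.

Lemma continuous_Re_coord n (j : 'I_n) (w : 'rV[R[i]]_n) :
  (fun x : 'rV[R[i]]_n => complex.Re (x 0 j)) @ w --> complex.Re (w 0 j).
Proof.
apply: continuous_polydisc => e e0; exists e => // v wv.
by rewrite -raddfB (le_lt_trans (ler_Re_normc _)).
Qed.

Lemma continuous_Im_coord n (j : 'I_n) (w : 'rV[R[i]]_n) :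
  (fun x : 'rV[R[i]]_n => complex.Im (x 0 j)) @ w --> complex.Im (w 0 j).
Proof.
apply: continuous_polydisc => e e0; exists e => // v wv.
by rewrite -raddfB (le_lt_trans (ler_Im_normc _)).
Qed.

(** This is 4 |rho(base, w)|^2, the denominator in the Bergman distance to the base point, cleared
    of its factor 1/4. *)
Definition qbase w : R := normc (lst w + 'i) ^+ 2.

Lemma qbaseE w : qbase w = complex.Re (lst w) ^+ 2 + (complex.Im (lst w) + 1) ^+ 2.
Proof. by rewrite /qbase normc_sqr; case: (lst w) => x y /=; rewrite addr0. Qed.

Lemma rhoE w : rho w = complex.Im (lst w) -
  \sum_(j < m) (complex.Re (hd w j) ^+ 2 + complex.Im (hd w j) ^+ 2).
Proof. by rewrite /rho; congr (_ - _); apply: eq_bigr => j _; rewrite normc_sqr. Qed.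

Lemma continuous_rho w : rho x @[x --> w] --> rho w.
Proof.
rewrite (_ : @rho R m = fun w => complex.Im (lst w) -
  \sum_(j < m) (complex.Re (hd w j) ^+ 2 + complex.Im (hd w j) ^+ 2)); last first.
  by apply/funext => v; exact: rhoE.
have cI := @continuous_Im_coord _ ord_max w.
have cS : \sum_(j < m) (complex.Re (hd x j) ^+ 2 + complex.Im (hd x j) ^+ 2)
    @[x --> w] --> \sum_(j < m) (complex.Re (hd w j) ^+ 2 + complex.Im (hd w j) ^+ 2).
  apply: cvg_big => [||j _]; [exact: add_continuous|exact: (nbhs_filter w)|].
  pose j' := widen_ord (leqnSn m) j.
  have cR := @continuous_Re_coord _ j' w; have cJ := @continuous_Im_coord _ j' w.
  exact: (cvgD (cvgM cR cR) (cvgM cJ cJ)).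
exact: (cvgB cI cS).
Qed.

Lemma continuous_qbase w : qbase x @[x --> w] --> qbase w.
Proof.
rewrite (_ : qbase = fun w : Cn => complex.Re (lst w) * complex.Re (lst w) +
  (complex.Im (lst w) + 1) * (complex.Im (lst w) + 1)); last first.
  by apply/funext => v; rewrite qbaseE !expr2.
have cR := @continuous_Re_coord _ ord_max w.
have cI := @continuous_Im_coord _ ord_max w.
have cI1 : (fun x : Cn => complex.Im (x 0 ord_max) + 1) @ w -->
    complex.Im (w 0 ord_max) + 1.
  by apply: (cvgD cI); exact: cvg_cst.
exact: (cvgD (cvgM cR cR) (cvgM cI1 cI1)).
Qed.

Lemma continuous_cball_gap k w :
  (fun x : Cn => 4 * rho x - k * qbase x) @ w --> 4 * rho w - k * qbase w.
Proof.
have cr := @continuous_rho w; have cq := @continuous_qbase w.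
have FF : Filter (nbhs w) := nbhs_filter w.
have c4 : (fun=> 4 : R) x @[x --> w] --> (4 : R) by exact: cvg_cst.
have ck : (fun=> k) x @[x --> w] --> k by exact: cvg_cst.
exact: (cvgB (cvgM c4 cr) (cvgM ck cq)).
Qed.

Lemma open_siegel : open (@siegel R m).
Proof.
rewrite (_ : siegel = @rho R m @^-1` [set x | 0 < x]); last first.
  by apply/seteqP; split=> z /siegel_rho.
by apply: open_comp => [z _|]; [exact: continuous_rho|exact: open_gt].
Qed.

Lemma measurable_fun_sumr d (T : measurableType d) (I : Type) (s : seq I)
    (h : I -> T -> R) : (forall i, measurable_fun setT (h i)) ->
  measurable_fun setT (fun x => \sum_(i <- s) h i x).
Proof.
move=> mh; elim: s => [|i s IH].
  by under eq_fun do rewrite big_nil; exact: measurable_cst.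
by under eq_fun do rewrite big_cons; exact: measurable_funD.
Qed.

Lemma measurable_rho : measurable_fun setT (@rho R m).
Proof.
rewrite (_ : @rho R m = fun w => complex.Im (lst w) -
  \sum_(j < m) (complex.Re (hd w j) ^+ 2 + complex.Im (hd w j) ^+ 2)); last first.
  by apply/funext => v; exact: rhoE.
have mI := @measurable_Im_coord R m.+1 ord_max.
have mS : measurable_fun setT (fun w : Cn =>
    \sum_(j < m) (complex.Re (hd w j) ^+ 2 + complex.Im (hd w j) ^+ 2)).
  apply: measurable_fun_sumr => j.
  pose j' := widen_ord (leqnSn m) j.
  have mR := @measurable_Re_coord R m.+1 j'; have mJ := @measurable_Im_coord R m.+1 j'.
  exact: (measurable_funD (measurable_funX 2 mR) (measurable_funX 2 mJ)).
exact: (measurable_funB mI mS).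
Qed.

Lemma measurable_qbase : measurable_fun setT qbase.
Proof.
rewrite (_ : qbase = fun w => complex.Re (lst w) ^+ 2 + (complex.Im (lst w) + 1) ^+ 2); last first.
  by apply/funext => v; exact: qbaseE.
have mR := @measurable_Re_coord R m.+1 ord_max.
have mI := @measurable_Im_coord R m.+1 ord_max.
have mI1 : measurable_fun setT (fun w : Cn => complex.Im (w 0 ord_max) + 1).
  exact: measurable_funD.
exact: (measurable_funD (measurable_funX 2 mR) (measurable_funX 2 mI1)).
Qed.

(* [kap r] is 1 - tanh(r)^2. *)
Definition kap (r : R) : R :=
  1 - ((expR (2 * r) - 1) / (expR (2 * r) + 1)) ^+ 2.

Lemma kap_gt0 r : 0 < kap r.
Proof.
have e0 := expR_gt0 (2 * r); rewrite subr_gt0 -[ltRHS](expr1n _ 2).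
rewrite -real_normK ?num_real// ltr_pXn2r ?nnegrE// ltr_norml.
by rewrite ltr_pdivlMr ?ltr_pdivrMr; lra.
Qed.

Lemma kap_lt1 r : 0 < r -> kap r < 1.
Proof.
move=> r0; have e1 : 1 < expR (2 * r) by rewrite expR_gt1 mulr_gt0.
by rewrite /kap gtrBl exprn_gt0// divr_gt0; lra.
Qed.

Lemma rho_base : rho (base : Cn) = 1.
Proof.
by rewrite /rho lst_mkC/= big1 ?subr0// => j _; rewrite hd_mkC normc0 expr0n.
Qed.

Lemma siegel_base : siegel (base : Cn).
Proof. by apply/siegel_rho; rewrite rho_base. Qed.

Lemma rho_le_Im w : rho w <= complex.Im (lst w).
Proof. by rewrite /rho gerBl sumr_ge0// => j _; rewrite sqr_ge0. Qed.

(** With w_n = x + i y one has y >= rho w > 0 and qbase w - 4 y = x^2 + (y - 1)^2. The second bound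
    makes the argument of the square root in [bergman] nonnegative. *)
Lemma qbase_gt0 w : siegel w -> 1 <= qbase w /\ 4 * rho w <= qbase w.
Proof.
move=> /siegel_rho w0; have wI := rho_le_Im w; rewrite qbaseE.
have := sqr_ge0 (complex.Re (lst w)); have := sqr_ge0 (complex.Im (lst w) - 1).
by rewrite !expr2; split; nra.
Qed.

Lemma rho2_base w : normc (rho2 base w) ^+ 2 = qbase w / 4.
Proof.
rewrite /rho2 lst_mkC big1 ?subr0; last by move=> j _; rewrite hd_mkC mul0r.
rewrite normc_sqr qbaseE; case: (lst w) => x y.
have -> : 'i / 2 * ((x +i* y)^*%C - 'i) = ((y + 1) / 2 +i* (x / 2)) :> R[i].
  have -> : 2^-1 = (2^-1 : R)%:C :> R[i] by rewrite fmorphV rmorph_nat.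
  by apply/eqP; rewrite eq_complex/=; apply/andP; split; apply/eqP; ring.
by rewrite /=; field.
Qed.

(** For 0 <= x < 1 the condition atanh x < r means x < tanh r. Squaring it with x^2 = 1 - 4 rho w /
    qbase w gives the inequality, which in turn forces [rho w > 0], so membership in the half-space
    need not be listed. *)
Lemma bergman_ball_base r : 0 < r ->
  bergman_ball (base : Cn) r = [set w | kap r * qbase w < 4 * rho w].
Proof.
move=> r0; have e1 : 1 < expR (2 * r) by rewrite expR_gt1 mulr_gt0.
have k0 := kap_gt0 r.
have S w : siegel w -> (bergman base w < r) = (kap r * qbase w < 4 * rho w).
  move=> sw; have [q1 q4] := qbase_gt0 sw; have q0 : 0 < qbase w by lra.
  have /siegel_rho w0 := sw.
  rewrite /bergman rho_base rho2_base mul1r.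
  have -> : rho w / (qbase w / 4) = 4 * rho w / qbase w by field; rewrite gt_eqF.
  set u := 4 * rho w / qbase w.
  have u0 : 0 < u by rewrite divr_gt0// mulr_gt0.
  have u1 : u <= 1 by rewrite ler_pdivrMr// mul1r.
  rewrite -[kap r * _ < _]ltr_pdivlMr// -/u /atanh.
  set x := Num.sqrt (1 - u).
  have x0 : 0 <= x by exact: sqrtr_ge0.
  have x1 : x < 1 by rewrite -[ltRHS]sqrtr1 ltr_sqrt; lra.
  have xx : x ^+ 2 = 1 - u by rewrite sqr_sqrtr; lra.
  have -> : (ln ((1 + x) / (1 - x)) / 2 < r) = (x < (expR (2 * r) - 1) / (expR (2 * r) + 1)).
    rewrite ltr_pdivrMr// -ltr_expR lnK; last by rewrite posrE divr_gt0; lra.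
    rewrite mulrC [r * 2]mulrC ltr_pdivlMr; last by lra.
    by rewrite mulrC ltr_pdivrMr; [apply/idP/idP; lra|lra].
  set t := (_ - 1) / _.
  have t0 : 0 < t by rewrite divr_gt0; lra.
  rewrite -(@ltr_pXn2r _ 2)// ?nnegrE//; last exact: ltW.
  by rewrite xx /kap -/t; apply/idP/idP; lra.
apply/seteqP; split=> w /=.
  by move=> [sw]; rewrite S.
move=> h; have sw : siegel w.
  apply/siegel_rho; have : 0 <= kap r * qbase w.
    by rewrite mulr_ge0 ?sqr_ge0// ltW.
  by lra.
by split=> //; rewrite S.
Qed.

(** For [k = kap r] this is the closed counterpart of the ball of radius r about the base point. *)
Definition cball (k : R) : set Cn := [set w | k * qbase w <= 4 * rho w].

Lemma bergman_ball_cball r : 0 < r ->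
  bergman_ball (base : Cn) r `<=` cball (kap r).
Proof. by move=> r0; rewrite bergman_ball_base// => w /ltW. Qed.

(** Let w_n = x + i y. As qbase w >= 1, rho w >= k/4. From k (x^2 + y^2 + 1) <= 4 y follow y <= 4/k
    and |w_n|^2 <= (4/k) y; the other coordinates satisfy |w_j|^2 <= y <= 4/k <= (4/k)^2, the last
    step because k <= 1. *)
Lemma cball_bounds k w : 0 < k -> k <= 1 -> cball k w ->
  k / 4 <= rho w /\ forall j, normc (w 0 j) <= 4 / k.
Proof.
move=> k0 k1; rewrite /cball/= qbaseE => h.
have wI := rho_le_Im w; set x := complex.Re (lst w) in h *.
set y := complex.Im (lst w) in h wI *.
have x20 := sqr_ge0 x; have y20 := sqr_ge0 (y + 1).
have kq : 0 <= k * (x ^+ 2 + (y + 1) ^+ 2) by rewrite mulr_ge0 ?addr_ge0// ltW.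
have y0 : 0 <= y by lra.
have xy : k * (x ^+ 2 + y ^+ 2 + 1) <= 4 * y.
  apply: (@le_trans _ _ (k * (x ^+ 2 + (y + 1) ^+ 2))); last by lra.
  by rewrite ler_pM2l//; lra.
have rw : k / 4 <= rho w.
  rewrite ler_pdivrMr// mulrC (le_trans _ h)// -[leLHS]mulr1 ler_pM2l//.
  by move: x20; rewrite !expr2; nra.
split=> // j; pose M := 4 / k.
have M0 : 0 < M by rewrite divr_gt0.
have M1 : 1 <= M by rewrite ler_pdivlMr//; lra.
have xyM : x ^+ 2 + y ^+ 2 + 1 <= M * y.
  by rewrite /M mulrAC ler_pdivlMr// mulrC.
have yM : y <= M.
  by move: xyM x20; rewrite !expr2; nra.
rewrite -(@ler_pXn2r _ 2)// ?nnegrE ?normc_ge0 ?(ltW M0)//.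
case: (unliftP ord_max j) => [i|] ->; last first.
  have MM : M * y <= M ^+ 2 by rewrite expr2 ler_pM2l.
  rewrite normc_sqr -/(lst w) -/x -/y.
  by rewrite (le_trans _ MM)// (le_trans _ xyM)// lerDl.
have : normc (hd w i) ^+ 2 <= y.
  have : 0 <= rho w by lra.
  rewrite /rho subr_ge0 (bigD1 i)//=; apply: le_trans.
  by rewrite lerDl sumr_ge0// => l _; rewrite sqr_ge0.
rewrite /hd widen_lift => /le_trans; apply; apply: (le_trans yM).
by rewrite expr2 ler_peMl// ltW.
Qed.

Lemma cball_siegel k : 0 < k -> k <= 1 -> cball k `<=` siegel.
Proof.
move=> k0 k1 w /(cball_bounds k0 k1)[h _]; apply/siegel_rho.
by rewrite (lt_le_trans _ h)// divr_gt0.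
Qed.

Lemma measurable_cball k : measurable (cball k).
Proof.
rewrite (_ : cball k = (fun w => 4 * rho w - k * qbase w) @^-1` `[0, +oo[%classic); last first.
  by apply/seteqP; split=> w; rewrite /cball/= in_itv/= andbT subr_ge0.
rewrite -[X in measurable X]setTI.
suff : measurable_fun setT (fun w => 4 * rho w - k * qbase w).
  by apply => //; exact: measurable_itv.
apply: measurable_funB; apply: measurable_funM => //.
  exact: measurable_rho.
exact: measurable_qbase.
Qed.

Lemma measurable_bergman_ball_base r : 0 < r ->
  measurable (bergman_ball (base : Cn) r).
Proof.
move=> r0; rewrite bergman_ball_base//.
rewrite (_ : mkset _ = (fun w => 4 * rho w - kap r * qbase w) @^-1` `]0, +oo[%classic); last first.
  by apply/seteqP; split=> w; rewrite /= in_itv/= andbT subr_gt0.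
rewrite -[X in measurable X]setTI.
suff : measurable_fun setT (fun w => 4 * rho w - kap r * qbase w).
  by apply => //; exact: measurable_itv.
apply: measurable_funB; apply: measurable_funM => //.
  exact: measurable_rho.
exact: measurable_qbase.
Qed.

Lemma compact_csquare (s : R) : 0 <= s -> compact (@csquare R s).
Proof.
move=> s0; pose g (q : R * R) : R[i] := q.1 +i* q.2.
have -> : csquare s = g @` (`[- s, s]%classic `*` `[- s, s]%classic).
  apply/seteqP; split=> [[x y] [/= h1 h2]|_ [[x y] [/= h1 h2] <-]].
    by exists (x, y) => //; split; rewrite /= in_itv.
  by rewrite /csquare/crect/=; move: h1 h2; rewrite !in_itv.
apply: continuous_compact; last first.
  by apply: compact_setX; exact: segment_compact.
apply: continuous_subspaceT => q A /nbhs_ballP[e /= e0 eA].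
have e0' : 0 < complex.Re e by move: e0; rewrite ltcE => /andP[].
have eE : e = (complex.Re e)%:C.
  by move: e0; rewrite ltcE => /andP[/eqP h _]; case: e h {e0' eA} => a b /= ->.
have d0 : 0 < complex.Re e / 2 by rewrite divr_gt0.
exists (ball q.1 (complex.Re e / 2), ball q.2 (complex.Re e / 2)) => /=.
  by split; exact: nbhsx_ballx.
move=> [x y] [/= h1 h2]; apply: eA; rewrite /ball/= normc_def2 eE ltcR.
by rewrite (le_lt_trans (ler_normc_ReIm _))// [ltRHS]splitr ltrD.
Qed.

Lemma compact_cbox n (c : 'rV[R[i]]_n) (s : R) : 0 <= s -> compact (cbox c s).
Proof.
move=> s0.
have -> : cbox c s = [set v : 'rV[R[i]]_n | forall j, (csquare s \o (fun x => x - c ord0 j)) (v ord0 j)] by [].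
apply: (@rV_compact R[i] n (fun j => csquare s \o (fun x => x - c ord0 j))) => j.
have -> : csquare s \o (fun x => x - c ord0 j) = (fun x => x + c ord0 j) @` csquare s.
  apply/seteqP; split=> [x /= sx|_ [x sx <-]/=]; last by rewrite addrK.
  by exists (x - c ord0 j) => //; rewrite subrK.
apply: continuous_compact; last exact: compact_csquare.
apply: continuous_subspaceT => x A /nbhs_ballP[e e0 eA].
apply/nbhs_ballP; exists e => // y xy; apply: eA; move: xy.
by rewrite /ball/= opprD addrACA subrr addr0.
Qed.

Lemma compact_cball k : 0 < k -> k <= 1 -> compact (cball k).
Proof.
move=> k0 k1; apply: (@subclosed_compact _ _ (cbox 0 (4 / k))).
- rewrite (_ : cball k = (fun w => 4 * rho w - k * qbase w) @^-1` [set x | 0 <= x]); last first.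
    by apply/seteqP; split=> w; rewrite /cball/= subr_ge0.
  apply: closed_comp; last exact: closed_ge.
  by move=> w _; exact: continuous_cball_gap.
- by apply: compact_cbox; rewrite divr_ge0// ltW.
- move=> w /(cball_bounds k0 k1)[_ h] j; rewrite mxE subr0.
  exact: normc_csquare.
Qed.

(** At the base point the continuous function [4 * rho w - k * qbase w] takes the value 4 - 4 k >
    0. *)
Lemma cball_cbox k : k < 1 -> exists2 e, 0 < e &
  cbox base e `<=` [set w : Cn | k * qbase w < 4 * rho w].
Proof.
move=> k1.
have C := @continuous_cball_gap k base.
have p0 : 0 < 4 * rho (base : Cn) - k * qbase base.
  by rewrite rho_base qbaseE lst_mkC /= expr0n/= expr2; lra.
have N : nbhs (base : Cn) [set w : Cn | 0 < 4 * rho w - k * qbase w].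
  apply: (C [set x | 0 < x]); apply: open_nbhs_nbhs.
  by split; [exact: open_gt|exact: p0].
have /nbhs_polydiscP[d d0 Hd] := N.
exists (d / 4); first by rewrite divr_gt0.
move=> w /(@cbox_polydisc _ _ base (d / 4) d) h; rewrite /= -subr_gt0.
by apply: Hd; apply: h; lra.
Qed.

Lemma sqr_convex (t x y : R) : 0 <= t <= 1 ->
  (x + t * (y - x)) ^+ 2 <= (1 - t) * x ^+ 2 + t * y ^+ 2.
Proof.
move=> /andP[t0 t1]; rewrite -subr_ge0.
have -> : (1 - t) * x ^+ 2 + t * y ^+ 2 - (x + t * (y - x)) ^+ 2 =
  t * (1 - t) * (y - x) ^+ 2 by ring.
by apply: mulr_ge0; [apply: mulr_ge0 => //; rewrite subr_ge0|exact: sqr_ge0].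
Qed.

Lemma Re_segment (t : R) (x y : R[i]) : complex.Re (x + t%:C * (y - x)) =
  complex.Re x + t * (complex.Re y - complex.Re x).
Proof. by case: x => a b; case: y => c d /=; ring. Qed.

Lemma Im_segment (t : R) (x y : R[i]) : complex.Im (x + t%:C * (y - x)) =
  complex.Im x + t * (complex.Im y - complex.Im x).
Proof. by case: x => a b; case: y => c d /=; ring. Qed.

Lemma coord_segment (t : R) a b j :
  (a + t%:C *: (b - a)) 0 j = a 0 j + t%:C * (b 0 j - a 0 j).
Proof. by rewrite !mxE. Qed.

(** [qbase] is convex and [rho], a linear form minus a sum of squares, is concave; so 4 rho - k
    qbase is concave for k >= 0. *)
Lemma cball_convex k a b t : 0 <= k -> 0 <= t <= 1 -> cball k a -> cball k b ->
  cball k (a + t%:C *: (b - a)).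
Proof.
rewrite /cball/= => k0 t01 ha hb; have /andP[t0 t1] := t01.
have t1' : 0 <= 1 - t by rewrite subr_ge0.
have Q : qbase (a + t%:C *: (b - a)) <= (1 - t) * qbase a + t * qbase b.
  rewrite !qbaseE /lst coord_segment Re_segment Im_segment.
  set x1 := complex.Re _; set x2 := complex.Re _.
  set y1 := complex.Im _; set y2 := complex.Im _.
  have := sqr_convex x1 x2 t01; have := sqr_convex (y1 + 1) (y2 + 1) t01.
  have -> : y1 + 1 + t * (y2 + 1 - (y1 + 1)) = y1 + t * (y2 - y1) + 1 by ring.
  by lra.
have P : (1 - t) * rho a + t * rho b <= rho (a + t%:C *: (b - a)).
  rewrite !rhoE /lst coord_segment Im_segment.
  have : \sum_(j < m) (complex.Re (hd (a + t%:C *: (b - a)) j) ^+ 2 +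
      complex.Im (hd (a + t%:C *: (b - a)) j) ^+ 2) <=
    (1 - t) * (\sum_(j < m) (complex.Re (hd a j) ^+ 2 + complex.Im (hd a j) ^+ 2)) +
    t * (\sum_(j < m) (complex.Re (hd b j) ^+ 2 + complex.Im (hd b j) ^+ 2)).
    rewrite !mulr_sumr -big_split/=; apply: ler_sum => j _.
    rewrite /hd coord_segment Re_segment Im_segment.
    set x1 := complex.Re _; set x2 := complex.Re _.
    set y1 := complex.Im _; set y2 := complex.Im _.
    by have := sqr_convex x1 x2 t01; have := sqr_convex y1 y2 t01; lra.
  by lra.
apply: (@le_trans _ _ (k * ((1 - t) * qbase a + t * qbase b))).
  exact: ler_wpM2l.
apply: (@le_trans _ _ (4 * ((1 - t) * rho a + t * rho b))); last first.
  by rewrite ler_pM2l.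
have -> : k * ((1 - t) * qbase a + t * qbase b) =
  (1 - t) * (k * qbase a) + t * (k * qbase b) by ring.
have -> : 4 * ((1 - t) * rho a + t * rho b) =
  (1 - t) * (4 * rho a) + t * (4 * rho b) by ring.
by apply: lerD; exact: ler_wpM2l.
Qed.

End base_ball.

(** * The invariant gradient *)

Section invariant_gradient.
Context {R : realType} {m : nat}.
Local Notation Cn := 'rV[R[i]]_m.+1.
Implicit Types (z w v : Cn) (g : 'I_m.+1 -> R[i]).
Local Notation wd := (widen_ord (leqnSn m)).

(** [invgrad] with the partial derivatives as a parameter: it applies to any vector that [cgrad]
    provides for [f \o sg z], which need not be identified with values of [dz]. *)
Definition ginv g z : R :=
  Num.sqrt (2 * rho z * (4 * rho z * normc (g ord_max) ^+ 2 +
    \sum_(j < m) normc (g (wd j) + 2 * 'i * (hd z j)^*%C * g ord_max) ^+ 2)).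

(* The chain rule: the gradient of f \o sg z at w when g is that of f at
   sg z w. *)
Definition gsg z g : 'I_m.+1 -> R[i] := fun k =>
  if unlift ord_max k is Some j
  then (scl z)%:C * (g (wd j) + 2 * 'i * (hd z j)^*%C * g ord_max)
  else (rho z)%:C * g ord_max.

Lemma gsg_wd z g j : gsg z g (wd j) =
  (scl z)%:C * (g (wd j) + 2 * 'i * (hd z j)^*%C * g ord_max).
Proof. by rewrite /gsg {1}widen_lift liftK. Qed.

Lemma gsg_max z g : gsg z g ord_max = (rho z)%:C * g ord_max.
Proof. by rewrite /gsg unlift_none. Qed.

(** In the j-th bracket the terms in conj z_j and conj w_j combine into the conjugate of the j-th
    coordinate of [sg z w], and a factor [scl z] comes out. Its square is [rho z], which turns
    [rho w] into [rho (sg z w)]. *)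
Lemma ginv_sg z w g : siegel z -> ginv (gsg z g) w = ginv g (sg z w).
Proof.
move=> sz; have s0 := scl_gt0 sz; have ss := scl_sqr sz.
have /siegel_rho r0 := sz.
rewrite /ginv gsg_max rho_sg//; congr Num.sqrt.
rewrite normcM normcR gtr0_norm//.
have -> : \sum_(j < m) normc (gsg z g (wd j) +
     2 * 'i * (hd w j)^*%C * ((rho z)%:C * g ord_max)) ^+ 2 =
   rho z * \sum_(j < m) normc (g (wd j) + 2 * 'i * (hd (sg z w) j)^*%C * g ord_max) ^+ 2.
  rewrite mulr_sumr; apply: eq_bigr => j _.
  rewrite gsg_wd hd_mkC conjcD conjcM conjc_real -(scl_sqrC sz).
  have -> : (scl z)%:C * (g (wd j) + 2 * 'i * (hd z j)^*%C * g ord_max) +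
    2 * 'i * (hd w j)^*%C * ((scl z)%:C * (scl z)%:C * g ord_max) =
    (scl z)%:C * (g (wd j) +
      2 * 'i * ((hd z j)^*%C + (scl z)%:C * (hd w j)^*%C) * g ord_max) by ring.
  by rewrite normcM normcR gtr0_norm// exprMn ss.
by ring.
Qed.

Lemma sum_wd (V : nmodType) (F : 'I_m.+1 -> V) :
  \sum_k F k = \sum_(j < m) F (wd j) + F ord_max.
Proof. by rewrite big_ord_recr. Qed.

Lemma sg_sub_hd z w v j : hd (sg z v) j - hd (sg z w) j =
  (scl z)%:C * (hd v j - hd w j).
Proof. by rewrite !hd_mkC; ring. Qed.

Lemma sg_sub_lst z w v : lst (sg z v) - lst (sg z w) =
  (rho z)%:C * (lst v - lst w) + 2 * 'i * (scl z)%:C *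
    \sum_(j < m) (hd v j - hd w j) * (hd z j)^*%C.
Proof.
rewrite !lst_mkC.
have -> : \sum_(j < m) (hd v j - hd w j) * (hd z j)^*%C =
  \sum_(j < m) hd v j * (hd z j)^*%C - \sum_(j < m) hd w j * (hd z j)^*%C.
  by rewrite -sumrB; apply: eq_bigr => j _; rewrite mulrBl.
by ring.
Qed.

Lemma natr_mul_sum n (x : R) : n%:R * x = \sum_(j < n) x.
Proof. by rewrite sumr_const card_ord mulr_natl. Qed.

Lemma ler_coord_nrm1 n (h : 'rV[R[i]]_n) j : normc (h 0 j) <= nrm1 h.
Proof.
rewrite /nrm1 (bigD1 j)//= lerDl sumr_ge0// => k _; exact: normc_ge0.
Qed.

Lemma normc2 : normc (2 : R[i]) = 2.
Proof.
have -> : (2 : R[i]) = (2 : R)%:C by rewrite rmorph_nat.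
by rewrite normcR ger0_norm.
Qed.

Lemma nrm1_sg z : siegel z -> exists2 C, 0 < C &
  forall w v, nrm1 (sg z v - sg z w) <= C * nrm1 (v - w).
Proof.
move=> sz; have s0 := scl_gt0 sz; have /siegel_rho r0 := sz.
pose Z := \sum_(j < m) normc (hd z j).
have Z0 : 0 <= Z by rewrite sumr_ge0// => j _; exact: normc_ge0.
(* The summands come from the dilation of z', the dilation of the last coordinate, and the shear. *)
exists (m%:R * scl z + rho z + 2 * scl z * Z).
  rewrite ltr_pwDl ?mulr_ge0 ?(ltW s0)//.
  by rewrite ltr_pwDr// mulr_ge0 ?(ltW s0).
move=> w v; set N := nrm1 (v - w).
have hj j : normc (hd v j - hd w j) <= N.
  by have := ler_coord_nrm1 (v - w) (wd j); rewrite rV_subE.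
have hl : normc (lst v - lst w) <= N.
  by have := ler_coord_nrm1 (v - w) ord_max; rewrite rV_subE.
have -> : (m%:R * scl z + rho z + 2 * scl z * Z) * N =
  m%:R * (scl z * N) + (rho z * N + 2 * scl z * (Z * N)) by ring.
rewrite {1}/nrm1 sum_wd; apply: lerD.
  rewrite natr_mul_sum; apply: ler_sum => j _.
  rewrite rV_subE -!/(hd _ _) sg_sub_hd normcM normcR gtr0_norm//.
  by apply: ler_wpM2l; [exact: ltW|exact: hj].
rewrite rV_subE -!/(lst _) sg_sub_lst; apply: (le_trans (le_normcD _ _)).
apply: lerD.
  rewrite normcM normcR gtr0_norm//.
  by apply: ler_wpM2l; [exact: ltW|exact: hl].
rewrite !normcM normci normcR gtr0_norm// mulr1 normc2.
apply: ler_wpM2l; first by apply: mulr_ge0 => //; exact: ltW.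
apply: (le_trans (ler_normc_sum _ _ _)); rewrite mulr_suml; apply: ler_sum => j _.
by rewrite normcM normc_conj mulrC; apply: ler_wpM2l; [exact: normc_ge0|exact: hj].
Qed.

(** As [sg z] is affine, its increments are exact and the only remainder is that of [f], controlled
    through [nrm1_sg]. *)
Lemma cgrad_sg (f : Cn -> R[i]) z w g : siegel z -> cgrad f (sg z w) g ->
  cgrad (f \o sg z) w (gsg z g).
Proof.
move=> sz fg e e0; have [C C0 HC] := nrm1_sg sz.
have [d d0 Hd] := fg _ (divr_gt0 e0 C0).
pose n := (m.+1)%:R : R.
have n0 : 0 < n by rewrite ltr0n.
exists (d / (2 * (C * n))); first by rewrite divr_gt0// !mulr_gt0.
move=> v wv; have n1 := polydisc_nrm1 wv.
have n2 : nrm1 (sg z v - sg z w) < d.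
  apply: (le_lt_trans (HC w v)).
  apply: (@le_lt_trans _ _ (C * (n * (d / (2 * (C * n)))))).
    by rewrite ler_pM2l.
  have -> : C * (n * (d / (2 * (C * n)))) = d / 2 by field; rewrite !gt_eqF.
  by rewrite ltr_pdivrMr// ltr_pMr// ltr1n.
have := Hd _ (nrm1_polydisc n2).
have -> : \sum_j g j * (sg z v 0 j - sg z w 0 j) = \sum_j gsg z g j * (v 0 j - w 0 j).
  rewrite !sum_wd gsg_max.
  have := sg_sub_lst z w v; rewrite /lst => ->.
  rewrite mulrDr mulrCA [g _ * (2 * _ * _ * _)]mulrC !mulr_sumr mulr_suml.
  rewrite addrCA -big_split/= addrC mulrA; congr (_ + _).
  apply: eq_bigr => j _; have := sg_sub_hd z w v j; rewrite /hd => ->.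
  by rewrite gsg_wd /hd; ring.
move=> /le_trans; apply.
by rewrite mulrAC ler_pdivrMr// -mulrA ler_pM2l// mulrC HC.
Qed.

Lemma ginv_ge0 g z : 0 <= ginv g z.
Proof. exact: sqrtr_ge0. Qed.

Lemma ginv_sqr g z : siegel z -> ginv g z ^+ 2 =
  2 * rho z * (4 * rho z * normc (g ord_max) ^+ 2 +
    \sum_(j < m) normc (g (wd j) + 2 * 'i * (hd z j)^*%C * g ord_max) ^+ 2).
Proof.
move=> /siegel_rho/ltW z0; rewrite sqr_sqrtr//.
apply: mulr_ge0; first exact: mulr_ge0.
apply: addr_ge0; last by apply: sumr_ge0 => j _; exact: sqr_ge0.
by apply: mulr_ge0; [exact: mulr_ge0|exact: sqr_ge0].
Qed.

(** The invariant gradient squared dominates 8 rho^2 |g_n|^2 and 2 rho times the square of each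
    bracket, with rho >= k/4. Each g_j is recovered from its bracket by subtracting 2 i conj w_j
    g_n, which accounts for the term in [M]. *)
Lemma ginv_coord_le (k M : R) g w : 0 < k -> k <= 1 -> 0 <= M -> siegel w ->
  k / 4 <= rho w -> (forall j, normc (w 0 j) <= M) ->
  forall j, normc (g j) <= (4 + 8 * M) / k * ginv g w.
Proof.
move=> k0 k1 M0 sw kw wM; have G0 := ginv_ge0 g w.
have := ginv_sqr g sw; set G := ginv g w in G0 *; set S := \sum_(j < m) _ => GE.
have S0 : 0 <= S by rewrite sumr_ge0// => j _; rewrite sqr_ge0.
set N := normc (g ord_max) in GE.
have N0 : 0 <= N by exact: normc_ge0.
have r0 : 0 < rho w by exact/siegel_rho.
have h1 : k * N <= 4 * G.
  rewrite -(@ler_pXn2r _ 2)// ?nnegrE ?mulr_ge0 ?(ltW k0)//.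
  rewrite !exprMn GE.
  have rk : (k / 4) ^+ 2 <= rho w ^+ 2.
    by rewrite ler_pXn2r ?nnegrE// ?divr_ge0// ltW.
  have a1 : (k / 4) ^+ 2 * N ^+ 2 <= rho w ^+ 2 * N ^+ 2 by rewrite ler_wpM2r ?sqr_ge0.
  have a2 : 0 <= rho w * S by rewrite mulr_ge0// ltW.
  have a3 : 0 <= rho w ^+ 2 * N ^+ 2 by rewrite mulr_ge0 ?sqr_ge0.
  move: a1 a2 a3; rewrite !expr2; nra.
have h2 j : k * normc (g (wd j) + 2 * 'i * (hd w j)^*%C * g ord_max) <= 2 * G.
  set A := normc _; have A0 : 0 <= A by exact: normc_ge0.
  have AS : A ^+ 2 <= S.
    by rewrite /S (bigD1 j)//= lerDl sumr_ge0// => i _; rewrite sqr_ge0.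
  rewrite -(@ler_pXn2r _ 2)// ?nnegrE ?mulr_ge0 ?(ltW k0)//.
  rewrite !exprMn GE.
  have b1 : k ^+ 2 * A ^+ 2 <= k * A ^+ 2.
    by rewrite ler_wpM2r ?sqr_ge0// expr2 ler_piMl// ltW.
  have b2 : k / 4 * A ^+ 2 <= rho w * S.
    by rewrite ler_pM ?sqr_ge0// divr_ge0// ltW.
  have b3 : 0 <= rho w * (rho w * N ^+ 2).
    by apply: mulr_ge0; [exact: ltW|apply: mulr_ge0; [exact: ltW|exact: sqr_ge0]].
  have b4 : 0 <= rho w * S by apply: mulr_ge0 => //; exact: ltW.
  by lra.
have M8 : 4 * G <= (4 + 8 * M) * G.
  by rewrite ler_wpM2r// lerDl mulr_ge0.
move=> j; rewrite mulrAC ler_pdivlMr// mulrC.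
case: (unliftP ord_max j) => [i|] ->; last exact: le_trans h1 M8.
rewrite -widen_lift.
have -> : g (wd i) = (g (wd i) + 2 * 'i * (hd w i)^*%C * g ord_max)
    - 2 * 'i * (hd w i)^*%C * g ord_max by ring.
apply: (@le_trans _ _ (k * normc (g (wd i) + 2 * 'i * (hd w i)^*%C * g ord_max)
   + k * normc (2 * 'i * (hd w i)^*%C * g ord_max))).
  by rewrite -mulrDr ler_pM2l// ler_normcB.
have h3 : k * normc (2 * 'i * (hd w i)^*%C * g ord_max) <= 2 * M * (4 * G).
  rewrite !normcM normc2 normci normc_conj mulr1 -/N.
  have -> : k * (2 * normc (hd w i) * N) = 2 * normc (hd w i) * (k * N) by ring.
  by rewrite ler_pM ?mulr_ge0 ?normc_ge0 ?(ltW k0)// ler_pM2l// wM.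
by have := h2 i; move: h3; nra.
Qed.

(** At the base point rho is 1 and z' is 0, so the square is 8 |g_n|^2 plus twice the sum of the
    other |g_j|^2, and 8 + 2 m <= (4 + m)^2. *)
Lemma ginv_base_le g X : 0 <= X -> (forall j, normc (g j) <= X) ->
  ginv g base <= (4 + m%:R) * X.
Proof.
move=> X0 gX; have G0 := ginv_ge0 g base.
have X20 : 0 <= X ^+ 2 by exact: sqr_ge0.
rewrite -(@ler_pXn2r _ 2)// ?nnegrE ?mulr_ge0 ?addr_ge0//.
rewrite ginv_sqr; last exact: siegel_base.
rewrite rho_base mulr1.
have h1 : normc (g ord_max) ^+ 2 <= X ^+ 2 by rewrite ler_pXn2r ?nnegrE ?normc_ge0.
have h2 : \sum_(j < m) normc (g (wd j) + 2 * 'i * (hd base j)^*%C * g ord_max) ^+ 2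
    <= m%:R * X ^+ 2.
  rewrite natr_mul_sum; apply: ler_sum => j _.
  rewrite hd_mkC conjc0 mulr0 mul0r addr0.
  by rewrite ler_pXn2r ?nnegrE ?normc_ge0.
have m0 : 0 <= (m%:R : R) by [].
apply: (@le_trans _ _ (2 * (4 * X ^+ 2 + m%:R * X ^+ 2))).
  by move: h1 h2; set A := normc _ ^+ 2; set B := \sum_(j < m) _; lra.
rewrite exprMn -mulrDl mulrA ler_wpM2r//.
by rewrite expr2; nra.
Qed.

Lemma normc_dot_le g (d : 'I_m.+1 -> R[i]) X Y : 0 <= X -> (forall j, normc (g j) <= X) ->
  (forall j, normc (d j) <= Y) -> normc (\sum_j g j * d j) <= (m.+1)%:R * (X * Y).
Proof.
move=> X0 gX dY; rewrite (le_trans (ler_normc_sum _ _ _))//.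
rewrite natr_mul_sum; apply: ler_sum => j _.
by rewrite normcM ler_pM ?normc_ge0.
Qed.

End invariant_gradient.

(** * Change of variables *)

Section borel_Cn.
Context {R : realType} {n : nat}.
Local Notation Cn := 'rV[R[i]]_n.

(** An open set is the union of the countably many rational boxes it contains, and boxes are
    measurable through the real coordinates. *)
Lemma open_measurable_Cn (A : set Cn) : open A -> measurable A.
Proof.
move=> oA.
pose B (qk : (n + n).-tuple rat * nat) : set Cn := [set w : Cn |
  forall i, `|tnth (realify w) i - ratr (tnth qk.1 i)| < (qk.2.+1)%:R^-1].
have mB qk : measurable (B qk).
  have -> : B qk = \bigcap_(i in [set: 'I_(n + n)])
      ((fun w : Cn => tnth (realify w) i) @^-1`
       `](ratr (tnth qk.1 i) - (qk.2.+1)%:R^-1), (ratr (tnth qk.1 i) + (qk.2.+1)%:R^-1)[%classic).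
    apply/seteqP; split=> w /=.
      by move=> H i _ /=; rewrite in_itv/= -ltr_distlC distrC.
    by move=> H i; have := H i I; rewrite /= in_itv/= -ltr_distlC distrC.
  apply: fin_bigcap_measurable => // i _.
  rewrite -[X in measurable X]setTI.
  have mi : measurable_fun setT (fun w : Cn => tnth (realify w) i).
    exact: (measurableT_comp (measurable_tnth i) measurable_realify).
  by apply: mi => //; exact: measurable_itv.
have -> : A = \bigcup_qk (if `[< B qk `<=` A >] then B qk else set0).
  apply/seteqP; split=> [w Aw|w [qk _]]; last by case: ifPn => // /asboolP; exact.
  have /nbhs_polydiscP[e e0 He] : nbhs w A by exact: open_nbhs_nbhs.
  (* Two points of the same rational box differ by less than e/2 in each real coordinate, hence by
     less than e in each complex one. *)
  have [k Hk] : exists k : nat, (k.+1)%:R^-1 < e / 4 :> R.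
    have e40 : 0 < e / 4 by rewrite divr_gt0.
    exists (Num.truncn (e / 4)^-1); rewrite invf_plt ?posrE//.
    exact: truncnS_gt.
  have k0 : 0 < (k.+1)%:R^-1 :> R by rewrite invr_gt0.
  have /choice[q Hq] (i : 'I_(n + n)) : exists q : rat,
      `|tnth (realify w) i - ratr q| < (k.+1)%:R^-1.
    have [|q] := @rat_in_itvoo R (tnth (realify w) i - (k.+1)%:R^-1) (tnth (realify w) i + (k.+1)%:R^-1).
      by rewrite ltrD2l gt0_cp.
    by rewrite in_itv/= -ltr_distlC => h; exists q.
  exists ([tuple q i | i < n + n], k) => //.
  have Bw : B ([tuple q i | i < n + n], k) w by move=> i /=; rewrite tnth_mktuple.
  rewrite ifT//; apply/asboolP => v Bv; apply: He => j.
  have D i : `|tnth (realify v) i - tnth (realify w) i| < e / 4 + e / 4.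
    have := Bv i; have := Bw i; rewrite /= !tnth_mktuple => h1 h2.
    rewrite (le_lt_trans (ler_distD (ratr (q i)) _ _))//.
    by rewrite ltrD// ?[`|ratr _ - _|]distrC (lt_trans _ Hk).
  apply: (le_lt_trans (ler_normc_ReIm _)); rewrite !raddfB.
  have := D (lshift n j); have := D (rshift n j); rewrite !tnth_realify.
  set x := `|_ - _|; set y := `|_ - _|; lra.
apply: countable_bigcupT_measurable => [|qk]; first exact: countableP.
by case: ifP => _; [exact: mB|exact: measurable0].
Qed.

Lemma open_measurable_fun_Cn (U : set Cn) (g : Cn -> R) : open U ->
  (forall z, U z -> g x @[x --> z] --> g z) -> measurable_fun U g.
Proof.
move=> oU gc; apply: (measurability _ (RGenOpens.measurableE R)).
move=> _ /= -[_ [a [b ->]] <-].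
apply: open_measurable_Cn.
rewrite openE => z [Uz gz]; apply: filterI.
  exact: open_nbhs_nbhs.
by apply: gc => //; apply: open_nbhs_nbhs; split.
Qed.

End borel_Cn.

(** * Measurability and Jacobian of the automorphisms *)

Section transform.
Context {R : realType} {m : nat}.
Local Notation Cn := 'rV[R[i]]_m.+1.
Local Notation wd := (widen_ord (leqnSn m)).
Implicit Types (z w : Cn).

Definition cmeasurable d (T : measurableType d) (g : T -> R[i]) :=
  measurable_fun setT (fun x => complex.Re (g x)) /\
  measurable_fun setT (fun x => complex.Im (g x)).

Lemma cmeasurable_cst d (T : measurableType d) (a : R[i]) :
  cmeasurable (fun _ : T => a).
Proof. by split; exact: measurable_cst. Qed.

Lemma cmeasurableD d (T : measurableType d) (g h : T -> R[i]) :
  cmeasurable g -> cmeasurable h -> cmeasurable (fun x => g x + h x).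
Proof.
move=> [g1 g2] [h1 h2]; split.
  have -> : (fun x => complex.Re (g x + h x)) =
    (fun x => complex.Re (g x) + complex.Re (h x)).
    by apply/funext => x; case: (g x); case: (h x).
  exact: measurable_funD.
have -> : (fun x => complex.Im (g x + h x)) =
  (fun x => complex.Im (g x) + complex.Im (h x)).
  by apply/funext => x; case: (g x); case: (h x).
exact: measurable_funD.
Qed.

Lemma cmeasurableM d (T : measurableType d) (g h : T -> R[i]) :
  cmeasurable g -> cmeasurable h -> cmeasurable (fun x => g x * h x).
Proof.
move=> [g1 g2] [h1 h2]; split.
  have -> : (fun x => complex.Re (g x * h x)) = (fun x =>
    complex.Re (g x) * complex.Re (h x) - complex.Im (g x) * complex.Im (h x)).
    by apply/funext => x; case: (g x); case: (h x).
  by apply: measurable_funB; exact: measurable_funM.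
have -> : (fun x => complex.Im (g x * h x)) = (fun x =>
  complex.Re (g x) * complex.Im (h x) + complex.Im (g x) * complex.Re (h x)).
  by apply/funext => x; case: (g x); case: (h x).
by apply: measurable_funD; exact: measurable_funM.
Qed.

Lemma cmeasurable_sum d (T : measurableType d) (I : Type) (s : seq I)
    (h : I -> T -> R[i]) : (forall i, cmeasurable (h i)) ->
  cmeasurable (fun x => \sum_(i <- s) h i x).
Proof.
move=> mh; elim: s => [|i s IH].
  have -> : (fun x : T => \sum_(i <- [::]) h i x) = (fun=> 0).
    by apply/funext => x; rewrite big_nil.
  exact: cmeasurable_cst.
have -> : (fun x => \sum_(j <- i :: s) h j x) = (fun x => h i x + \sum_(j <- s) h j x).
  by apply/funext => x; rewrite big_cons.
exact: cmeasurableD.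
Qed.

Lemma cmeasurable_coord n (j : 'I_n) : cmeasurable (fun w : 'rV[R[i]]_n => w 0 j).
Proof. by split; [exact: measurable_Re_coord|exact: measurable_Im_coord]. Qed.

Lemma measurable_mkC d (T : measurableType d) (h : 'I_m -> T -> R[i]) (l : T -> R[i]) :
  (forall j, cmeasurable (h j)) -> cmeasurable l ->
  measurable_fun setT (fun x => mkC (h^~ x) (l x)).
Proof.
move=> mh ml.
have E (P : R[i] -> R) k : (fun x => P (mkC (h^~ x) (l x) 0 k)) =
    (fun x => P (if unlift ord_max k is Some j then h j x else l x)).
  by apply/funext => x; rewrite mxE.
apply: measurable_fun_Cn => k.
  rewrite (E (@complex.Re R) k); case: unlift => [j|].
    by case: (mh j).
  by case: ml.
rewrite (E (@complex.Im R) k); case: unlift => [j|].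
  by case: (mh j).
by case: ml.
Qed.

Lemma measurable_sgi z : measurable_fun setT (sgi z).
Proof.
pose h (j : 'I_m) (w : Cn) : R[i] := (scl z)^-1%:C * (hd w j - hd z j).
have mh j : cmeasurable (h j).
  apply: cmeasurableM; first exact: cmeasurable_cst.
  by apply: cmeasurableD; [exact: cmeasurable_coord|exact: cmeasurable_cst].
apply: (@measurable_mkC _ _ h (fun w => 'i + (rho z)^-1%:C * (lst w - lst z
       - 2 * 'i * (scl z)%:C * \sum_(j < m) h j w * (hd z j)^*%C))) => //.
apply: cmeasurableD; first exact: cmeasurable_cst.
apply: cmeasurableM; first exact: cmeasurable_cst.
have -> : (fun x : Cn => lst x - lst z - 2 * 'i * (scl z)%:C *
    \sum_(j < m) h j x * (hd z j)^*%C) = (fun x : Cn => lst x +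
    (- lst z + (- (2 * 'i * (scl z)%:C)) * \sum_(j < m) h j x * (hd z j)^*%C)).
  by apply/funext => x; ring.
apply: cmeasurableD; first exact: cmeasurable_coord.
apply: cmeasurableD; first exact: cmeasurable_cst.
apply: cmeasurableM; first exact: cmeasurable_cst.
apply: cmeasurable_sum => j.
by apply: cmeasurableM; [exact: mh|exact: cmeasurable_cst].
Qed.

(* The z'-part of [sg z], on the coordinates in l; the last coordinate is then
   changed affinely, with the others as parameters. *)
Definition dil (l : seq 'I_m.+1) z w : Cn :=
  \row_k (if k \in l then (scl z)%:C * w 0 k + z 0 k else w 0 k).

Lemma dilE l z w k :
  dil l z w 0 k = if k \in l then (scl z)%:C * w 0 k + z 0 k else w 0 k.
Proof. by rewrite mxE. Qed.

Lemma measurable_dil l z : measurable_fun setT (dil l z).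
Proof.
have E (P : R[i] -> R) k : (fun w => P (dil l z w 0 k)) =
    (fun w => P (if k \in l then (scl z)%:C * w 0 k + z 0 k else w 0 k)).
  by apply/funext => x; rewrite dilE.
have c k : cmeasurable (fun w : Cn =>
    if k \in l then (scl z)%:C * w 0 k + z 0 k else w 0 k).
  case: (k \in l); last exact: cmeasurable_coord.
  apply: cmeasurableD; last exact: cmeasurable_cst.
  by apply: cmeasurableM; [exact: cmeasurable_cst|exact: cmeasurable_coord].
by apply: measurable_fun_Cn => k; rewrite E; case: (c k).
Qed.

Local Open Scope ereal_scope.

Lemma integral_dil l z (F : Cn -> \bar R) : siegel z -> uniq l ->
  measurable_fun setT F -> (forall w, 0 <= F w) ->
  \int[volume]_w F w =
  ((scl z ^+ 2) ^+ size l)%:E * \int[volume]_w F (dil l z w).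
Proof.
move=> sz; have s0 := scl_gt0 sz.
elim: l F => [|k l IH] F /=.
  move=> _ mF F0; rewrite expr0 mul1e; apply: eq_integral => w _; congr F.
  by apply/rowP => k; rewrite dilE.
move=> /andP[kl ul] mF F0; rewrite (IH F ul mF F0).
have mFd : measurable_fun setT (F \o dil l z).
  by apply: measurableT_comp => //; exact: measurable_dil.
have := @integral_cupd_affine R _ _ mFd (fun w => F0 _) k (scl z) (fun=> z 0%R k)
  s0 (measurable_cst _) (measurable_cst _) (fun w x => erefl) => ->.
rewrite muleA -EFinM -exprSr; congr (_ * _); apply: eq_integral => w _.
rewrite /=; congr F; apply/rowP => j; rewrite !dilE in_cons cupdE.
have [->|jk] := eqVneq j k; first by rewrite (negPf kl).
by [].
Qed.

(** The map is triangular: z' is dilated one coordinate at a time, then the last coordinate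
    undergoes an affine change whose shift depends on the others only. The constant is (rho z)^(m +
    2). *)
Lemma integral_sg z : siegel z -> exists2 c : R, (0 < c)%R &
  forall F : Cn -> \bar R, measurable_fun setT F -> (forall w, 0 <= F w) ->
  \int[volume]_w F w = c%:E * \int[volume]_w F (sg z w).
Proof.
move=> sz; have s0 := scl_gt0 sz; have /siegel_rho r0 := sz.
pose l := [seq wd j | j <- enum 'I_m].
have ul : uniq l.
  rewrite map_inj_uniq ?enum_uniq// => i j /(congr1 val)/= ij.
  exact: val_inj.
have wl j : wd j \in l by rewrite map_f// mem_enum.
have nl : ord_max \notin l.
  apply/mapP => -[j _ /(congr1 val)/= E].
  by have := ltn_ord j; rewrite -E ltnn.
exists ((scl z ^+ 2) ^+ size l * rho z ^+ 2)%R.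
  by rewrite mulr_gt0// !exprn_gt0.
move=> F mF F0; rewrite (integral_dil sz ul mF F0).
have mFd : measurable_fun setT (F \o dil l z).
  by apply: measurableT_comp => //; exact: measurable_dil.
(* The shift uses the original z'-coordinates of [w], because the dilation acts after the change of
   the last coordinate. *)
pose h w : R[i] := (lst z - (rho z)%:C * 'i
  + 2 * 'i * (scl z)%:C * \sum_(j < m) hd w j * (hd z j)^*%C)%R.
have [mh1 mh2] : cmeasurable h.
  apply: cmeasurableD; first exact: cmeasurable_cst.
  apply: cmeasurableM; first exact: cmeasurable_cst.
  apply: cmeasurable_sum => j.
  by apply: cmeasurableM; [exact: cmeasurable_coord|exact: cmeasurable_cst].
have hc w x : h (cupd w ord_max x) = h w.
  rewrite /h; congr (_ + _ * _)%R; apply: eq_bigr => j _.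
  by rewrite /hd cupdE widen_lift eq_sym (negPf (neq_lift _ _)).
have := @integral_cupd_affine R _ _ mFd (fun w => F0 _) ord_max (rho z) h
  r0 mh1 mh2 hc => ->.
rewrite muleA -EFinM; congr (_ * _); apply: eq_integral => w _ /=; congr F.
apply: hd_lst_eq => [j|].
  rewrite hd_mkC /hd dilE wl cupdE widen_lift eq_sym (negPf (neq_lift _ _)).
  by rewrite addrC.
rewrite lst_mkC /lst dilE (negPf nl) cupdE eqxx /h /lst; ring.
Qed.

End transform.

(** * Mean oscillation *)

Section bounded_integrals.
Context {R : realType} {n : nat}.
Local Notation Cn := 'rV[R[i]]_n.
Variable D : set Cn.
Hypothesis mD : measurable D.
Hypothesis fD : (volume D < +oo)%E.
Local Notation vol := (fine (volume D)).

(** Boundedness on a set of finite volume makes every integral below finite. *)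
Definition bmeas (g : Cn -> R[i]) :=
  [/\ measurable_fun D (fun w => complex.Re (g w)),
      measurable_fun D (fun w => complex.Im (g w)) &
      exists M, forall w, D w -> normc (g w) <= M].

Lemma integrable_bounded (h : Cn -> R) M : measurable_fun D h ->
  (forall w, D w -> `|h w| <= M) -> volume.-integrable D (EFin \o h).
Proof.
move=> mh hM; apply: measurable_bounded_integrable => //.
by exists M; split; [exact: num_real|move=> x Mx w Dw /=; exact: le_trans (hM w Dw) (ltW Mx)].
Qed.

Lemma measurable_normc_sqr g : bmeas g -> measurable_fun D (fun w => normc (g w) ^+ 2).
Proof.
move=> [m1 m2 _]; rewrite (_ : (fun w => _) =
  fun w => complex.Re (g w) ^+ 2 + complex.Im (g w) ^+ 2); last first.
  by apply/funext => w; rewrite normc_sqr.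
exact: (measurable_funD (measurable_funX 2 m1) (measurable_funX 2 m2)).
Qed.

Lemma measurable_normc g : bmeas g -> measurable_fun D (fun w => normc (g w)).
Proof.
move=> bg; rewrite (_ : (fun w => _) = Num.sqrt \o (fun w => normc (g w) ^+ 2)); last first.
  by apply/funext => w /=; rewrite sqrtr_sqr ger0_norm ?normc_ge0.
have ms : measurable_fun setT (@Num.sqrt R).
  by apply: continuous_measurable_fun; exact: sqrt_continuous.
exact: (measurable_comp measurableT _ ms (measurable_normc_sqr bg)).
Qed.

Lemma bmeas_integrable g : bmeas g ->
  [/\ volume.-integrable D (EFin \o (fun w => complex.Re (g w))),
      volume.-integrable D (EFin \o (fun w => complex.Im (g w))),
      volume.-integrable D (EFin \o (fun w => normc (g w))) &
      volume.-integrable D (EFin \o (fun w => normc (g w) ^+ 2))].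
Proof.
move=> bg; have [m1 m2 [M gM]] := bg; split.
- by apply: (integrable_bounded m1) => w /gM; exact: le_trans (ler_Re_normc _).
- by apply: (integrable_bounded m2) => w /gM; exact: le_trans (ler_Im_normc _).
- apply: (integrable_bounded (measurable_normc bg)) => w /gM.
  by rewrite ger0_norm ?normc_ge0; exact.
- apply: (integrable_bounded (M := M ^+ 2) (measurable_normc_sqr bg)) => w /gM h.
  rewrite ger0_norm ?sqr_ge0// ler_pXn2r ?nnegrE ?normc_ge0//.
  exact: le_trans (normc_ge0 _) h.
Qed.

Lemma bmeasB g h : bmeas g -> bmeas h -> bmeas (fun w => g w - h w).
Proof.
move=> [g1 g2 [M gM]] [h1 h2 [N hN]]; split.
- rewrite (_ : (fun w => _) = fun w => complex.Re (g w) - complex.Re (h w)).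
    exact: measurable_funB.
  by apply/funext => w; rewrite raddfB.
- rewrite (_ : (fun w => _) = fun w => complex.Im (g w) - complex.Im (h w)).
    exact: measurable_funB.
  by apply/funext => w; rewrite raddfB.
- exists (M + N) => w Dw; rewrite (le_trans (ler_normcB _ _))// lerD//.
    exact: gM.
  exact: hN.
Qed.

Lemma bmeas_cst a : bmeas (fun=> a).
Proof. by split; [exact: measurable_cst|exact: measurable_cst|exists (normc a)]. Qed.

Lemma bmeasZ g a : bmeas g -> bmeas (fun w => a * g w).
Proof.
move=> [g1 g2 [M gM]]; case: a => p q; split.
- rewrite (_ : (fun w => _) = fun w => p * complex.Re (g w) - q * complex.Im (g w)).
    by apply: measurable_funB; apply: measurable_funM.
  by apply/funext => w; case: (g w).
- rewrite (_ : (fun w => _) = fun w => p * complex.Im (g w) + q * complex.Re (g w)).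
    by apply: measurable_funD; apply: measurable_funM.
  by apply/funext => w; case: (g w).
- exists (normc (p +i* q) * M) => w Dw; rewrite normcM ler_wpM2l ?normc_ge0//.
  exact: gM.
Qed.

Lemma cintegralB g h : bmeas g -> bmeas h ->
  cintegral D (fun w => g w - h w) = cintegral D g - cintegral D h.
Proof.
move=> bg bh; have [g1 g2 _ _] := bmeas_integrable bg.
have [h1 h2 _ _] := bmeas_integrable bh.
rewrite /cintegral; apply/eqP; rewrite eq_complex/=.
under eq_Rintegral do rewrite raddfB.
rewrite (RintegralB mD g1 h1)//= eqxx/=.
under eq_Rintegral do rewrite raddfB.
by rewrite (RintegralB mD g2 h2).
Qed.

Lemma cintegral_cst a : cintegral D (fun=> a) = a * vol%:C.
Proof.
rewrite /cintegral !Rintegral_cst//; case: a => p q.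
by apply/eqP; rewrite eq_complex/= !mulr0 subr0 add0r !eqxx.
Qed.

Lemma normc_cintegral g : bmeas g ->
  normc (cintegral D g) <= \int[volume]_(w in D) normc (g w).
Proof.
move=> bg; set I := cintegral D g; have [g1 g2 g3 _] := bmeas_integrable bg.
have [->|I0] := eqVneq I 0.
  by rewrite normc0; apply: Rintegral_ge0 => x _; exact: normc_ge0.
have H : (normc I) ^+ 2 <= normc I * \int[volume]_(w in D) normc (g w).
  have -> : normc I ^+ 2 = \int[volume]_(w in D) complex.Re (I^*%C * g w).
    have E w : complex.Re (I^*%C * g w) =
        complex.Re I * complex.Re (g w) + complex.Im I * complex.Im (g w).
      by case: (I) => p q; case: (g w) => u v /=; ring.
    under eq_Rintegral do rewrite E.
    have i1 : volume.-integrable D (EFin \o (fun w => complex.Re I * complex.Re (g w))).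
      by have := integrableZl mD (complex.Re I) g1; apply: eq_integrable.
    have i2 : volume.-integrable D (EFin \o (fun w => complex.Im I * complex.Im (g w))).
      by have := integrableZl mD (complex.Im I) g2; apply: eq_integrable.
    by rewrite RintegralD// !RintegralZl// normc_sqr !expr2.
  rewrite -RintegralZl//; apply: le_Rintegral => //.
  - by have [] := bmeas_integrable (bmeasZ I^*%C bg).
  - by have := integrableZl mD (normc I) g3; apply: eq_integrable.
  - move=> w _; rewrite (le_trans (ler_norm _))// (le_trans (ler_Re_normc _))//.
    by rewrite normcM (normc_conj I).
by rewrite expr2 ler_pM2l ?normc_gt0 in H.
Qed.

Hypothesis D0 : 0 < vol.

(** [avg] and [osc] are [mean] and [MO] over a fixed set; on the ball about the base point they
    agree with those by conversion. *)
Definition avg g : R[i] := cintegral D g / vol%:C.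
Definition osc g : R :=
  Num.sqrt (vol^-1 * \int[volume]_(w in D) normc (g w - avg g) ^+ 2).

Let volC : vol%:C != 0 :> R[i].
Proof. by rewrite -normc_gt0 normcR gtr0_norm. Qed.

Lemma le_Rint_cst (h : Cn -> R) M : volume.-integrable D (EFin \o h) ->
  (forall w, D w -> h w <= M) -> \int[volume]_(w in D) h w <= M * vol.
Proof.
move=> ih hM; rewrite -(Rintegral_cst volume mD).
apply: le_Rintegral => //.
apply: (@integrable_bounded (fun=> M) `|M|); first exact: measurable_cst.
by [].
Qed.

Lemma avg_dist g a S : bmeas g -> (forall w, D w -> normc (g w - a) <= S) ->
  normc (avg g - a) <= S.
Proof.
move=> bg gS; have ba := bmeas_cst a; have bga := bmeasB bg ba.
have -> : avg g - a = cintegral D (fun w => g w - a) / vol%:C.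
  by rewrite (cintegralB bg ba) cintegral_cst mulrBl mulfK.
rewrite normcM normcV normcR gtr0_norm// ler_pdivrMr//.
rewrite (le_trans (normc_cintegral bga))//.
by apply: le_Rint_cst => //; case: (bmeas_integrable bga).
Qed.

(** The mean lies within [S] of the reference value [a] as well, which costs the factor 2. *)
Lemma osc_le g a S : 0 <= S -> bmeas g -> (forall w, D w -> normc (g w - a) <= S) ->
  osc g <= 2 * S.
Proof.
move=> S0 bg gS; have aS := avg_dist bg gS.
have bga := bmeasB bg (bmeas_cst (avg g)).
have S20 : 0 <= 2 * S by rewrite mulr_ge0.
rewrite /osc -(ger0_norm S20) -sqrtr_sqr ler_wsqrtr//.
rewrite ler_pdivrMl// mulrC; apply: le_Rint_cst.
  by case: (bmeas_integrable bga).
move=> w Dw; rewrite ler_pXn2r ?nnegrE ?normc_ge0//.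
have -> : g w - avg g = (g w - a) - (avg g - a) by ring.
rewrite (le_trans (ler_normcB _ _))// mulrDl mul1r lerD//.
exact: gS.
Qed.

Lemma osc_sqr g : osc g ^+ 2 = vol^-1 * \int[volume]_(w in D) normc (g w - avg g) ^+ 2.
Proof.
rewrite sqr_sqrtr// mulr_ge0 ?invr_ge0 ?(ltW D0)//.
by apply: Rintegral_ge0 => w _; exact: sqr_ge0.
Qed.

(* AM-GM replaces the Cauchy-Schwarz inequality here. *)
Lemma int_normc_le_osc g t : bmeas g -> osc g < t ->
  \int[volume]_(w in D) normc (g w - avg g) <= t * vol.
Proof.
move=> bg ot; have t0 : 0 < t by rewrite (le_lt_trans _ ot)// sqrtr_ge0.
have bga := bmeasB bg (bmeas_cst (avg g)).
have [_ _ i1 i2] := bmeas_integrable bga.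
set J := \int[volume]_(w in D) normc (g w - avg g) ^+ 2.
have JE : J = vol * osc g ^+ 2 by rewrite osc_sqr mulrA divff ?mul1r// gt_eqF.
have Jt : J <= vol * t ^+ 2.
  by rewrite JE ler_pM2l// ler_pXn2r ?nnegrE ?sqrtr_ge0 ?(ltW t0)// ltW.
have i3 : volume.-integrable D (EFin \o (fun w => (2 * t)^-1 * normc (g w - avg g) ^+ 2)).
  by have := integrableZl mD (2 * t)^-1 i2; apply: eq_integrable.
have i4 : volume.-integrable D (EFin \o (fun _ : Cn => t / 2)).
  by apply: (@integrable_bounded (fun=> t / 2) `|t / 2|); first exact: measurable_cst.
apply: (@le_trans _ _ (\int[volume]_(w in D) (t / 2 + (2 * t)^-1 * normc (g w - avg g) ^+ 2))).
  apply: le_Rintegral => //.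
    apply: (@eq_integrable _ _ _ volume _ mD
      (fun w => (t / 2)%:E + ((2 * t)^-1 * normc (g w - avg g) ^+ 2)%:E)%E) => //.
    exact: integrableD.
  move=> w _; set x := normc _; rewrite -subr_ge0.
  have -> : t / 2 + (2 * t)^-1 * x ^+ 2 - x = (2 * t)^-1 * (t - x) ^+ 2.
    by field; rewrite gt_eqF.
  by rewrite mulr_ge0 ?sqr_ge0// invr_ge0 mulr_ge0// ltW.
rewrite RintegralD// Rintegral_cst// RintegralZl// -/J.
have : (2 * t)^-1 * J <= (2 * t)^-1 * (vol * t ^+ 2).
  by rewrite ler_wpM2l// invr_ge0 mulr_ge0// ltW.
have -> : (2 * t)^-1 * (vol * t ^+ 2) = vol * t / 2 by field; rewrite gt_eqF.
by lra.
Qed.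

(** The deviations of [g] and [h] from their means differ by at most 2 e, and that of [h] is at most
    2 M; so its square grows by at most 4 e (2 M) + 4 e^2. Squares are compared because no root has
    to be estimated then. *)
Lemma osc_dist g h M e : 0 <= e -> bmeas g -> bmeas h ->
  (forall w, D w -> normc (h w) <= M) ->
  (forall w, D w -> normc (g w - h w) <= e) ->
  osc g ^+ 2 <= osc h ^+ 2 + (8 * e * M + 4 * e ^+ 2).
Proof.
have le_vol (V x y c : R) : 0 < V -> x <= y + V * c -> V^-1 * x <= V^-1 * y + c.
  by move=> V0 xy; rewrite -(ler_pM2l V0) mulrDr !mulrA divff ?gt_eqF// !mul1r.
move=> e0 bg bh hM ghe.
have bhc := bmeasB bh (bmeas_cst (avg h)).
have bgc := bmeasB bg (bmeas_cst (avg g)).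
have [_ _ _ ih] := bmeas_integrable bhc; have [_ _ _ ig] := bmeas_integrable bgc.
have am : normc (avg g - avg h) <= e.
  have bgh := bmeasB bg bh.
  have -> : avg g - avg h = avg (fun w => g w - h w) - 0.
    by rewrite /avg cintegralB// mulrBl subr0.
  by apply: avg_dist => // w Dw; rewrite subr0 ghe.
have ahM : normc (avg h) <= M.
  by rewrite -[avg h]subr0; apply: avg_dist => // w Dw; rewrite subr0 hM.
have pt w : D w -> normc (g w - avg g) ^+ 2 <=
    normc (h w - avg h) ^+ 2 + (8 * e * M + 4 * e ^+ 2).
  move=> Dw; have h1 : normc (g w - avg g) <= normc (h w - avg h) + 2 * e.
    have -> : g w - avg g = (h w - avg h) + ((g w - h w) - (avg g - avg h)) by ring.
    rewrite (le_trans (le_normcD _ _))// lerD2l (le_trans (ler_normcB _ _))//.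
    by have := ghe _ Dw; move: am; set x := normc _; set y := normc _; lra.
  have h2 : normc (h w - avg h) <= 2 * M.
    rewrite (le_trans (ler_normcB _ _))//.
    by have := hM _ Dw; move: ahM; set x := normc _; set y := normc _; lra.
  have h0 := normc_ge0 (h w - avg h); have g0 := normc_ge0 (g w - avg g).
  move: h0 g0 h1 h2; set x := normc (h w - _); set y := normc _ => h0 g0 h1 h2.
  have h3 : y ^+ 2 <= (x + 2 * e) ^+ 2.
    by rewrite ler_pXn2r ?nnegrE ?addr_ge0 ?mulr_ge0.
  have h4 : e * x <= e * (2 * M) by rewrite ler_wpM2l.
  by move: h3; rewrite !expr2; lra.
set c := 8 * e * M + 4 * e ^+ 2 in pt *.
rewrite !osc_sqr; apply: (le_vol _ _ _ _ D0).
have ic : volume.-integrable D (EFin \o (fun _ : Cn => c)).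
  by apply: (@integrable_bounded (fun=> c) `|c|); first exact: measurable_cst.
rewrite [vol * c]mulrC -(Rintegral_cst volume mD) -RintegralD//.
apply: le_Rintegral => //.
apply: (@eq_integrable _ _ _ volume _ mD
  (fun w => (normc (h w - avg h) ^+ 2)%:E + c%:E)%E) => //.
exact: integrableD.
Qed.

End bounded_integrals.

Section mean_oscillation.
Context {R : realType} {m : nat}.
Local Notation Cn := 'rV[R[i]]_m.+1.
Implicit Types (z w v : Cn) (f : Cn -> R[i]).

Definition fcont f := forall z, siegel z -> forall e, 0 < e ->
  exists2 d, 0 < d & forall w, polydisc z d w -> normc (f w - f z) < e.

Lemma holomorphic_cgrad f : holomorphic f ->
  forall z, siegel z -> cgrad f z (fun j => dz j f z).
Proof. by move=> hf z sz; apply: differentiable_cgrad; exact: hf. Qed.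

Lemma siegel_polydisc z : siegel z ->
  exists2 d, 0 < d & polydisc z d `<=` (siegel : set Cn).
Proof.
by move=> sz; apply/nbhs_polydiscP; apply: open_nbhs_nbhs; split=> //; exact: open_siegel.
Qed.

Lemma cgrad_fcont f : cgrad_on siegel f -> fcont f.
Proof. by move=> hf z /hf[g fg]; exact: cgrad_le fg. Qed.

Lemma holomorphic_fcont f : holomorphic f -> fcont f.
Proof. by move=> hf; apply: cgrad_fcont => z sz; eexists; exact: holomorphic_cgrad. Qed.

Lemma fcont_measurable f : fcont f ->
  measurable_fun siegel (fun w => complex.Re (f w)) /\
  measurable_fun siegel (fun w => complex.Im (f w)).
Proof.
move=> cf; split; apply: open_measurable_fun_Cn; try exact: open_siegel.
  move=> z sz; apply: continuous_polydisc => e /(cf z sz)[d d0 Hd].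
  exists d => // w /Hd; apply: le_lt_trans; rewrite -raddfB; exact: ler_Re_normc.
move=> z sz; apply: continuous_polydisc => e /(cf z sz)[d d0 Hd].
exists d => // w /Hd; apply: le_lt_trans; rewrite -raddfB; exact: ler_Im_normc.
Qed.

Lemma continuous_bounded (h : Cn -> R) (K : set Cn) : compact K ->
  (forall z, K z -> h x @[x --> z] --> h z) -> exists M, forall w, K w -> `|h w| <= M.
Proof.
move=> cK ch.
have wc : {within K, continuous h}.
  by apply: continuous_in_subspaceT => z /[!inE] Kz; exact: ch.
have /compact_bounded[M [_ HM]] := continuous_compact wc cK.
exists (M + 1) => w Kw; apply: (HM (M + 1)); first by rewrite ltrDl.
by exists w.
Qed.

Lemma fcont_bounded f (K : set Cn) : fcont f -> compact K -> K `<=` siegel ->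
  exists M, forall w, K w -> normc (f w) <= M.
Proof.
move=> cf cK Ks.
have [|M HM] := @continuous_bounded (fun w => normc (f w)) K cK.
  move=> z /Ks sz; apply: continuous_polydisc => e /(cf z sz)[d d0 Hd].
  by exists d => // w /Hd; apply: le_lt_trans; exact: ler_dist_normc.
by exists M => w /HM; rewrite ger0_norm ?normc_ge0.
Qed.

Lemma compact_cbox0 (K : set Cn) : compact K -> exists2 M, 0 <= M & K `<=` cbox 0 M.
Proof.
move=> cK.
have H (h : 'I_m.+1 -> Cn -> R) : (forall j z, h j x @[x --> z] --> h j z) ->
    exists2 M, 0 <= M & forall w, K w -> forall j, `|h j w| <= M.
  move=> ch.
  have /choice[M HM] (j : 'I_m.+1) : exists M, forall w, K w -> `|h j w| <= M.
    by apply: continuous_bounded => // z _; exact: ch.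
  exists (\sum_j `|M j|); first by rewrite sumr_ge0.
  move=> w Kw j; rewrite (le_trans (HM j w Kw))// (le_trans (ler_norm _))//.
  by rewrite (bigD1 j)//= lerDl sumr_ge0.
have [M M0 HM] := H _ (fun j z => @continuous_Re_coord _ _ j z).
have [N N0 HN] := H _ (fun j z => @continuous_Im_coord _ _ j z).
exists (M + N); first exact: addr_ge0.
move=> w Kw j; rewrite mxE subr0; apply/csquareP; split.
  by rewrite (le_trans (HM w Kw j))// lerDl.
by rewrite (le_trans (HN w Kw j))// lerDr.
Qed.

Lemma compact_measurable_Cn (K : set Cn) : compact K -> measurable K.
Proof.
move=> cK; rewrite -[K]setCK; apply: measurableC; apply: open_measurable_Cn.
by apply: closed_openC; apply: compact_closed => //; exact: norm_hausdorff.
Qed.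

Lemma compact_volume (K : set Cn) : compact K -> (volume K < +oo)%E.
Proof.
move=> cK; have [M M0 KM] := compact_cbox0 cK.
rewrite (@le_lt_trans _ _ (volume (cbox (0 : Cn) M)))//.
  apply: le_measure => //; rewrite inE; first exact: compact_measurable_Cn.
  exact: measurable_cbox.
by rewrite volume_cbox// ltry.
Qed.

Lemma fcont_bmeas f (D K : set Cn) : fcont f -> measurable D -> D `<=` K ->
  compact K -> K `<=` siegel -> bmeas D f.
Proof.
move=> cf mD DK cK Ks; have [m1 m2] := fcont_measurable cf.
have ms : measurable (siegel : set Cn) by apply: open_measurable_Cn; exact: open_siegel.
have Ds : D `<=` siegel by move=> w /DK /Ks.
split.
- exact: measurable_funS m1.
- exact: measurable_funS m2.
- by have [M HM] := fcont_bounded cf cK Ks; exists M => w /DK; exact: HM.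
Qed.

Lemma fcont_L2loc f : fcont f -> L2loc f.
Proof.
move=> cf; have [m1 m2] := fcont_measurable cf; split=> // K cK Ks.
have mK := compact_measurable_Cn cK; have vK := compact_volume cK.
have b : bmeas K f by exact: (@fcont_bmeas f K K).
have [_ _ _ /integrableP[_]] := bmeas_integrable mK vK b.
under eq_integral do rewrite /= ger0_norm ?sqr_ge0//.
by [].
Qed.

Section ball.
Variables (r : R) (r0 : 0 < r).
Local Notation B := (bergman_ball (base : Cn) r).
Local Notation K := (@cball R m (kap r)).

Lemma kap_le1 : kap r <= 1.
Proof. exact/ltW/kap_lt1. Qed.

Lemma compactK : compact K.
Proof. by apply: compact_cball; [exact: kap_gt0|exact: kap_le1]. Qed.

Lemma K_siegel : K `<=` siegel.
Proof. by apply: cball_siegel; [exact: kap_gt0|exact: kap_le1]. Qed.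

Lemma ball_K : B `<=` K.
Proof. exact: bergman_ball_cball. Qed.

Lemma ball_volume : (volume B < +oo)%E.
Proof.
apply: le_lt_trans (compact_volume compactK); apply: le_measure; rewrite ?inE.
- exact: measurable_bergman_ball_base.
- exact: measurable_cball.
- exact: ball_K.
Qed.

Lemma ball_cbox : exists2 e, 0 < e & cbox base e `<=` B.
Proof.
by rewrite bergman_ball_base//; apply: cball_cbox; exact: kap_lt1.
Qed.

Lemma vol_ball_gt0 : 0 < fine (volume B).
Proof.
have [e e0 eB] := ball_cbox.
rewrite fine_gt0// ball_volume andbT (@lt_le_trans _ _ (volume (cbox (base : Cn) e)))//.
  by rewrite volume_cbox ?ltW// lte_fin exprn_gt0// addr_gt0.
apply: le_measure; rewrite ?inE//; first exact: measurable_cbox.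
exact: measurable_bergman_ball_base.
Qed.

Lemma fcont_bmeas_ball f : fcont f -> bmeas B f.
Proof.
move=> cf; apply: (@fcont_bmeas f B K) => //.
- exact: measurable_bergman_ball_base.
- exact: ball_K.
- exact: compactK.
- exact: K_siegel.
Qed.

Lemma fcont_sg f z : siegel z -> fcont f -> fcont (f \o sg z).
Proof.
move=> sz cf w sw e e0; have [d d0 Hd] := cf _ (siegel_sg sz sw) _ e0.
have [C C0 HC] := nrm1_sg sz.
pose n := (m.+1)%:R : R; have n0 : 0 < n by rewrite ltr0n.
exists (d / (2 * (C * n))); first by rewrite divr_gt0// !mulr_gt0.
move=> v wv; apply: Hd; apply: nrm1_polydisc.
have n1 := polydisc_nrm1 wv.
apply: (le_lt_trans (HC w v)).
apply: (@le_lt_trans _ _ (C * (n * (d / (2 * (C * n)))))).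
  by rewrite ler_pM2l.
have -> : C * (n * (d / (2 * (C * n)))) = d / 2 by field; rewrite !gt_eqF.
by rewrite ltr_pdivrMr// ltr_pMr// ltr1n.
Qed.

Lemma ball_sgE z w : siegel z -> bergman_ball z r (sg z w) <-> B w.
Proof. by move=> sz; rewrite bergman_ball_sg//= sgK. Qed.

Lemma measurable_ball z : siegel z -> measurable (bergman_ball z r).
Proof.
move=> sz; rewrite bergman_ball_sg// -[X in measurable X]setTI.
by apply: measurable_sgi => //; exact: measurable_bergman_ball_base.
Qed.

(** The Jacobian of [sg z] multiplies the integrals and the volume alike, so it drops out of the
    mean and of the mean square. *)
Lemma MO_sg f z : siegel z -> fcont f ->
  MO r f z = MO r (f \o sg z) base.
Proof.
have invE (x y : R) : 0 < x -> (x * y)^-1 * x = y^-1.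
  by move=> x0; rewrite invfM mulrAC mulVf ?mul1r// gt_eqF.
move=> sz cf; have [c c0 Hc] := integral_sg sz.
have mB := @measurable_bergman_ball_base R m r r0.
have mBz := measurable_ball sz.
have Fc (F : Cn -> \bar R) : measurable_fun (bergman_ball z r) F ->
    (forall w, bergman_ball z r w -> 0 <= F w)%E ->
    (\int[volume]_(w in bergman_ball z r) F w =
     c%:E * \int[volume]_(w in B) F (sg z w))%E.
  move=> mF F0; rewrite integral_mkcond Hc.
  - rewrite [in RHS]integral_mkcond; congr (_ * _)%E; apply: eq_integral => w _.
    rewrite !patchE; case: ifPn => h; case: ifPn => // h'.
      by move: h'; rewrite notin_setE; move: h; rewrite inE => /(ball_sgE _ sz).
    by move: h; rewrite notin_setE; move: h'; rewrite inE => /(ball_sgE _ sz).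
  - exact: (proj1 (measurable_restrictT _ mBz) mF).
  - move=> w; rewrite patchE; case: ifPn => // /[!inE]; exact: F0.
have vE : volume (bergman_ball z r) = (c%:E * volume B)%E.
  have := Fc (fun=> 1%E) (measurable_cst _) (fun _ _ => lee01).
  have cstE (D : set Cn) : measurable D -> (\int[volume]_(w in D) 1 = volume D)%E.
    by move=> mD; rewrite -[RHS]mul1e; exact: integral_cst.
  by rewrite (cstE _ mBz) (cstE _ mB).
have vfin := ball_volume.
have vzE : fine (volume (bergman_ball z r)) = c * fine (volume B).
  by rewrite vE fineM// ge0_fin_numE.
have vzfin : (volume (bergman_ball z r) < +oo)%E.
  by rewrite vE lte_mul_pinfty// lee_fin ltW.
have cfz := fcont_sg sz cf.
have bB := fcont_bmeas_ball cfz.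
have bz : bmeas (bergman_ball z r) f.
  have [m1 m2] := fcont_measurable cf.
  have ms : measurable (siegel : set Cn) by apply: open_measurable_Cn; exact: open_siegel.
  have Bs : bergman_ball z r `<=` siegel by move=> w [].
  have [_ _ [M HM]] := bB.
  split; [exact: measurable_funS m1|exact: measurable_funS m2|].
  exists M => w; rewrite -{1 2}(sgiK sz w) => /(ball_sgE _ sz); exact: HM.
have rcst (D : set Cn) M : measurable D ->
    \int[volume]_(_ in D) M = M * fine (volume D).
  by move=> mD; exact: (Rintegral_cst volume mD M).
(* [Fc] handles nonnegative integrands only. A bounded one becomes nonnegative when its bound [M] is
   added, and the added term is removed through the volumes. *)
have RE (G : Cn -> R) M : measurable_fun (bergman_ball z r) G ->
    measurable_fun B (G \o sg z) ->
    (forall w, bergman_ball z r w -> `|G w| <= M) ->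
    \int[volume]_(w in bergman_ball z r) G w = c * \int[volume]_(w in B) G (sg z w).
  move=> mG mGs GM.
  have GsM w : B w -> `|G (sg z w)| <= M by move=> /(ball_sgE w sz); exact: GM.
  have iz := integrable_bounded mBz vzfin mG GM.
  have iB := integrable_bounded mB vfin mGs GsM.
  have cz D (mD : measurable D) (vD : (volume D < +oo)%E) :
      volume.-integrable D (EFin \o (fun _ : Cn => M)).
    by apply: (@integrable_bounded _ _ D mD vD (fun=> M) `|M|); first exact: measurable_cst.
  have G0 w : bergman_ball z r w -> (0 <= (G w + M)%:E)%E.
    by move=> /GM; rewrite ler_norml lee_fin => /andP[h _]; rewrite -lerBlDr sub0r.
  have mGM : measurable_fun (bergman_ball z r) (fun w => (G w + M)%:E).
    by apply/measurable_EFinP; apply: measurable_funD.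
  have := Fc _ mGM G0 => /(congr1 fine).
  have -> : fine (\int[volume]_(w in bergman_ball z r) (G w + M)%:E)%E =
    \int[volume]_(w in bergman_ball z r) G w + M * (c * fine (volume B)).
    rewrite -/(Rintegral volume _ (fun w => G w + M)) RintegralD//; last exact: cz.
    by rewrite -vzE; congr (_ + _); exact: rcst.
  have fB : (\int[volume]_(w in B) (G (sg z w) + M)%:E)%E \is a fin_num.
    apply: integrable_fin_num => //.
    apply: (@eq_integrable _ _ _ volume _ mB (fun w => (G (sg z w))%:E + M%:E)%E) => //.
    by apply: integrableD => //; exact: cz.
  rewrite fineM//= -/(Rintegral volume _ (fun w => G (sg z w) + M)) RintegralD//; last exact: cz.
  have := rcst _ M mB; set I1 := Rintegral _ _ _ => ->.
  by rewrite mulrDr mulrCA; exact: addIr.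
have cI (g : Cn -> R[i]) : bmeas (bergman_ball z r) g -> bmeas B (g \o sg z) ->
    cintegral (bergman_ball z r) g = c%:C * cintegral B (g \o sg z).
  move=> [z1 z2 [M HM]] [b1 b2 _]; rewrite /cintegral.
  rewrite (RE (fun w => complex.Re (g w)) M)//; last first.
    by move=> w /HM; exact: le_trans (ler_Re_normc _).
  rewrite (RE (fun w => complex.Im (g w)) M)//; last first.
    by move=> w /HM; exact: le_trans (ler_Im_normc _).
  by apply/eqP; rewrite eq_complex/= !mul0r subr0 addr0 !eqxx.
have c0' : c%:C != 0 :> R[i] by rewrite -normc_gt0 normcR gtr0_norm.
have V0 := vol_ball_gt0.
have aE : mean r f z = mean r (f \o sg z) base.
  apply: (etrans (congr2 (fun x (y : R) => x / y%:C) (cI f bz bB) vzE)).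
  rewrite /mean /vol_ball [X in _ / X]rmorphM.
  by rewrite -mulf_div divff// mul1r.
rewrite /MO aE; congr Num.sqrt; set a := mean r _ base.
have bza := bmeasB bz (bmeas_cst _ a); have bBa := bmeasB bB (bmeas_cst _ a).
have [_ _ [M HM]] := bza.
apply: (etrans (congr2 (fun x y => x^-1 * y) vzE
  (RE (fun w => normc (f w - a) ^+ 2) (M ^+ 2) _ _ _))).
- exact: measurable_normc_sqr.
- exact: measurable_normc_sqr.
- move=> w /HM h; have n0 := normc_ge0 (f w - a).
  by rewrite normrX (ger0_norm n0) lerXn2r ?nnegrE ?(le_trans n0 h).
- rewrite mulrA; congr (_ * _); exact: invE.
Qed.

End ball.

End mean_oscillation.

(** * Mean oscillation against the invariant gradient *)

Section oscillation_estimates.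
Context {R : realType} {m : nat}.
Local Notation Cn := 'rV[R[i]]_m.+1.
Implicit Types (z w v : Cn) (f : Cn -> R[i]).

Lemma cgrad_subC n (f : 'rV[R[i]]_n -> R[i]) a (c : 'rV[R[i]]_n) g :
  cgrad f c g -> cgrad (fun w : 'rV[R[i]]_n => f w - a) c g.
Proof.
move=> fg e /fg[d d0 Hd]; exists d => // w /Hd.
by rewrite opprB addrA subrK.
Qed.

Definition sgrad f z w := gsg z (fun j => dz j f (sg z w)).

Lemma cgrad_sgrad f z w : holomorphic f -> siegel z -> siegel w ->
  cgrad (f \o sg z) w (sgrad f z w).
Proof.
by move=> hf sz sw; apply: cgrad_sg => //; apply: holomorphic_cgrad => //; exact: siegel_sg.
Qed.

Lemma ginv_sgrad f z w : siegel z -> ginv (sgrad f z w) w = invgrad f (sg z w).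
Proof. by move=> sz; rewrite ginv_sg. Qed.

Variables (r : R) (r0 : 0 < r).
Local Notation B := (bergman_ball (base : Cn) r).
Local Notation K := (@cball R m (kap r)).
Local Notation mB := (@measurable_bergman_ball_base R m r r0).

Lemma K_base : K base.
Proof.
by apply: ball_K => //; have [e e0] := @ball_cbox R m r r0; apply; exact/cbox_center/ltW.
Qed.

(** From left to right: the factor of [osc_le], the number of coordinates, the factor of
    [ginv_coord_le] with 4 / kap r as bound for the coordinates, and the resulting bound for |w_j -
    base_j|. *)
Definition cupper : R :=
  2 * ((m.+1)%:R * ((4 + 8 * (4 / kap r)) / kap r * (4 / kap r + 4 / kap r))).

Lemma cupper_gt0 : 0 < cupper.
Proof.
have k0 := kap_gt0 r; have k4 : 0 < 4 / kap r by rewrite divr_gt0.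
by rewrite mulr_gt0// mulr_gt0// ?ltr0n// mulr_gt0 ?addr_gt0// divr_gt0// addr_gt0// mulr_gt0.
Qed.

Lemma MO_le_invgrad f z S : holomorphic f -> siegel z -> 0 <= S ->
  (forall w, K w -> invgrad f (sg z w) <= S) -> MO r f z <= cupper * S.
Proof.
move=> hf sz S0 KS; have cf := holomorphic_fcont hf.
have k0 := kap_gt0 r; have k1 := kap_le1 r0.
rewrite MO_sg// /cupper.
set k := kap r in k0 k1 *; set M := 4 / k.
have M0 : 0 < M by rewrite divr_gt0.
set C := (4 + 8 * M) / k; have C0 : 0 < C by rewrite divr_gt0// addr_gt0// mulr_gt0.
rewrite (_ : 2 * _ * S = 2 * ((m.+1)%:R * (C * S * (M + M)))); last by ring.
apply: (@osc_le _ _ B mB (ball_volume r0) (vol_ball_gt0 r0) _ (f (sg z base))).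
- have M0' := ltW M0; have C0' := ltW C0.
  by rewrite mulr_ge0 ?ler0n// (mulr_ge0 (mulr_ge0 C0' S0))// addr_ge0.
- exact: (fcont_bmeas_ball r0 (fcont_sg sz cf)).
move=> w Bw.
(* Convexity keeps the segment from the base point inside the set on which the gradient is
   bounded. *)
have Kt t : 0 <= t <= 1 -> K (base + t%:C *: (w - base)).
  move=> t01; apply: cball_convex => //; [exact: ltW|exact: K_base|exact: ball_K].
apply: (@cgrad_mean_value _ _ (f \o sg z) base w
  (fun t => sgrad f z (base + t%:C *: (w - base)))) => t t01.
  by apply: cgrad_sgrad => //; apply: (K_siegel r0); exact: Kt.
have [kr kM] := cball_bounds k0 k1 (Kt t t01).
apply: normc_dot_le => [|j|j]; first by rewrite mulr_ge0// ltW.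
  apply: (le_trans (ginv_coord_le _ k0 k1 (ltW M0) (K_siegel r0 (Kt t t01)) kr kM j)).
  by rewrite ler_pM2l// ginv_sgrad//; apply: KS; exact: Kt.
rewrite (le_trans (ler_normcB _ _))//; apply: lerD.
  by have [_] := cball_bounds k0 k1 (ball_K r0 Bw); apply.
by have [_] := cball_bounds k0 k1 K_base; apply.
Qed.

Lemma invgrad_le_MO : exists2 C, 0 < C & forall f z, holomorphic f -> siegel z ->
  invgrad f z <= C * MO r f z.
Proof.
have [e e0 eB] := @ball_cbox R m r r0.
(* Half of the available size serves for the box about the base point, the other half for the boxes
   about its points in the mean value inequality. *)
pose s := e / 2; have s0 : 0 < s by rewrite divr_gt0.
pose V := fine (volume B); have V0 : 0 < V := vol_ball_gt0 r0.
(* The constant of [mean_value_cbox] when the integral of |h - a| is at most [t * V]. *)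
pose n := m.+1; pose A := 16 ^+ n * V / (s + s) ^+ (n + n).
have p0 : 0 < (s + s) ^+ (n + n) by rewrite exprn_gt0// addr_gt0.
have A0 : 0 < A by rewrite divr_gt0// mulr_gt0// exprn_gt0.
pose C := (4 + m%:R) * (4 * A / s).
have C0 : 0 < C by rewrite mulr_gt0 ?ltr_wpDr// divr_gt0// mulr_gt0.
exists C => // f z hf sz.
have cf := holomorphic_fcont hf; have cfz := fcont_sg sz cf.
rewrite MO_sg//; set h := f \o sg z in cfz *.
have bh := fcont_bmeas_ball r0 cfz.
set a := avg B h; have bha := bmeasB bh (bmeas_cst _ a).
(* A strict upper bound [t] is positive even when the oscillation is 0, so it may be divided by; it
   tends to the oscillation afterwards. *)
suff H t : osc B h < t -> invgrad f z <= C * t.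
  apply/ler_addgt0Pr => d d0.
  have := H (osc B h + d / C); rewrite ltrDl divr_gt0// => /(_ isT).
  by rewrite mulrDr [C * (d / C)]mulrC divfK ?gt_eqF.
move=> ot; have t0 : 0 < t by rewrite (le_lt_trans _ ot)// sqrtr_ge0.
have It := int_normc_le_osc mB (ball_volume r0) (vol_ball_gt0 r0) bh ot.
have pt w : cbox base s w -> normc (h w - a) <= A * t.
  move=> bw.
  have wB : cbox w s `<=` B.
    move=> v wv; apply: eB; rewrite (_ : e = s + s); last by rewrite /s; field.
    exact: cbox_trans bw wv.
  have [_ _ ia _] := bmeas_integrable mB (ball_volume r0) bha.
  have mn : measurable_fun B (fun v : Cn => (normc (h v - a))%:E).
    by apply/measurable_EFinP; exact: measurable_normc bha.
  have mw := @measurable_cbox R n w s.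
  have := @mean_value_cbox R n w s (fun v : Cn => h v - a) s0.
  have gD : cgrad_on (cbox w s) (fun v : Cn => h v - a).
    move=> v /wB Bv; exists (sgrad f z v); apply: cgrad_subC; apply: cgrad_sgrad => //.
    by case: Bv.
  move=> /(_ gD) H.
  have {}H := H ((measurable_restrictT _ mw).1 (measurable_funS mB wB mn)).
  have H2 : (\int[volume]_(w in cbox w s) (normc (h w - a))%:E <=
      (t * V)%:E)%E.
    apply: (@le_trans _ _ (\int[volume]_(w in B) (normc (h w - a))%:E)%E).
      apply: ge0_subset_integral; [exact: mw|exact: mB|exact: mn| |exact: wB] => v _.
      by rewrite lee_fin normc_ge0.
    rewrite -(fineK (integrable_fin_num mB ia)) lee_fin; exact: It.
  have p16 : (0 <= (16 ^+ n)%:E :> \bar R)%E by rewrite lee_fin exprn_ge0.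
  have := le_trans H (lee_wpmul2l p16 H2); rewrite -EFinM lee_fin => {}H.
  rewrite -(ler_pM2l p0) (le_trans H)// /A.
  rewrite (_ : _ * (16 ^+ n * V / _ * t) = 16 ^+ n * (t * V))//.
  by field; rewrite gt_eqF.
have At0 : 0 <= A * t by rewrite mulr_ge0 ?ltW.
have gE := ginv_sgrad f base sz; rewrite sg_base in gE; rewrite -gE.
apply: (@le_trans _ _ ((4 + m%:R) * (4 * (A * t) / s))).
  apply: ginv_base_le => [|j]; first by rewrite divr_ge0 ?(ltW s0)// mulr_ge0.
  apply: (@cauchy_grad _ _ (fun v : Cn => h v - a) base s) => //.
    move=> v bv; exists (sgrad f z v); apply: cgrad_subC; apply: cgrad_sgrad => //.
    have /eB[] // : cbox base e v by apply: cboxS bv; rewrite /s ler_pdivrMr// ler_pMr// ler1n.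
  apply: cgrad_subC; apply: cgrad_sgrad => //; exact: siegel_base.
rewrite le_eqVlt; apply/orP; left; apply/eqP; rewrite /C.
by field; rewrite gt_eqF.
Qed.

End oscillation_estimates.

(** * Continuity *)

Section continuity.
Context {R : realType} {m : nat}.
Local Notation Cn := 'rV[R[i]]_m.+1.
Local Notation wd := (widen_ord (leqnSn m)).
Implicit Types (z w v : Cn) (f : Cn -> R[i]).

Lemma cvg_near (h : Cn -> R) z : (fun x : Cn => h x) @ z --> h z ->
  forall e, 0 < e -> exists2 d, 0 < d & forall w, polydisc z d w -> `|h w - h z| < e.
Proof.
move=> hz e e0; have : nbhs z (h @^-1` ball (h z) e) by apply: hz; exact: nbhsx_ballx.
move=> /nbhs_polydiscP[d d0 Hd]; exists d => // w /Hd.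
by rewrite /ball/= distrC.
Qed.

Definition ccont (c : Cn -> R[i]) z :=
  (fun x : Cn => complex.Re (c x)) @ z --> complex.Re (c z) /\
  (fun x : Cn => complex.Im (c x)) @ z --> complex.Im (c z).

Lemma ccont_near c z : ccont c z -> forall e, 0 < e ->
  exists2 d, 0 < d & forall w, polydisc z d w -> normc (c w - c z) < e.
Proof.
move=> [c1 c2] e e0; have e2 : 0 < e / 2 by rewrite divr_gt0.
have [d1 d10 H1] := cvg_near c1 e2; have [d2 d20 H2] := cvg_near c2 e2.
exists (Num.min d1 d2); first by rewrite lt_min d10.
move=> w zw; rewrite (le_lt_trans (ler_normc_ReIm _))// !raddfB.
rewrite [ltRHS](_ : e = e / 2 + e / 2); last by field.
by apply: ltrD; [apply: H1|apply: H2] => j; rewrite (lt_le_trans (zw j))// ge_min lexx ?orbT.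
Qed.

Lemma near_ccont c z : (forall e, 0 < e ->
  exists2 d, 0 < d & forall w, polydisc z d w -> normc (c w - c z) < e) -> ccont c z.
Proof.
move=> H; split; apply: continuous_polydisc => e /H[d d0 Hd]; exists d => // w /Hd;
  apply: le_lt_trans; rewrite -raddfB; [exact: ler_Re_normc|exact: ler_Im_normc].
Qed.

Lemma ccontD c d z : ccont c z -> ccont d z -> ccont (fun x => c x + d x) z.
Proof.
move=> [c1 c2] [d1 d2]; split.
  rewrite (_ : (fun x => _) = fun x : Cn => complex.Re (c x) + complex.Re (d x)).
    by rewrite raddfD; exact: (cvgD c1 d1).
  by apply/funext => x; rewrite raddfD.
rewrite (_ : (fun x => _) = fun x : Cn => complex.Im (c x) + complex.Im (d x)).
  by rewrite raddfD; exact: (cvgD c2 d2).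
by apply/funext => x; rewrite raddfD.
Qed.

Lemma ccontM c d z : ccont c z -> ccont d z -> ccont (fun x => c x * d x) z.
Proof.
have ReM (x y : R[i]) : complex.Re (x * y) =
    complex.Re x * complex.Re y - complex.Im x * complex.Im y by case: x y => ? ? [].
have ImM (x y : R[i]) : complex.Im (x * y) =
    complex.Re x * complex.Im y + complex.Im x * complex.Re y by case: x y => ? ? [].
move=> [c1 c2] [d1 d2]; split.
  rewrite (_ : (fun x => _) = fun x : Cn => complex.Re (c x) * complex.Re (d x) -
      complex.Im (c x) * complex.Im (d x)); last by apply/funext => x; rewrite ReM.
  by rewrite ReM; exact: (cvgB (cvgM c1 d1) (cvgM c2 d2)).
rewrite (_ : (fun x => _) = fun x : Cn => complex.Re (c x) * complex.Im (d x) +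
    complex.Im (c x) * complex.Re (d x)); last by apply/funext => x; rewrite ImM.
by rewrite ImM; exact: (cvgD (cvgM c1 d2) (cvgM c2 d1)).
Qed.

Lemma ccont_cst a z : ccont (fun=> a) z.
Proof. by have FF : Filter (nbhs z) := nbhs_filter z; split; exact: cvg_cst. Qed.

Lemma ccont_real (h : Cn -> R) z : (fun x : Cn => h x) @ z --> h z ->
  ccont (fun x => (h x)%:C) z.
Proof.
by move=> hz; have FF : Filter (nbhs z) := nbhs_filter z; split; [exact: hz|exact: cvg_cst].
Qed.

Lemma ccont_coord j z : ccont (fun x => x 0 j) z.
Proof. by split; [exact: continuous_Re_coord|exact: continuous_Im_coord]. Qed.

Lemma ccont_conj c z : ccont c z -> ccont (fun x => (c x)^*%C) z.
Proof.
have ReC (x : R[i]) : complex.Re (x^*%C) = complex.Re x by case: x.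
have ImC (x : R[i]) : complex.Im (x^*%C) = - complex.Im x by case: x.
move=> [c1 c2]; split.
  by rewrite ReC (_ : (fun x => _) = fun x : Cn => complex.Re (c x))//; apply/funext => x; rewrite ReC.
rewrite ImC (_ : (fun x => _) = fun x : Cn => - complex.Im (c x)); first exact: (cvgN c2).
by apply/funext => x; rewrite ImC.
Qed.

Lemma ccont_normc c z : ccont c z -> (fun x : Cn => normc (c x)) @ z --> normc (c z).
Proof.
move=> cz; apply: continuous_polydisc => e /(ccont_near cz)[d d0 Hd].
by exists d => // w /Hd; apply: le_lt_trans; exact: ler_dist_normc.
Qed.

Lemma continuous_sqrt_comp (h : Cn -> R) z : (fun x : Cn => h x) @ z --> h z ->
  (fun x : Cn => Num.sqrt (h x)) @ z --> Num.sqrt (h z).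
Proof.
move=> hz; have FF : Filter (nbhs z) := nbhs_filter z.
by apply: continuous_cvg hz; exact: sqrt_continuous.
Qed.

Lemma continuous_invgrad f z : holomorphic f -> siegel z ->
  (fun x : Cn => invgrad f x) @ z --> invgrad f z.
Proof.
move=> hf sz; apply: continuous_sqrt_comp.
have FF : Filter (nbhs z) := nbhs_filter z.
have dzc j : ccont (fun x => dz j f x) z.
  have [d d0 zd] := siegel_polydisc sz.
  have hd : exists2 d, 0 < d & cgrad_on (polydisc z d) f.
    exists d => // w /zd sw; eexists; exact: holomorphic_cgrad.
  apply: near_ccont => e e0.
  have [d' d'0 Hd'] := cgrad_continuous hd (holomorphic_cgrad hf sz) e0.
  exists (Num.min d d'); first by rewrite lt_min d0.
  move=> w zw; apply: (Hd' w (fun j => dz j f w)).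
    by move=> k; rewrite (lt_le_trans (zw k))// ge_min lexx orbT.
  apply: holomorphic_cgrad => //; apply: zd => k.
  by rewrite (lt_le_trans (zw k))// ge_min lexx.
have cr := @continuous_rho R m z.
have ck (a : R) : (fun=> a) x @[x --> z] --> a by exact: cvg_cst.
have sq (c : Cn -> R[i]) : ccont c z ->
    (fun x : Cn => normc (c x) ^+ 2) @ z --> normc (c z) ^+ 2.
  move=> /ccont_normc cz; rewrite expr2.
  by under eq_fun do rewrite expr2; exact: (cvgM cz cz).
have cS : \sum_(j < m) normc (dz (wd j) f x + 2 * 'i * (hd x j)^*%C * dz ord_max f x) ^+ 2
    @[x --> z] -->
    \sum_(j < m) normc (dz (wd j) f z + 2 * 'i * (hd z j)^*%C * dz ord_max f z) ^+ 2.
  apply: cvg_big => [|j _]; first exact: add_continuous.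
  apply: sq; apply: ccontD => //; apply: ccontM => //; apply: ccontM.
    exact: ccont_cst.
  by apply: ccont_conj; exact: ccont_coord.
exact: (cvgM (cvgM (ck 2) cr) (cvgD (cvgM (cvgM (ck 4) cr) (sq _ (dzc ord_max))) cS)).
Qed.

End continuity.

(** * Continuity of the mean oscillation *)

Section continuity_of_oscillation.
Context {R : realType} {m : nat}.
Local Notation Cn := 'rV[R[i]]_m.+1.
Implicit Types (z w v : Cn) (f : Cn -> R[i]).

(** [sg z w] is affine in w with coefficients continuous in z, so convergence as z tends to [z0] is
    uniform for bounded w. *)
Lemma sg_near z0 (delta L : R) : 0 < delta -> 0 <= L ->
  exists2 d, 0 < d & forall z, polydisc z0 d z -> forall w,
    (forall j, normc (w 0 j) <= L) -> polydisc (sg z0 w) delta (sg z w).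
Proof.
(* If the coefficients move by less than [e], the first coordinates move by less than e (1 + L) and
   the last one by at most e (2 + L + 2 m L); the spare [e] makes the bound strict. *)
move=> delta0 L0; pose e := delta / (3 + L + 2 * m%:R * L).
have D0 : 0 < 3 + L + 2 * m%:R * L by rewrite ltr_wpDr ?mulr_ge0 ?ler0n// ltr_wpDr.
have e0 : 0 < e by rewrite divr_gt0.
have FF : Filter (nbhs z0) := nbhs_filter z0.
have N c : ccont c z0 -> nbhs z0 [set z | normc (c z - c z0) < e].
  by move=> cc; apply/nbhs_polydiscP; exact: ccont_near cc _ e0.
have cr := ccont_real (@continuous_rho R m z0).
have cs := ccont_real (continuous_sqrt_comp (@continuous_rho R m z0)).
have N1 : nbhs z0 [set z : Cn | forall k, normc (z 0 k - z0 0 k) < e].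
  have := @filter_forall Cn 'I_m.+1 (fun k (z : Cn) => normc (z 0 k - z0 0 k) < e) _ FF.
  by apply => k; apply: (N (fun z : Cn => z 0 k)); exact: ccont_coord.
have N4 : nbhs z0 [set z : Cn | forall j, normc ((scl z)%:C * (hd z j)^*%C
    - (scl z0)%:C * (hd z0 j)^*%C) < e].
  have := @filter_forall Cn 'I_m (fun j (z : Cn) => normc ((scl z)%:C * (hd z j)^*%C
    - (scl z0)%:C * (hd z0 j)^*%C) < e) _ FF.
  apply => j; apply: (N (fun z : Cn => (scl z)%:C * (hd z j)^*%C)).
  by apply: ccontM => //; apply: ccont_conj; exact: ccont_coord.
have [d d0 Hd] := (nbhs_polydiscP _ _).1 (filterI N1 (filterI (N _ cr) (filterI (N _ cs) N4))).
exists d => // z /Hd[h1 [/= h2 [h3 h4]]] w wL.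
have {}h2 := ltW h2; have {}h3 := ltW h3.
have eE : delta = e * (3 + L + 2 * m%:R * L) by rewrite divfK// gt_eqF.
move=> k; case: (unliftP ord_max k) => [j|] -> {k}.
  rewrite -widen_lift -/(hd _ j) -/(hd _ j) !hd_mkC.
  rewrite (_ : _ - _ = (hd z j - hd z0 j) + ((scl z)%:C - (scl z0)%:C) * hd w j); last by ring.
  apply: (le_lt_trans (le_normcD _ _)); rewrite normcM.
  apply: (@le_lt_trans _ _ (e + e * L)).
    apply: lerD; first exact: ltW (h1 _).
    by apply: ler_pM; [exact: normc_ge0|exact: normc_ge0|exact: h3|exact: wL].
  rewrite eE -[X in X + _]mulr1 -mulrDr ltr_pM2l//.
  have : 0 <= 2 * m%:R * L by rewrite !mulr_ge0.
  by lra.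
rewrite -/(lst _) -/(lst _) !lst_mkC.
rewrite (_ : _ - _ = (lst z - lst z0) + (((rho z)%:C - (rho z0)%:C) * (lst w - 'i)
  + 2 * 'i * \sum_(j < m) hd w j * ((scl z)%:C * (hd z j)^*%C - (scl z0)%:C * (hd z0 j)^*%C))); last first.
  have -> : \sum_(j < m) hd w j * ((scl z)%:C * (hd z j)^*%C - (scl z0)%:C * (hd z0 j)^*%C)
      = (scl z)%:C * \sum_(j < m) hd w j * (hd z j)^*%C
        - (scl z0)%:C * \sum_(j < m) hd w j * (hd z0 j)^*%C.
    by rewrite !mulr_sumr -sumrB; apply: eq_bigr => j _; ring.
  by ring.
apply: (le_lt_trans (le_normcD _ _)).
apply: (@le_lt_trans _ _ (e + (e * (L + 1) + 2 * (m%:R * (L * e))))); last first.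
  by rewrite eE -subr_gt0 (_ : _ - _ = e)//; ring.
apply: lerD; first exact: ltW (h1 _).
apply: (le_trans (le_normcD _ _)); apply: lerD.
  rewrite normcM; apply: ler_pM; [exact: normc_ge0|exact: normc_ge0|exact: h2|].
  by rewrite (le_trans (ler_normcB _ _))// normci lerD2r; exact: wL.
rewrite !normcM normci normc2 mulr1 ler_pM2l//.
rewrite (le_trans (ler_normc_sum _ _ _))// natr_mul_sum; apply: ler_sum => j _.
rewrite normcM; apply: ler_pM; [exact: normc_ge0|exact: normc_ge0|exact: wL|].
exact: ltW (h4 j).
Qed.

(** Uniform continuity near the compact image of [K]: for each point of [K] one radius serves a
    whole neighbourhood, and compactness gives a common one. *)
Lemma fcont_sg_uniform f z0 (K : set Cn) : fcont f -> siegel z0 -> compact K ->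
  K `<=` siegel -> forall e, 0 < e -> exists2 delta, 0 < delta & forall w, K w ->
  forall v, polydisc (sg z0 w) delta v -> normc (f v - f (sg z0 w)) < e.
Proof.
move=> cf sz cK Ks e e0.
pose P (delta : R) (w : Cn) := forall v,
  polydisc (sg z0 w) delta v -> normc (f v - f (sg z0 w)) < e.
have : \forall delta \near 0^'+, K `<=` P delta.
  have /compact_near_coveringP H := cK; apply: H => w0 Kw0.
  have e2 : 0 < e / 2 by rewrite divr_gt0.
  have [d d0 Hd] := cf _ (siegel_sg sz (Ks _ Kw0)) _ e2.
  have [C C0 HC] := nrm1_sg sz.
  pose n := (m.+1)%:R : R; have n0 : 0 < n by rewrite ltr0n.
  pose t := d / (4 * (C * n)).
  have t0 : 0 < t by rewrite divr_gt0// !mulr_gt0.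
  exists (polydisc w0 t, [set x | x < d / 2]).
    split; first by apply/nbhs_polydiscP; exists t.
    by apply: nbhs_right_lt; rewrite divr_gt0.
  move=> [w delta] [/= ww dd] v wv.
  have w1 : polydisc (sg z0 w0) (d / 2) (sg z0 w).
    apply: nrm1_polydisc; apply: (le_lt_trans (HC _ _)).
    apply: (@le_lt_trans _ _ (C * (n * t))).
      by rewrite ler_pM2l//; exact: polydisc_nrm1.
    rewrite (_ : C * (n * t) = d / 4); last by rewrite /t; field; rewrite !gt_eqF.
    by rewrite ltr_pM2l// ltf_pV2 ?posrE// ltr_nat.
  have v1 : polydisc (sg z0 w0) d v.
    move=> j; rewrite (_ : v 0 j - _ = (v 0 j - sg z0 w 0 j) + (sg z0 w 0 j - sg z0 w0 0 j)); last by ring.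
    apply: (le_lt_trans (le_normcD _ _)).
    rewrite (_ : d = d / 2 + d / 2); last by field.
    by apply: ltrD => //; apply: lt_trans (wv j) dd.
  have w2 : polydisc (sg z0 w0) d (sg z0 w).
    by move=> j; apply: (lt_trans (w1 j)); rewrite ltr_pdivrMr// ltr_pMr// ltr1n.
  rewrite (_ : f v - _ = (f v - f (sg z0 w0)) - (f (sg z0 w) - f (sg z0 w0))); last by ring.
  apply: (le_lt_trans (ler_normcB _ _)); rewrite (_ : e = e / 2 + e / 2); last by field.
  by apply: ltrD; exact: Hd.
move=> H; have [delta [/= delta0 Hd]] := filter_ex (filterI (nbhs_right_gt 0) H).
by exists delta.
Qed.

Variables (r : R) (r0 : 0 < r).
Local Notation B := (bergman_ball (base : Cn) r).
Local Notation K := (@cball R m (kap r)).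

(** After pulling back, only the function varies and not the ball: [f \o sg z] tends to [f \o sg z0]
    uniformly on [B], and [osc_dist] applies in both directions. *)
Lemma continuous_MO f z0 : fcont f -> siegel z0 ->
  (fun z : Cn => MO r f z) @ z0 --> MO r f z0.
Proof.
move=> cf sz.
have fin (X x y : R) e : x <= y + X -> y <= x + X -> X < e -> `|x - y| < e.
  by rewrite ltr_norml; lra.
have MOE z : MO r f z = Num.sqrt (MO r f z ^+ 2) by rewrite sqrtr_sqr ger0_norm// sqrtr_ge0.
rewrite MOE; under eq_fun do rewrite MOE; apply: continuous_sqrt_comp.
apply: continuous_polydisc => e e0.
have k0 := kap_gt0 r; have k1 := kap_le1 r0.
have [M0 HM0] := fcont_bounded (fcont_sg sz cf) (compactK r0) (K_siegel r0).
(* The extra 1 lets [M] bound [f \o sg z] too, which differs from [f \o sg z0] by less than t <=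
   1. *)
pose M := `|M0| + 1; have M1 : 0 < M by rewrite ltr_wpDl.
(* From t <= 1 one gets t^2 <= t, so the error of [osc_dist] is at most t (8 M + 4) <= e/2. *)
pose t := Num.min 1 (e / (2 * (8 * M + 4))).
have A0 : 0 < 8 * M + 4 by rewrite addr_gt0// mulr_gt0.
have t0 : 0 < t by rewrite lt_min ltr01 divr_gt0// mulr_gt0.
have t1 : t <= 1 by rewrite ge_min lexx.
have te : 8 * t * M + 4 * t ^+ 2 < e.
  have tt : t ^+ 2 <= t by rewrite expr2 ler_piMr// ltW.
  have : t * (8 * M + 4) <= e / 2.
    rewrite -ler_pdivlMr// (_ : e / 2 / _ = e / (2 * (8 * M + 4))).
      by rewrite ge_min lexx orbT.
    by field; rewrite gt_eqF.
  by move: e0 tt; rewrite -!(mulrC t) mulrDr; lra.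
have [delta delta0 Hf] := fcont_sg_uniform cf sz (compactK r0) (K_siegel r0) t0.
have kL : 0 <= 4 / kap r by rewrite divr_ge0// ltW.
have [d d0 Hd] := @sg_near z0 delta (4 / kap r) delta0 kL.
have [d' d'0 Hd'] := siegel_polydisc sz.
exists (Num.min d d'); first by rewrite lt_min d0.
move=> z zz.
have sz' : siegel z by apply: Hd' => j; rewrite (lt_le_trans (zz j))// ge_min lexx orbT.
have zd : polydisc z0 d z by move=> j; rewrite (lt_le_trans (zz j))// ge_min lexx.
rewrite !(MO_sg r0 _ cf)//.
have cl w : B w -> normc (f (sg z w) - f (sg z0 w)) < t.
  move=> Bw; have Kw := ball_K r0 Bw; apply: Hf => //; apply: Hd => //.
  by have [_] := cball_bounds k0 k1 Kw.
have b1 := fcont_bmeas_ball r0 (fcont_sg sz' cf).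
have b2 := fcont_bmeas_ball r0 (fcont_sg sz cf).
have M2 w : B w -> normc ((f \o sg z0) w) <= M.
  by move=> /(ball_K r0)/HM0 h; rewrite (le_trans h)// (le_trans (ler_norm _))// lerDl.
have M3 w : B w -> normc ((f \o sg z) w) <= M.
  move=> Bw; have h := HM0 _ (ball_K r0 Bw); have c := cl _ Bw.
  have -> : (f \o sg z) w = (f (sg z w) - f (sg z0 w)) + (f \o sg z0) w by rewrite /= subrK.
  rewrite (le_trans (le_normcD _ _))// addrC; apply: lerD.
    exact: le_trans h (ler_norm _).
  exact: le_trans (ltW c) t1.
have mB := @measurable_bergman_ball_base R m r r0.
have o1 := osc_dist mB (ball_volume r0) (vol_ball_gt0 r0) (ltW t0) b1 b2 M2 (fun w Bw => ltW (cl w Bw)).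
have o2 := osc_dist mB (ball_volume r0) (vol_ball_gt0 r0) (ltW t0) b2 b1 M3.
have {}o2 : osc B (f \o sg z0) ^+ 2 <= osc B (f \o sg z) ^+ 2 + (8 * t * M + 4 * t ^+ 2).
  by apply: o2 => w Bw; rewrite normc_distC; exact/ltW/cl.
exact: fin o1 o2 te.
Qed.

End continuity_of_oscillation.

(** * Decay at the boundary *)

Section decay.
Context {R : realType} {m : nat}.
Local Notation Cn := 'rV[R[i]]_m.+1.
Implicit Types (z w v : Cn) (f : Cn -> R[i]) (phi psi : Cn -> R).

(** The decay half of [C0], stated for real functions and separated from continuity: it passes to
    smaller functions, which continuity does not. *)
Definition vanish phi :=
  (forall e, 0 < e -> exists2 d, 0 < d & forall z, siegel z -> rho z < d -> phi z < e) /\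
  (forall e, 0 < e -> exists M, forall z, siegel z -> M < enorm z -> phi z < e).

Lemma C0_vanish phi : (forall z, 0 <= phi z) -> C0 (fun z => (phi z)%:C) -> vanish phi.
Proof.
move=> p0 [_ h1 h2]; split=> e e0.
  have [d d0 Hd] := h1 e e0; exists d => // z sz zd.
  by have := Hd z sz zd; rewrite normcR ger0_norm.
have [M HM] := h2 e e0; exists M => z sz zM.
by have := HM z sz zM; rewrite normcR ger0_norm.
Qed.

Lemma vanish_C0 phi : (forall z, 0 <= phi z) ->
  (forall z, siegel z -> (fun x : Cn => phi x) @ z --> phi z) ->
  vanish phi -> C0 (fun z => (phi z)%:C).
Proof.
move=> p0 pc [h1 h2]; split.
- apply: continuous_in_subspaceT => z /[!inE] sz A /nbhs_ballP[e /= e0 eA].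
  have e0' : 0 < complex.Re e by move: e0; rewrite ltcE => /andP[].
  have [d d0 Hd] := cvg_near (pc z sz) e0'.
  apply/nbhs_polydiscP; exists d => // w /Hd h; apply: eA.
  rewrite /ball/= normc_def2 -rmorphB normcR distrC.
  by move: e0; rewrite !ltcE/= => /andP[-> _].
- move=> e e0; have [d d0 Hd] := h1 e e0; exists d => // z sz zd.
  by rewrite normcR ger0_norm//; exact: Hd.
- move=> e e0; have [M HM] := h2 e e0; exists M => z sz zM.
  by rewrite normcR ger0_norm//; exact: HM.
Qed.

Lemma vanish_le C phi psi : 0 < C ->
  (forall z, siegel z -> phi z <= C * psi z) -> vanish psi -> vanish phi.
Proof.
move=> C0 pp [h1 h2]; split=> e e0; have eC : 0 < e / C by rewrite divr_gt0.
  have [d d0 Hd] := h1 _ eC; exists d => // z sz zd.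
  by rewrite (le_lt_trans (pp z sz))// mulrC -ltr_pdivlMr//; exact: Hd.
have [M HM] := h2 _ eC; exists M => z sz zM.
by rewrite (le_lt_trans (pp z sz))// mulrC -ltr_pdivlMr//; exact: HM.
Qed.

Lemma ler_normc_enorm z j : normc (z 0 j) <= enorm z.
Proof.
have h : 0 <= \sum_k normc (z 0 k) ^+ 2 by rewrite sumr_ge0// => k _; exact: sqr_ge0.
rewrite -(@ler_pXn2r _ 2)// ?nnegrE ?normc_ge0 ?sqrtr_ge0// sqr_sqrtr//.
by rewrite (bigD1 j)//= lerDl sumr_ge0// => k _; exact: sqr_ge0.
Qed.

Lemma enorm_le_sum z : enorm z <= \sum_k normc (z 0 k).
Proof.
have h k : 0 <= normc (z 0 k) := normc_ge0 _.
have h2 : 0 <= \sum_k normc (z 0 k) by rewrite sumr_ge0.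
rewrite -(@ler_pXn2r _ 2)// ?nnegrE ?sqrtr_ge0// sqr_sqrtr; last first.
  by rewrite sumr_ge0// => k _; exact: sqr_ge0.
rewrite [leRHS]expr2 mulr_suml; apply: ler_sum => k _.
by rewrite expr2 ler_wpM2l// (bigD1 k)//= lerDl sumr_ge0.
Qed.

(** Off the compact set where rho >= d and the coordinates are bounded the function is below 1. This
    is what puts a holomorphic VMO function into the Bloch space. *)
Lemma vanish_bounded phi :
  (forall z, siegel z -> (fun x : Cn => phi x) @ z --> phi z) ->
  vanish phi -> exists M, forall z, siegel z -> phi z <= M.
Proof.
move=> pc [h1 h2]; have [d d0 Hd] := h1 1 ltr01; have [M HM] := h2 1 ltr01.
pose K : set Cn := cbox 0 `|M| `&` [set z | d <= rho z].
have cK : compact K.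
  apply: compact_closedI; first exact: compact_cbox.
  rewrite (_ : mkset _ = @rho R m @^-1` [set x | d <= x])//.
  by apply: closed_comp; [move=> z _; exact: continuous_rho|exact: closed_ge].
have Ks z : K z -> siegel z by move=> [_ dz]; apply/siegel_rho; exact: lt_le_trans d0 dz.
have [N HN] := continuous_bounded cK (fun z Kz => pc z (Ks z Kz)).
exists (`|N| + 1) => z sz.
have [dz|dz] := ltP (rho z) d; first by rewrite (le_trans (ltW (Hd z sz dz)))// lerDr.
have [Mz|Mz] := ltP M (enorm z); first by rewrite (le_trans (ltW (HM z sz Mz)))// lerDr.
have Kz : K z.
  split=> // j; apply: normc_csquare; rewrite mxE subr0.
  by rewrite (le_trans (ler_normc_enorm z j))// (le_trans Mz)// ler_norm.
rewrite (le_trans (ler_norm _))// (le_trans (HN z Kz))// (le_trans (ler_norm _))//.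
by rewrite lerDl.
Qed.

Variables (r : R) (r0 : 0 < r).
Local Notation K := (@cball R m (kap r)).

(** The contrapositive is what matters: [sg z w] goes to infinity with z, uniformly for w in [K]. *)
Lemma enorm_sg_bounded M : exists M', forall z w, siegel z -> K w ->
  enorm (sg z w) <= M -> enorm z <= M'.
Proof.
have k0 := kap_gt0 r; have k1 := kap_le1 r0; pose L := 4 / kap r.
have L0 : 0 < L by rewrite divr_gt0.
(* [T] bounds rho z, because rho z * rho w is at most the imaginary part of the last coordinate of
   [sg z w]; being at least 1, it also bounds [scl z]. Solving for z then gives [A] for z' and [N]
   for the last coordinate. *)
pose T := 1 + `|M| * L; pose A := `|M| + T * L.
have T1 : 1 <= T by rewrite lerDl mulr_ge0// ltW.
have T0 : 0 < T by rewrite (lt_le_trans _ T1).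
have A0 : 0 <= A by rewrite addr_ge0// mulr_ge0// ltW.
pose N := `|M| + (T * (L + 1) + 2 * (T * (m%:R * (L * A)))).
exists (\sum_(k < m.+1) (A + N)) => z w sz Kw uM.
have [kr wL] := cball_bounds k0 k1 Kw; rewrite -/L in wL.
have uj j : normc (sg z w 0 j) <= `|M|.
  by rewrite (le_trans (ler_normc_enorm _ _))// (le_trans uM)// ler_norm.
have z0 : 0 < rho z by apply/siegel_rho.
have rz : rho z <= T.
  have h : rho z * (kap r / 4) <= `|M|.
    apply: (le_trans _ (uj ord_max)).
    rewrite (le_trans _ (le_trans (ler_norm _) (ler_Im_normc _)))//.
    rewrite (le_trans _ (rho_le_Im _))// rho_sg// ler_pM2l//.
  have : rho z <= `|M| * L by rewrite -ler_pdivrMr// invf_div.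
  by rewrite /T; lra.
have s0 := scl_gt0 sz; have ss := scl_sqr sz.
have sT : scl z <= T.
  rewrite -(@ler_pXn2r _ 2)// ?nnegrE ?(ltW s0) ?(ltW T0)// ss (le_trans rz)//.
  by rewrite expr2 ler_peMr// ltW.
have hA j : normc (hd z j) <= A.
  have -> : hd z j = hd (sg z w) j - (scl z)%:C * hd w j by rewrite hd_mkC addrK.
  rewrite (le_trans (ler_normcB _ _))//; apply: lerD; first exact: uj.
  rewrite normcM normcR gtr0_norm//.
  by apply: ler_pM; [exact: ltW|exact: normc_ge0|exact: sT|exact: wL].
have lN : normc (lst z) <= N.
  have -> : lst z = lst (sg z w) - ((rho z)%:C * (lst w - 'i)
        + 2 * 'i * (scl z)%:C * \sum_(j < m) hd w j * (hd z j)^*%C).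
    by rewrite lst_mkC -[X in X - _]addrA addrK.
  rewrite (le_trans (ler_normcB _ _))//; apply: lerD; first exact: uj.
  rewrite (le_trans (le_normcD _ _))//; apply: lerD.
    rewrite normcM normcR gtr0_norm//.
    apply: ler_pM; [exact: ltW|exact: normc_ge0|exact: rz|].
    by rewrite (le_trans (ler_normcB _ _))// normci lerD2r; exact: wL.
  rewrite !normcM normci normc2 normcR gtr0_norm// mulr1 -mulrA ler_pM2l//.
  apply: ler_pM; [exact: ltW|exact: normc_ge0|exact: sT|].
  rewrite (le_trans (ler_normc_sum _ _ _))// natr_mul_sum; apply: ler_sum => j _.
  rewrite normcM normc_conj.
  by apply: ler_pM; [exact: normc_ge0|exact: normc_ge0|exact: wL|exact: hA].
have N0 : 0 <= N := le_trans (normc_ge0 _) lN.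
apply: (le_trans (enorm_le_sum z)); apply: ler_sum => k _.
case: (unliftP ord_max k) => [j|] ->.
  by rewrite -widen_lift (le_trans (hA j))// lerDl.
by rewrite (le_trans lN)// lerDr.
Qed.

Lemma vanish_MO f : holomorphic f -> vanish (invgrad f) -> vanish (MO r f).
Proof.
move=> hf [h1 h2]; have c0 := @cupper_gt0 R m r.
have k0 := kap_gt0 r; have k1 := kap_le1 r0.
pose t e := e / (2 * cupper (m := m) r).
have t0 e : 0 < e -> 0 < t e by move=> e0; rewrite divr_gt0// mulr_gt0.
have H e z : 0 < e -> siegel z ->
    (forall w, K w -> invgrad f (sg z w) < t e) -> MO r f z < e.
  move=> e0 sz zt; apply: (@le_lt_trans _ _ (cupper (m := m) r * t e)).
    by apply: MO_le_invgrad => //; [exact/ltW/t0|move=> w /zt/ltW].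
  rewrite (_ : _ * t e = e / 2); last by rewrite /t; field; rewrite gt_eqF.
  by rewrite ltr_pdivrMr// ltr_pMr// ltr1n.
split=> e e0.
- have [d d0 Hd] := h1 _ (t0 e e0).
  (* On [K] rho is at most 4 / kap r, and rho (sg z w) = rho z * rho w. *)
  exists (d * (kap r / 4)); first by rewrite !mulr_gt0// invr_gt0.
  move=> z sz zd; apply: H => // w Kw; have [kr wL] := cball_bounds k0 k1 Kw.
  have sw := K_siegel r0 Kw.
  apply: Hd; first exact: siegel_sg.
  rewrite rho_sg//; apply: (@le_lt_trans _ _ (rho z * (4 / kap r))).
    rewrite ler_pM2l; last exact/siegel_rho.
    apply: (le_trans (rho_le_Im w)).
    exact: le_trans (le_trans (ler_norm _) (ler_Im_normc _)) (wL ord_max).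
  by rewrite -ltr_pdivlMr ?divr_gt0// invf_div.
- have [M HM] := h2 _ (t0 e e0); have [M' HM'] := enorm_sg_bounded M.
  exists M' => z sz zM; apply: H => // w Kw.
  apply: HM; first by apply: siegel_sg => //; exact: (K_siegel r0).
  by rewrite ltNge; apply/negP => /(HM' z w sz Kw); rewrite leNgt zM.
Qed.

End decay.

(** * The two seminorms and the theorem *)

Section norms.
Context {R : realType} {m : nat} (r : R) (r0 : 0 < r).
Local Notation Cn := 'rV[R[i]]_m.+1.
Implicit Types (f : Cn -> R[i]).

Lemma invgrad_le_normBloch f z : siegel z -> ((invgrad f z)%:E <= normBloch f)%E.
Proof. by move=> sz; apply: ereal_sup_ubound; exists z. Qed.

Lemma MO_le_normBMO f z : siegel z -> ((MO r f z)%:E <= normBMO r f)%E.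
Proof. by move=> sz; apply: ereal_sup_ubound; exists z. Qed.

Lemma normBloch_le_BMO : exists2 C, 0 < C & forall f, holomorphic f ->
  (normBloch f <= C%:E * normBMO r f)%E.
Proof.
have [C C0 HC] := @invgrad_le_MO R m r r0; exists C => // f hf.
apply: ge_ereal_sup => _ [z sz <-]; rewrite (@le_trans _ _ (C * MO r f z)%:E)//.
  by rewrite lee_fin; exact: HC.
by rewrite EFinM lee_wpmul2l ?lee_fin ?(ltW C0)//; exact: MO_le_normBMO.
Qed.

Lemma normBMO_le_Bloch f : Bloch f ->
  (normBMO r f <= (cupper (m := m) r)%:E * normBloch f)%E.
Proof.
move=> [hf bf]; have c0 := @cupper_gt0 R m r.
have b0 : (0 <= normBloch f)%E.
  apply: le_trans (invgrad_le_normBloch f siegel_base).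
  by rewrite lee_fin sqrtr_ge0.
(* A finite Bloch norm serves as the real bound in [MO_le_invgrad]. *)
have bE : normBloch f = (fine (normBloch f))%:E by rewrite fineK// ge0_fin_numE.
apply: ge_ereal_sup => _ [z sz <-]; rewrite bE -EFinM lee_fin.
apply: MO_le_invgrad => // [|w Kw]; first exact: fine_ge0.
by rewrite -lee_fin -bE; apply: invgrad_le_normBloch; apply: siegel_sg => //; exact: (K_siegel r0).
Qed.

End norms.

Theorem theorem1p3 (R : realType) (m : nat) (r : R) (hr : 0 < r) :
  [/\ @Bloch R m = holomorphic `&` BMO r,
      @Bloch0 R m = holomorphic `&` VMO r &
      exists c1 c2 : R, [/\ 0 < c1, 0 < c2 &
        forall f : 'rV[R[i]]_m.+1 -> R[i], Bloch f ->
          (normBloch f <= c1%:E * normBMO r f)%E /\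
          (normBMO r f <= c2%:E * normBloch f)%E]].
Proof.
have [C C0 HC] := @normBloch_le_BMO R m r hr.
have c0 := @cupper_gt0 R m r.
have invgrad_ge0 (f : 'rV[R[i]]_m.+1 -> R[i]) z : 0 <= invgrad f z by exact: sqrtr_ge0.
have MO_ge0 (f : 'rV[R[i]]_m.+1 -> R[i]) z : 0 <= MO r f z by exact: sqrtr_ge0.
split.
- apply/seteqP; split=> [f bf|f [hf [_ bf]]].
    have [hf fb] := bf; split=> //; split; first exact/fcont_L2loc/holomorphic_fcont.
    by rewrite (le_lt_trans (normBMO_le_Bloch hr bf))// lte_mul_pinfty ?lee_fin ?(ltW c0).
  by split=> //; rewrite (le_lt_trans (HC f hf))// lte_mul_pinfty ?lee_fin ?(ltW C0).
- apply/seteqP; split=> [f [[hf bf] f0]|f [hf [_ f0]]].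
    have cf := holomorphic_fcont hf; split=> //; split; first exact: fcont_L2loc.
    apply: vanish_C0 => // [z sz|]; first exact: continuous_MO.
    by apply: vanish_MO => //; exact: C0_vanish.
  have [D D0 HD] := @invgrad_le_MO R m r hr.
  have ic z : siegel z -> (fun x : 'rV[R[i]]_m.+1 => invgrad f x) @ z --> invgrad f z.
    exact: continuous_invgrad.
  (* Decay comes first, from the pointwise estimate; boundedness of the invariant gradient, required
     for membership in the Bloch space, is then a consequence. *)
  have vf : vanish (invgrad f).
    by apply: (vanish_le D0 (fun z sz => HD f z hf sz)); exact: C0_vanish.
  split; last exact: vanish_C0.
  split=> //; have [M HM] := vanish_bounded ic vf.
  apply: (@le_lt_trans _ _ M%:E); last exact: ltry.
  by apply: ge_ereal_sup => _ [z sz <-]; rewrite lee_fin HM.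
- exists C, (cupper (m := m) r); split=> // f bf; split.
    by apply: HC; case: bf.
  exact: normBMO_le_Bloch.
Qed.
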